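(* Let $A>0$ and consider $-y''+q(x)y=\lambda y$ on $[A,\infty)$ with the boundary condition $y(A)=0$, where $q(x)=\frac{q_0}{x^2}+\frac{q_1}{x}+\sum_{n=0}^\infty q_{n+2}x^n$ (real coefficients, series convergent on $(0,\infty)$, $q_0\ge -\tfrac14$, $q_0,q_1$ not both zero), and assume that for some $x_0>0$ either (a) $q\in L_1(x_0,\infty)$, or (b) $q'\in L_1(x_0,\infty)$, $q\in AC_{loc}[x_0,\infty)$ and $\lim_{x\to\infty}q(x)=0$. Let $U_1=(P_1,Q_1,R_1)^T$ be the unique solution of the Appell system with $\lim_{x\to\infty}U_1(x,\lambda)=(\sqrt\lambda,0,1/\sqrt\lambda)^T$, let $u,v$ and the real numbers $\tilde a(\lambda),\tilde b(\lambda),\tilde c(\lambda)$ be as in the context, and let $\alpha(\lambda)=-\frac{\tilde b}{2\tilde a}+i\frac{1}{\tilde a}$, $\alpha_2(\lambda)=\frac1{\tilde a(\lambda)}$. Then the spectral function $\rho_A$ is absolutely continuous on $(0,\infty)$, and for every $\lambda\in(0,\infty)$ its density $f_A(\lambda):=\rho_A'(\lambda)$ satisfies \[ f_A(\lambda)=\lim_{\epsilon\downarrow0}\frac1\pi\,\mathrm{Im}[m_A(\lambda+i\epsilon)]=\frac{\alpha_2(\lambda)}{\pi}=\frac{1}{\pi\tilde a(\lambda)}=\frac{1}{\pi\,[P_1(x,\lambda)v(x,\lambda)^2+Q_1(x,\lambda)v(x,\lambda)v'(x,\lambda)+R_1(x,\lambda)v'(x,\lambda)^2]}\] for every $x\ge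 A$.
   Context: The Appell system is $\frac{d}{dx}(P,Q,R)^T=M(x,\lambda)(P,Q,R)^T$ with $M=\begin{pmatrix}0&\lambda-q&0\\-2&0&2(\lambda-q)\\0&-1&0\end{pmatrix}$. Under the stated hypotheses on $q$ it is known that for every $\lambda\in(0,\infty)$ the Appell system has a unique solution $U_1$ with $\lim_{x\to\infty}U_1(x,\lambda)=(\sqrt\lambda,0,1/\sqrt\lambda)^T$. Let $u(\cdot,\lambda),v(\cdot,\lambda)$ be the solutions of $-y''+qy=\lambda y$ with $u(A)=1,u'(A)=0,v(A)=0,v'(A)=1$. Then $U_1$ can be written uniquely as $U_1=\tilde a\,((u')^2,-2uu',u^2)^T+\tilde b\,(u'v',-(uv'+u'v),uv)^T+\tilde c\,((v')^2,-2vv',v^2)^T$ with real $\tilde a(\lambda),\tilde b(\lambda),\tilde c(\lambda)$. The Titchmarsh–Weyl function $m_A(\lambda)$ ($\mathrm{Im}\lambda\ne0$) is the unique number with $u(\cdot,\lambda)+m_A(\lambda)v(\cdot,\lambda)\in L_2(A,\infty)$; the spectral function is $\rho_A(\lambda)=\lim_{\epsilon\downarrow0}\frac1\pi\int_0^\lambda\mathrm{Im}[m_A(t+i\epsilon)]\,dt$. *)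

(* Defs.v *)
From Stdlib Require Import Reals ClassicalEpsilon.
From Coquelicot Require Import Coquelicot.
Open Scope R_scope.

Fixpoint rsum (g : nat -> R) (n : nat) : R :=
  match n with O => 0 | S k => rsum g k + g k end.

Definition qfun (c : nat -> R) (x : R) : R :=
  c O / x ^ 2 + c 1%nat / x + Series (fun n => c (S (S n)) * x ^ n).

Definition abs_cont_on (f : R -> R) (a b : R) : Prop :=
  forall eps, 0 < eps -> exists delta, 0 < delta /\
    forall (n : nat) (s t : nat -> R),
      (forall i, (i < n)%nat -> a <= s i /\ s i <= t i /\ t i <= b) ->
      (forall i, (S i < n)%nat -> t i <= s (S i)) ->
      rsum (fun i => t i - s i) n < delta ->
      rsum (fun i => Rabs (f (t i) - f (s i))) n < eps.

Definition AC_loc_from (f : R -> R) (x0 : R) : Prop :=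
  forall b, x0 < b -> abs_cont_on f x0 b.

(* f in L1(x0, oo) (for continuous f: improper Riemann integrability of |f|) *)
Definition L1_from (f : R -> R) (x0 : R) : Prop :=
  ex_RInt_gen (fun x => Rabs (f x)) (at_point x0) (Rbar_locally p_infty).

(* y = y1 + i y2 (with derivative dy1 + i dy2) solves -y'' + q y = lam y on [A, oo) *)
Definition is_sol_C (q : R -> R) (A : R) (lam : C)
  (y1 y2 dy1 dy2 : R -> R) : Prop :=
  forall x, A <= x ->
    is_derive y1 x (dy1 x) /\ is_derive y2 x (dy2 x) /\
    is_derive dy1 x ((q x - Re lam) * y1 x + Im lam * y2 x) /\
    is_derive dy2 x ((q x - Re lam) * y2 x - Im lam * y1 x).

Definition L2_from (y1 y2 : R -> R) (A : R) : Prop :=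
  ex_RInt_gen (fun x => y1 x ^ 2 + y2 x ^ 2) (at_point A) (Rbar_locally p_infty).

(* m is the Titchmarsh-Weyl coefficient: u + m v in L2(A,oo), where u, v are
   the solutions with u(A)=1,u'(A)=0,v(A)=0,v'(A)=1. *)
Definition is_TW (q : R -> R) (A : R) (lam m : C) : Prop :=
  forall u1 u2 du1 du2 v1 v2 dv1 dv2 : R -> R,
    is_sol_C q A lam u1 u2 du1 du2 ->
    is_sol_C q A lam v1 v2 dv1 dv2 ->
    u1 A = 1 -> u2 A = 0 -> du1 A = 0 -> du2 A = 0 ->
    v1 A = 0 -> v2 A = 0 -> dv1 A = 1 -> dv2 A = 0 ->
    L2_from (fun x => u1 x + Re m * v1 x - Im m * v2 x)
            (fun x => u2 x + Re m * v2 x + Im m * v1 x) A.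

Definition mA (c : nat -> R) (A : R) (lam : C) : C :=
  epsilon (inhabits (RtoC 0)) (is_TW (qfun c) A lam).

Definition rho_approx (c : nat -> R) (A lam eps : R) : R :=
  / PI * RInt (fun t => Im (mA c A (t, eps))) 0 lam.

Definition rhoA (c : nat -> R) (A lam : R) : R :=
  epsilon (inhabits 0)
    (fun r => filterlim (rho_approx c A lam) (at_right 0) (locally r)).

Definition alpha (at_ bt : R -> R) (lam : R) : C :=
  (- bt lam / (2 * at_ lam), / at_ lam).
Definition alpha2 (at_ : R -> R) (lam : R) : R := / at_ lam.

(* Main.v *)
Require Import Defs.
From Stdlib Require Import Reals Lra Psatz ClassicalEpsilon Classical.
From Coquelicot Require Import Coquelicot.
Open Scope R_scope.

(* In the upper half-plane [m_A] is the value at [A] of [psi'/psi], where [psi = u + m v] is the Weyl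
   solution.  Wronskian and energy identities, integrated up to points where [psi] and [psi'] are small,
   show that [m_A] is holomorphic with nonnegative imaginary part.

   For [lam0 > 0] the Appell solution [U_1 = (P, Q, R)] satisfies [4 P R - Q^2 = 4], and the Hermitian form
   [P |y|^2 + Q Re(conj y y') + R |y'|^2 - 2 Im(conj y y') = R |y' - w y|^2], [w = (- Q/2 + i)/R], is
   conserved along solutions at [lam0].  For the Weyl solution at [lambda] near [lam0] it is small at a
   large [x], because there [psi'/psi] and [w] are both close to [i sqrt lam0] (a cone estimate for
   [psi' -+ i k psi], [k^2 = lambda] or [k^2 = lambda - q]).  Hence [m_A(lambda) -> w(A)] as
   [lambda -> lam0], with imaginary part [1/R(A)] and [R(A) = a~].

   For the spectral function one also needs the limit of the integrals of [Im m_A (. + i eps)] down to 0,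
   where [m_A] may be singular.  The imaginary part [V] of a second primitive of [m_A] is continuous up to
   the real axis and convex along horizontal lines, so its boundary values have one-sided derivatives at 0,
   and a barrier argument for harmonic functions shows that [V_x(0, eps)] tends to their mean. *)

(** A square-integrable [psi] need not tend to 0, and in case (a) [q] may be unbounded. So [psi'] is
    shown to be square integrable too, and Wronskians are evaluated only at selected far points
    where both are small. Each comparison adds to a Wronskian a multiple of [Im (conj psi psi')],
    whose rate of decrease [eps |psi|^2] pays for the error terms.

    The boundary value is approached uniformly from a half-neighbourhood of [lam0], not only
    vertically. Hence the density is continuous, and integrals of [Im m_A] are handled through a
    primitive [b] in place of an exchange of limit and integral; for positive [lam] the limit of
    [b lam] is then immediate.

    The delicate endpoint is 0, where the integral defining the spectral function starts and where
    [Im m_A] is only known to be [O(1/eps)]. Integrating this bound once leaves a logarithm, twice a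
    function that is continuous up to the axis; [Im m_A >= 0] makes that function convex, and
    convexity recovers the derivative lost by integrating twice. *)

Ltac sq_ge0 x := pose proof (pow2_ge_0 x).
Ltac abs_ge0 x := pose proof (Rabs_pos x).
Ltac min_le a b := pose proof (Rmin_l a b); pose proof (Rmin_r a b).
Ltac max_ge a b := pose proof (Rmax_l a b); pose proof (Rmax_r a b).
Ltac unball H := unfold ball in H; simpl in H; unfold AbsRing_ball, abs, minus, plus, opp in H; simpl in H.
Ltac unball_goal := unfold ball; simpl; unfold AbsRing_ball, abs, minus, plus, opp; simpl.

(** * One-variable calculus: derivatives, monotonicity, Gronwall *)

Lemma is_derive_eq (f : R -> R) (x l l' : R) : is_derive f x l -> l = l' -> is_derive f x l'.
Proof. intros H ->; exact H. Qed.

Lemma derC (c x : R) : is_derive (fun _ : R => c) x 0.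
Proof. apply @is_derive_const. Qed.

Lemma derI (x : R) : is_derive (fun t : R => t) x 1.
Proof. apply @is_derive_id. Qed.

Lemma derP (f g : R -> R) (x a b : R) :
  is_derive f x a -> is_derive g x b -> is_derive (fun t => f t + g t) x (a + b).
Proof. intros; now apply @is_derive_plus. Qed.

Lemma derN (f : R -> R) (x a : R) : is_derive f x a -> is_derive (fun t => - f t) x (- a).
Proof. intros; now apply @is_derive_opp. Qed.

Lemma derB (f g : R -> R) (x a b : R) :
  is_derive f x a -> is_derive g x b -> is_derive (fun t => f t - g t) x (a - b).
Proof. intros; now apply @is_derive_minus. Qed.

Lemma derM (f g : R -> R) (x a b : R) :
  is_derive f x a -> is_derive g x b ->
  is_derive (fun t => f t * g t) x (a * g x + f x * b).
Proof. intros; apply (is_derive_mult f g); auto. intros; apply Rmult_comm. Qed.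

Lemma derX2 (f : R -> R) (x a : R) :
  is_derive f x a -> is_derive (fun t => f t ^ 2) x (2 * f x * a).
Proof.
intros H; apply is_derive_ext with (fun t => f t * f t); [intros; simpl; ring|].
eapply is_derive_eq; [apply derM; eassumption|ring].
Qed.

Lemma derV (f : R -> R) (x a : R) : f x <> 0 ->
  is_derive f x a -> is_derive (fun t => / f t) x (- a / f x ^ 2).
Proof. intros; now apply is_derive_inv. Qed.

(** Differentiates by recursion on the shape of the function and takes the derivatives of opaque
    functions from the context; the value it produces is then reconciled through [is_derive_eq]. *)
Ltac der tac := first [ eassumption | lazymatch goal with
  | |- is_derive (fun _ => ?c) _ _ => apply derC
  | |- is_derive (fun t => t) _ _ => apply derI
  | |- is_derive (fun t => @?f t + @?g t) _ _ => eapply (derP f g); der tac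
  | |- is_derive (fun t => @?f t - @?g t) _ _ => eapply (derB f g); der tac
  | |- is_derive (fun t => - @?f t) _ _ => eapply (derN f); der tac
  | |- is_derive (fun t => @?f t * @?g t) _ _ => eapply (derM f g); der tac
  | |- is_derive (fun t => @?f t ^ 2) _ _ => eapply (derX2 f); der tac
  | _ => tac
  end ].

Lemma der_cont (f : R -> R) (x l : R) : is_derive f x l -> continuous f x.
Proof. intros H; apply @ex_derive_continuous; now exists l. Qed.

Lemma der_incr (f : R -> R) a b : a <= b ->
  (forall x, a <= x <= b -> exists l : R, is_derive f x l /\ 0 <= l) -> f a <= f b.
Proof.
intros ab H.
destruct (MVT_gen f a b (Derive f)) as (c & Hc & Hd).
- rewrite Rmin_left, Rmax_right by lra; intros x Hx.
  destruct (H x) as (l & Hl & _); [lra|]. apply Derive_correct; now exists l.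
- rewrite Rmin_left, Rmax_right by lra; intros x Hx.
  destruct (H x Hx) as (l & Hl & _).
  apply continuity_pt_filterlim; exact (der_cont _ _ _ Hl).
- rewrite Rmin_left, Rmax_right in Hc by lra.
  destruct (H c Hc) as (l & Hl & Hl0).
  rewrite (is_derive_unique _ _ _ Hl) in Hd. nra.
Qed.

Lemma der_decr (f : R -> R) a b : a <= b ->
  (forall x, a <= x <= b -> exists l : R, is_derive f x l /\ l <= 0) -> f b <= f a.
Proof.
intros ab H.
assert (- f a <= - f b); [|lra].
apply (der_incr (fun x => - f x)); auto.
intros x Hx; destruct (H x Hx) as (l & Hl & Hl0).
exists (- l); split; [der idtac|lra].
Qed.

Lemma der_zero (f : R -> R) a b : a <= b ->
  (forall x, a <= x <= b -> is_derive f x 0) -> f b = f a.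
Proof.
intros ab H; apply Rle_antisym; [apply der_decr|apply der_incr]; auto;
intros x Hx; exists 0; split; auto; lra.
Qed.

Lemma der_exp (L a x : R) : is_derive (fun t => exp (L * (t - a))) x (L * exp (L * (x - a))).
Proof. auto_derive; [auto|unfold Rminus; ring]. Qed.

Lemma gronwall_up (f : R -> R) (L a b : R) : a <= b ->
  (forall x, a <= x <= b -> exists l : R, is_derive f x l /\ l <= L * f x) ->
  f b <= f a * exp (L * (b - a)).
Proof.
intros ab H.
assert (Hm : f b * exp (- L * (b - a)) <= f a * exp (- L * (a - a))).
{ apply (der_decr (fun x => f x * exp (- L * (x - a)))); auto.
  intros x Hx; destruct (H x Hx) as (l & Hl & Hl0).
  eexists; split; [eapply derM; [exact Hl|apply der_exp]|].
  pose proof (exp_pos (- L * (x - a))). nra. }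
replace (- L * (a - a)) with 0 in Hm by ring; rewrite exp_0 in Hm.
replace (- L * (b - a)) with (- (L * (b - a))) in Hm by ring; rewrite exp_Ropp in Hm.
pose proof (exp_pos (L * (b - a))) as Hp.
apply (Rmult_le_compat_r (exp (L * (b - a)))) in Hm; [|lra].
rewrite Rmult_assoc, Rinv_l in Hm by lra. lra.
Qed.

Lemma gronwall_dn (f : R -> R) (L a b : R) : a <= b ->
  (forall x, a <= x <= b -> exists l : R, is_derive f x l /\ - L * f x <= l) ->
  f a * exp (- L * (b - a)) <= f b.
Proof.
intros ab H.
assert (Hm : - f b <= - f a * exp (- L * (b - a))).
{ apply (gronwall_up (fun x => - f x)); auto.
  intros x Hx; destruct (H x Hx) as (l & Hl & Hl0).
  exists (- l); split; [der idtac|lra]. }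
lra.
Qed.

Lemma cont_P (f g : R -> R) (x : R) : continuous f x -> continuous g x -> continuous (fun t => f t + g t) x.
Proof. intros; now apply @continuous_plus. Qed.
Lemma cont_B (f g : R -> R) (x : R) : continuous f x -> continuous g x -> continuous (fun t => f t - g t) x.
Proof. intros; now apply @continuous_minus. Qed.
Lemma cont_N (f : R -> R) (x : R) : continuous f x -> continuous (fun t => - f t) x.
Proof. intros; now apply @continuous_opp. Qed.
Lemma cont_M (f g : R -> R) (x : R) : continuous f x -> continuous g x -> continuous (fun t => f t * g t) x.
Proof. intros; now apply @continuous_mult. Qed.
Lemma cont_X2 (f : R -> R) (x : R) : continuous f x -> continuous (fun t => f t ^ 2) x.
Proof.
intros; apply continuous_ext with (fun t => f t * f t); [intros; simpl; ring|now apply cont_M].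
Qed.
Lemma cont_C (c x : R) : continuous (fun _ : R => c) x.
Proof. apply continuous_const. Qed.
Lemma cont_Abs (f : R -> R) (x : R) : continuous f x -> continuous (fun t => Rabs (f t)) x.
Proof.
intros H; apply (continuous_comp f Rabs); auto.
apply continuity_pt_filterlim, Rcontinuity_abs.
Qed.

Ltac cont tac := first [ assumption | lazymatch goal with
  | |- continuous (fun _ => ?c) _ => apply cont_C
  | |- continuous (fun t => @?f t + @?g t) _ => apply (cont_P f g); cont tac
  | |- continuous (fun t => @?f t - @?g t) _ => apply (cont_B f g); cont tac
  | |- continuous (fun t => - @?f t) _ => apply (cont_N f); cont tac
  | |- continuous (fun t => @?f t * @?g t) _ => apply (cont_M f g); cont tac
  | |- continuous (fun t => @?f t ^ 2) _ => apply (cont_X2 f); cont tac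
  | |- continuous (fun t => Rabs (@?f t)) _ => apply (cont_Abs f); cont tac
  | _ => tac
  end ].

(** * Integrals over half-lines *)

Lemma ex_RInt_from (f : R -> R) A a b :
  (forall x, A <= x -> continuous f x) -> A <= a -> A <= b -> ex_RInt f a b.
Proof.
intros H Ha Hb; apply (ex_RInt_continuous (V:=R_CompleteNormedModule)).
intros z Hz; apply H. unfold Rmin in Hz; destruct (Rle_dec a b); lra.
Qed.

Lemma RInt_from_nonneg (f : R -> R) A a b :
  (forall x, A <= x -> continuous f x) -> (forall x, A <= x -> 0 <= f x) ->
  A <= a -> a <= b -> 0 <= RInt f a b.
Proof.
intros H H0 Ha Hb; apply RInt_ge_0; auto.
- apply ex_RInt_from with A; auto; lra.
- intros; apply H0; lra.
Qed.

Lemma RInt_from_le (f g : R -> R) A a b :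
  (forall x, A <= x -> continuous f x) -> (forall x, A <= x -> continuous g x) ->
  (forall x, A <= x -> f x <= g x) ->
  A <= a -> a <= b -> RInt f a b <= RInt g a b.
Proof.
intros Hf Hg H0 Ha Hb; apply RInt_le; auto;
try (apply ex_RInt_from with A; auto; lra); intros; apply H0; lra.
Qed.

Lemma RInt_from_Chasles (f : R -> R) A a b c :
  (forall x, A <= x -> continuous f x) -> A <= a -> A <= b -> A <= c ->
  RInt f a c = RInt f a b + RInt f b c.
Proof.
intros Hf Ha Hb Hc; symmetry.
apply (RInt_Chasles f a b c); apply ex_RInt_from with A; auto.
Qed.

Lemma RInt_from_plus (f g : R -> R) A a b :
  (forall x, A <= x -> continuous f x) -> (forall x, A <= x -> continuous g x) ->
  A <= a -> A <= b -> RInt (fun x => f x + g x) a b = RInt f a b + RInt g a b.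
Proof.
intros Hf Hg Ha Hb; apply (RInt_plus f g a b); apply ex_RInt_from with A; auto.
Qed.

Lemma RInt_from_scal (f : R -> R) A k a b :
  (forall x, A <= x -> continuous f x) ->
  A <= a -> A <= b -> RInt (fun x => k * f x) a b = k * RInt f a b.
Proof.
intros Hf Ha Hb; apply (RInt_scal f a b k); apply ex_RInt_from with A; auto.
Qed.

Lemma bounded_on (f : R -> R) a b : a <= b ->
  (forall x, a <= x <= b -> continuous f x) ->
  exists M, 0 <= M /\ forall x, a <= x <= b -> Rabs (f x) <= M.
Proof.
intros ab H.
destruct (continuity_ab_maj (fun x => Rabs (f x)) a b ab) as (x0 & Hx0 & _).
- intros c Hc; apply continuity_pt_filterlim; apply cont_Abs; auto.
- exists (Rabs (f x0)); split; [apply Rabs_pos|auto].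
Qed.

Lemma incr_bounded_cv (f : R -> R) A B :
  (forall x y, A <= x -> x <= y -> f x <= f y) -> (forall x, A <= x -> f x <= B) ->
  exists l, (forall x, A <= x -> f x <= l) /\
    forall e, 0 < e -> exists X, A <= X /\ forall x, X <= x -> l - e < f x.
Proof.
intros Hm Hb.
destruct (completeness (fun r => exists x, A <= x /\ r = f x)) as (l & Hu & Hl).
- exists B; intros r (x & Hx & ->); auto.
- exists (f A), A; split; auto; lra.
- exists l; split.
  + intros x Hx; apply Hu; now exists x.
  + intros e He.
    destruct (classic (exists x, A <= x /\ l - e < f x)) as [(x & Hx & Hlt)|Hn].
    * exists x; split; auto; intros y Hy; specialize (Hm x y Hx Hy); lra.
    * exfalso. assert (l <= l - e); [|lra].
      apply Hl; intros r (x & Hx & ->).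
      destruct (Rle_lt_dec (f x) (l - e)); auto. exfalso; apply Hn; now exists x.
Qed.

Lemma small_often (S : R -> R) A B :
  (forall x, A <= x -> continuous S x) -> (forall x, A <= x -> 0 <= S x) ->
  (forall X, A <= X -> RInt S A X <= B) ->
  forall e X0, 0 < e -> exists x, A <= x /\ X0 <= x /\ S x < e.
Proof.
intros Hc H0 HB e X0 He. apply NNPP; intros Hn.
set (X1 := Rmax A X0).
assert (HX1 : A <= X1 /\ X0 <= X1) by (split; [apply Rmax_l|apply Rmax_r]).
assert (Hge : forall x, X1 <= x -> e <= S x).
{ intros x Hx; destruct (Rle_lt_dec e (S x)); auto.
  exfalso; apply Hn; exists x; repeat split; auto; lra. }
assert (HB0 : 0 <= B).
{ specialize (HB A (Rle_refl _)). rewrite RInt_point in HB. exact HB. }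
set (X2 := X1 + (B / e + 1)).
assert (HX2 : X1 <= X2). { unfold X2; assert (0 <= B / e) by (apply Rdiv_le_0_compat; lra); lra. }
assert (H1 : 0 <= RInt S A X1) by (apply RInt_from_nonneg with A; auto; lra).
assert (H2 : RInt (fun _ => e) X1 X2 <= RInt S X1 X2).
{ apply RInt_from_le with X1; auto; try lra; intros; [apply cont_C|apply Hc; lra]. }
rewrite RInt_const in H2. unfold scal in H2; simpl in H2; unfold mult in H2; simpl in H2.
assert (H3 := HB X2 ltac:(lra)). rewrite (RInt_from_Chasles S A A X1 X2) in H3 by (auto; lra).
assert ((X2 - X1) * e = B + e) by (unfold X2; field; lra). lra.
Qed.

(** Replaces the integration of a derivative up to infinity: [F] can only increase, yet it is
    dominated at arbitrarily far points by quantities as small as desired. *)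
Lemma compare_at_infinity (F S : R -> R) A K :
  (forall x, A <= x -> exists l : R, is_derive F x l /\ 0 <= l) ->
  (forall x, A <= x -> F x <= K * S x) -> (forall x, A <= x -> 0 <= S x) ->
  (forall e X0, 0 < e -> exists x, A <= x /\ X0 <= x /\ S x < e) ->
  F A <= 0.
Proof.
intros Hd HF H0 Hs. apply Rnot_lt_le; intros Hp.
set (K' := Rmax 1 K).
assert (HK : 1 <= K' /\ K <= K') by (split; [apply Rmax_l|apply Rmax_r]).
destruct (Hs (F A / K') A) as (x & Hx & _ & Hlt); [apply Rdiv_lt_0_compat; lra|].
assert (F A <= F x) by (apply der_incr; auto; intros; apply Hd; lra).
specialize (HF x Hx); specialize (H0 x Hx).
assert (K' * S x < F A).
{ apply Rmult_lt_reg_r with (/ K'); [apply Rinv_0_lt_compat; lra|].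
  replace (K' * S x * / K') with (S x) by (field; lra). exact Hlt. }
nra.
Qed.

Lemma L2_of_bounded (f : R -> R) A B :
  (forall x, A <= x -> continuous f x) -> (forall x, A <= x -> 0 <= f x) ->
  (forall X, A <= X -> RInt f A X <= B) ->
  ex_RInt_gen f (at_point A) (Rbar_locally p_infty).
Proof.
intros Hc H0 HB.
destruct (incr_bounded_cv (fun X => RInt f A X) A B) as (l & Hl & He); auto.
{ intros x y Hx Hy. rewrite (RInt_from_Chasles f A A x y) by (auto; lra).
  assert (0 <= RInt f x y) by (apply RInt_from_nonneg with A; auto). lra. }
exists l. intros P (e & HP).
destruct (He e (cond_pos e)) as (X & HX & Hlt).
exists (fun a => a = A) (fun x => X < x); [reflexivity|now exists X|].
intros a b -> Hb; simpl. exists (RInt f A b); split.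
- apply (RInt_correct f A b), ex_RInt_from with A; auto; lra.
- apply HP. unball_goal.
  specialize (Hl b ltac:(lra)); specialize (Hlt b ltac:(lra)).
  rewrite Rabs_left1; lra.
Qed.

(** By positivity a partial integral is at most any later one, and some later one lies within 1 of
    the limit. *)
Lemma gen_int_bounded (f : R -> R) A :
  (forall x, A <= x -> continuous f x) -> (forall x, A <= x -> 0 <= f x) ->
  ex_RInt_gen f (at_point A) (Rbar_locally p_infty) ->
  exists B, forall X, A <= X -> RInt f A X <= B.
Proof.
intros Hc H0 (l & Hl).
destruct (Hl (ball l (mkposreal 1 Rlt_0_1))) as [Q T HQ (M & HT) Himp];
  [apply locally_ball|].
assert (HQA : Q A) by exact HQ.
exists (l + 1); intros X HX.
set (Y := Rmax X (M + 1)).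
assert (HY : X <= Y /\ M + 1 <= Y) by (split; [apply Rmax_l|apply Rmax_r]).
destruct (Himp A Y HQA (HT Y ltac:(lra))) as (v & Hv & Hb); simpl in Hv.
apply (is_RInt_unique (V:=R_CompleteNormedModule)) in Hv.
unball Hb.
apply Rabs_def2 in Hb.
rewrite (RInt_from_Chasles f A A X Y) in Hv by (auto; lra).
assert (0 <= RInt f X Y) by (apply RInt_from_nonneg with A; auto; lra). lra.
Qed.

Lemma gen_int_tail (f : R -> R) x0 :
  (forall x, x0 <= x -> continuous f x) -> (forall x, x0 <= x -> 0 <= f x) ->
  ex_RInt_gen f (at_point x0) (Rbar_locally p_infty) ->
  forall e, 0 < e -> exists X, x0 <= X /\ forall a b, X <= a -> a <= b -> RInt f a b <= e.
Proof.
intros Hc H0 Hg e He.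
destruct (gen_int_bounded f x0 Hc H0 Hg) as (B & HB).
destruct (incr_bounded_cv (fun X => RInt f x0 X) x0 B) as (l & Hl & Hcv); auto.
{ intros x y Hx Hy. rewrite (RInt_from_Chasles f x0 x0 x y) by (auto; lra).
  assert (0 <= RInt f x y) by (apply RInt_from_nonneg with x0; auto). lra. }
destruct (Hcv e He) as (X & HX & Hlt). exists X; split; auto.
intros a b Ha Hb.
specialize (Hl b ltac:(lra)); specialize (Hlt a ltac:(lra)).
rewrite (RInt_from_Chasles f x0 x0 a b) in Hl by (auto; lra). lra.
Qed.

Lemma exp_nondecr x y : x <= y -> exp x <= exp y.
Proof. intros [H| ->]; [left; now apply exp_increasing|right; reflexivity]. Qed.

Lemma Rabs_triang4 a b c d : Rabs (a + (b + (c + d))) <= Rabs a + (Rabs b + (Rabs c + Rabs d)).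
Proof.
pose proof (Rabs_triang a (b + (c + d))); pose proof (Rabs_triang b (c + d)).
pose proof (Rabs_triang c d); lra.
Qed.

Lemma pow2_le_0 a : a ^ 2 <= 0 -> a = 0.
Proof. intros H; apply Rsqr_0_uniq; unfold Rsqr; sq_ge0 a; simpl in *; lra. Qed.

Lemma sum_sq4_le_0 a b c d : a ^ 2 + b ^ 2 + (c ^ 2 + d ^ 2) <= 0 -> a = 0 /\ b = 0 /\ c = 0 /\ d = 0.
Proof.
intros H; sq_ge0 a; sq_ge0 b; sq_ge0 c; sq_ge0 d.
split; [|split; [|split]]; apply pow2_le_0; lra.
Qed.

Lemma RInt_of_derive (f df : R -> R) A X : A <= X ->
  (forall x, A <= x -> is_derive f x (df x)) -> (forall x, A <= x -> continuous df x) ->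
  RInt df A X = f X - f A.
Proof.
intros HX Hd Hc. apply (is_RInt_unique (V:=R_CompleteNormedModule)).
apply (is_RInt_derive (V:=R_CompleteNormedModule)); rewrite Rmin_left, Rmax_right by lra;
intros x Hx; [apply Hd|apply Hc]; lra.
Qed.

(** * Regularity of the potential *)

(** Convergence at the single point [Rabs x + 1] bounds the terms there, so the radius is at least
    [Rabs x + 1]. *)
Lemma cv_radius_infinite (a : nat -> R) :
  (forall x, 0 < x -> ex_series (fun n => a n * x ^ n)) ->
  forall x, Rbar_lt (Rabs x) (CV_radius a).
Proof.
intros H x.
apply Rbar_lt_le_trans with (Finite (Rabs x + 1)); [simpl; lra|].
apply CV_radius_bounded.
assert (Hp : 0 < Rabs x + 1) by (abs_ge0 x; lra).
pose proof (ex_series_lim_0 _ (H _ Hp)) as Hl.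
destruct (filterlim_bounded _ (ex_intro _ 0 Hl)) as (M & HM).
exists M; exact HM.
Qed.

Definition qder (c : nat -> R) (x : R) : R :=
  - 2 * c O / x ^ 3 - c 1%nat / x ^ 2 + PSeries (PS_derive (fun n => c (S (S n)))) x.

Lemma qfun_derive (c : nat -> R) :
  (forall x, 0 < x -> ex_series (fun n => c (S (S n)) * x ^ n)) ->
  forall x, 0 < x -> is_derive (qfun c) x (qder c x).
Proof.
intros H x Hx. unfold qfun, qder.
eapply is_derive_eq.
- apply derP; [|apply (is_derive_PSeries (fun n => c (S (S n)))), cv_radius_infinite, H].
  apply derP; (eapply derM; [apply derC|]).
  + apply derV; [apply pow_nonzero; lra|]. apply derX2, derI.
  + apply derV; [lra|apply derI].
- cbv beta; field; lra.
Qed.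

Lemma qfun_continuous (c : nat -> R) :
  (forall x, 0 < x -> ex_series (fun n => c (S (S n)) * x ^ n)) ->
  forall x, 0 < x -> continuous (qfun c) x.
Proof. intros H x Hx; exact (der_cont _ _ _ (qfun_derive c H x Hx)). Qed.

Lemma qder_continuous (c : nat -> R) :
  (forall x, 0 < x -> ex_series (fun n => c (S (S n)) * x ^ n)) ->
  forall x, 0 < x -> continuous (qder c) x.
Proof.
intros H x Hx. unfold qder.
apply cont_P; [apply cont_B; (apply cont_M; [apply cont_C|])|].
- apply (@ex_derive_continuous _ R_NormedModule). auto_derive. repeat apply Rmult_integral_contrapositive_currified; lra.
- apply (@ex_derive_continuous _ R_NormedModule). auto_derive. repeat apply Rmult_integral_contrapositive_currified; lra.
- apply continuity_pt_filterlim, PSeries_continuity.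
  rewrite CV_radius_derive. now apply cv_radius_infinite.
Qed.

(** * Global existence for Lipschitz systems *)

(** Both [M * exp (L * (x - A)) + D x] and [M * exp (L * (x - A)) - D x] are nondecreasing. This is
    how the weighted norm of the Picard iteration absorbs an integration. *)
Lemma exp_growth_right (D g : R -> R) A r M L : 0 <= M -> 0 <= L ->
  D A = 0 -> (forall t : R, is_derive D t (g t)) ->
  (forall t, A <= t <= A + r -> Rabs (g t) <= M * (L * exp (L * (t - A)))) ->
  forall x, A <= x <= A + r -> Rabs (D x) <= M * exp (L * (x - A)).
Proof.
intros HM HL H0 Hd Hg x Hx.
assert (HA : exp (L * (A - A)) = 1) by (rewrite Rminus_diag, Rmult_0_r; apply exp_0).
apply Rabs_le; split.
- assert (0 <= M * exp (L * (x - A)) + D x); [|lra].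
  apply Rle_trans with (M * exp (L * (A - A)) + D A); [rewrite HA; lra|].
  apply (der_incr (fun x => M * exp (L * (x - A)) + D x)); [lra|].
  intros t Ht; eexists; split; [eapply derP; [eapply derM; [apply derC|apply der_exp]|apply Hd]|].
  assert (Hb := Hg t ltac:(lra)); apply Rabs_le_between in Hb. nra.
- assert (0 <= M * exp (L * (x - A)) - D x); [|lra].
  apply Rle_trans with (M * exp (L * (A - A)) - D A); [rewrite HA; lra|].
  apply (der_incr (fun x => M * exp (L * (x - A)) - D x)); [lra|].
  intros t Ht; eexists; split; [eapply derB; [eapply derM; [apply derC|apply der_exp]|apply Hd]|].
  assert (Hb := Hg t ltac:(lra)); apply Rabs_le_between in Hb. nra.
Qed.

Lemma exp_growth (D g : R -> R) A r M L : 0 <= M -> 0 <= L ->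
  D A = 0 -> (forall t : R, is_derive D t (g t)) ->
  (forall t, Rabs (t - A) <= r -> Rabs (g t) <= M * (L * exp (L * Rabs (t - A)))) ->
  forall x, Rabs (x - A) <= r -> Rabs (D x) <= M * exp (L * Rabs (x - A)).
Proof.
intros HM HL H0 Hd Hg x Hx.
destruct (Rle_lt_dec A x) as [Hle|Hlt].
- rewrite (Rabs_right (x - A)) in Hx |- * by lra.
  apply (exp_growth_right D g A r); auto; [|lra].
  intros t Ht; specialize (Hg t); rewrite Rabs_right in Hg by lra; apply Hg; lra.
- rewrite (Rabs_left (x - A)) in Hx |- * by lra.
  replace (D x) with ((fun t => D (2 * A - t)) (2 * A - x)) by (f_equal; ring).
  replace (- (x - A)) with (2 * A - x - A) by ring.
  apply (exp_growth_right (fun t => D (2 * A - t)) (fun t => - g (2 * A - t)) A r); auto; [| | |lra].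
  + now replace (2 * A - A) with A by ring.
  + intros t. eapply is_derive_eq.
    * apply (is_derive_comp D (fun t => 2 * A - t)); [apply Hd|].
      eapply derB; [apply derC|apply derI].
    * unfold scal; simpl; unfold mult; simpl. ring.
  + intros t Ht. rewrite Rabs_Ropp. specialize (Hg (2 * A - t)).
    replace (2 * A - t - A) with (- (t - A)) in Hg by ring.
    rewrite Rabs_Ropp, (Rabs_right (t - A)) in Hg by lra. apply Hg; lra.
Qed.

Lemma geometric_limit (u : nat -> R) M :
  (forall n, Rabs (u (S n) - u n) <= M * (/ 2) ^ n) ->
  forall n, Rabs (u n - real (Lim_seq u)) <= 2 * M * (/ 2) ^ n.
Proof.
intros H.
assert (Hp : forall n, 0 < (/ 2) ^ n) by (intros; apply pow_lt; lra).
assert (HM : 0 <= M) by (specialize (H O); simpl in H; abs_ge0 (u 1%nat - u O); lra).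
assert (Hd : forall n p, Rabs (u (n + p)%nat - u n) <= 2 * M * (/ 2) ^ n * (1 - (/ 2) ^ p)).
{ intros n p; induction p as [|p IH].
  - rewrite Nat.add_0_r, Rminus_diag, Rabs_R0; simpl; lra.
  - rewrite Nat.add_succ_r.
    replace (u (S (n + p)) - u n) with ((u (S (n + p)) - u (n + p)%nat) + (u (n + p)%nat - u n)) by ring.
    eapply Rle_trans; [apply Rabs_triang|].
    specialize (H (n + p)%nat). rewrite pow_add in H. simpl.
    assert (2 * M * (/ 2) ^ n * (1 - / 2 * (/ 2) ^ p) =
      M * ((/ 2) ^ n * (/ 2) ^ p) + 2 * M * (/ 2) ^ n * (1 - (/ 2) ^ p)) by field.
    lra. }
assert (Hd' : forall n p, Rabs (u (n + p)%nat - u n) <= 2 * M * (/ 2) ^ n).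
{ intros n p; eapply Rle_trans; [apply Hd|].
  assert (0 <= 2 * M * (/ 2) ^ n) by (specialize (Hp n); nra). specialize (Hp p). nra. }
assert (Hc : ex_finite_lim_seq u).
{ apply ex_lim_seq_cauchy_corr. intros e.
  assert (He : 0 < e / (4 * M + 1)) by (apply Rdiv_lt_0_compat; [apply cond_pos|lra]).
  destruct (pow_lt_1_zero (/ 2) ltac:(rewrite Rabs_right; lra) _ He) as (N & HN).
  exists N; intros n m Hn Hm.
  assert (HN' := HN N (le_n _)). rewrite Rabs_right in HN' by (left; apply Rlt_gt, Hp).
  assert (H1 := Hd' N (n - N)%nat); assert (H2 := Hd' N (m - N)%nat).
  replace (N + (n - N))%nat with n in H1 by lia; replace (N + (m - N))%nat with m in H2 by lia.
  replace (u n - u m) with ((u n - u N) - (u m - u N)) by ring.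
  eapply Rle_lt_trans; [apply Rabs_triang|]. rewrite Rabs_Ropp.
  apply Rmult_lt_compat_r with (r := 4 * M + 1) in HN'; [|lra].
  replace (e / (4 * M + 1) * (4 * M + 1)) with (pos e) in HN' by (field; lra).
  specialize (Hp N). nra. }
intros n. apply Lim_seq_correct' in Hc.
assert (Hc' : is_lim_seq (fun p => Rabs (u n - u (p + n)%nat)) (Rabs (u n - real (Lim_seq u)))).
{ apply (is_lim_seq_abs _ (Finite _)).
  apply is_lim_seq_minus'; [apply is_lim_seq_const|].
  now apply is_lim_seq_incr_n. }
apply (is_lim_seq_le _ (fun _ => 2 * M * (/ 2) ^ n) (Finite _) (Finite _)) with (2 := Hc')
  (3 := is_lim_seq_const _).
intros p; rewrite Rabs_minus_sym, Nat.add_comm; apply Hd'.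
Qed.

Lemma half_pow_small M e : 0 < e -> exists n, M * (/ 2) ^ n < e.
Proof.
intros He.
assert (HM : 0 < Rabs M + 1) by (abs_ge0 M; lra).
destruct (pow_lt_1_zero (/ 2) ltac:(rewrite Rabs_right; lra) (e / (Rabs M + 1))) as (N & HN);
  [apply Rdiv_lt_0_compat; lra|].
exists N. specialize (HN N (le_n _)).
assert (Hp : 0 < (/ 2) ^ N) by (apply pow_lt; lra).
rewrite Rabs_right in HN by lra.
apply Rmult_lt_compat_r with (r := Rabs M + 1) in HN; [|lra].
replace (e / (Rabs M + 1) * (Rabs M + 1)) with e in HN by (field; lra).
pose proof (Rle_abs M). nra.
Qed.

Lemma cont_RInt (f : R -> R) A x : (forall t, continuous f t) ->
  is_derive (fun X => RInt f A X) x (f x).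
Proof.
intros H; apply (is_derive_RInt f (fun X => RInt f A X) A x); [|apply H].
apply filter_forall; intros y. apply (RInt_correct f A y), (ex_RInt_continuous (V:=R_CompleteNormedModule)); auto.
Qed.

(* Picard iteration in the weighted norm [sup exp (- 2 K |x - A|) |y x|], where the integral operator
   is a contraction of ratio 1/2. *)
Theorem ode_exists (F : R -> (nat -> R) -> nat -> R) (A : R) (y0 : nat -> R) :
  (forall y : nat -> R -> R, (forall j x, continuous (y j) x) ->
     forall i x, continuous (fun t => F t (fun j => y j t) i) x) ->
  (forall r, 0 < r -> exists K B, 0 < K /\ 0 <= B /\ forall t, Rabs (t - A) <= r ->
     (forall i, Rabs (F t y0 i) <= B) /\
     forall y y' d, (forall j, Rabs (y j - y' j) <= d) -> forall i, Rabs (F t y i - F t y' i) <= K * d) ->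
  exists y : nat -> R -> R, (forall i, y i A = y0 i) /\
    forall i x, is_derive (y i) x (F x (fun j => y j x) i).
Proof.
intros HC HL.
set (phi := fix phi (n : nat) : nat -> R -> R := match n with
  | O => fun i _ => y0 i
  | S n => fun i x => y0 i + RInt (fun t => F t (fun j => phi n j t) i) A x end).
assert (phiC : forall n i x, continuous (phi n i) x).
{ induction n as [|n IH]; intros i x; [apply cont_C|].
  simpl. apply cont_P; [apply cont_C|].
  eapply der_cont, (cont_RInt (fun t => F t (fun j => phi n j t) i)). intros t; now apply HC. }
assert (phiD : forall n i x, is_derive (phi (S n) i) x (F x (fun j => phi n j x) i)).
{ intros n i x; simpl. eapply is_derive_eq; [eapply derP; [apply derC|]|].
  - apply (cont_RInt (fun t => F t (fun j => phi n j t) i)). intros t; now apply HC.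
  - ring. }
assert (phiA : forall n i, phi n i A = y0 i).
{ intros [|n] i; auto. simpl. rewrite RInt_point. unfold zero; simpl; ring. }
assert (Hstep : forall r, 0 < r -> exists M, 0 <= M /\ forall n i x, Rabs (x - A) <= r ->
   Rabs (phi (S n) i x - phi n i x) <= M * (/ 2) ^ n).
{ intros r Hr. destruct (HL r Hr) as (K & B & HK & HB & HF).
  (* The weight with factor [B / (2 * K)] has slope [B * exp (2 * K * Rabs (x - A))], at least the
     slope bound [B] of the first increment; every further integration costs [K] and gains
     [/ (2 * K)]. *)
  assert (Hb : forall n i x, Rabs (x - A) <= r ->
     Rabs (phi (S n) i x - phi n i x) <= B / (2 * K) * (/ 2) ^ n * exp (2 * K * Rabs (x - A))).
  { induction n as [|n IH]; intros i.
    - apply (exp_growth (fun x => phi 1%nat i x - phi 0%nat i x) (fun t => F t y0 i)).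
      + rewrite Rmult_1_r; apply Rdiv_le_0_compat; lra.
      + lra.
      + rewrite !phiA; ring.
      + intros t; eapply is_derive_eq; [eapply derB; [apply phiD|apply derC]|apply Rminus_0_r].
      + intros t Ht. destruct (HF t Ht) as (HF0 & _). eapply Rle_trans; [apply HF0|].
        assert (1 <= exp (2 * K * Rabs (t - A))).
        { rewrite <- exp_0. apply exp_nondecr. abs_ge0 (t - A); nra. }
        simpl. replace (B / (2 * K) * 1 * (2 * K * exp (2 * K * Rabs (t - A))))
          with (B * exp (2 * K * Rabs (t - A))) by (field; lra). nra.
    - apply (exp_growth (fun x => phi (S (S n)) i x - phi (S n) i x)
         (fun t => F t (fun j => phi (S n) j t) i - F t (fun j => phi n j t) i)).
      + apply Rmult_le_pos; [apply Rdiv_le_0_compat; lra|apply pow_le; lra].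
      + lra.
      + rewrite !phiA; ring.
      + intros t; apply derB; apply phiD.
      + intros t Ht. destruct (HF t Ht) as (_ & HF1).
        eapply Rle_trans; [apply HF1; intros j; apply IH, Ht|].
        right; simpl; field; lra. }
  exists (B / (2 * K) * exp (2 * K * r)); split.
  { apply Rmult_le_pos; [apply Rdiv_le_0_compat; lra|left; apply exp_pos]. }
  intros n i x Hx. eapply Rle_trans; [apply Hb, Hx|].
  assert (exp (2 * K * Rabs (x - A)) <= exp (2 * K * r)) by (apply exp_nondecr; nra).
  assert (0 <= B / (2 * K) * (/ 2) ^ n).
  { apply Rmult_le_pos; [apply Rdiv_le_0_compat; lra|apply pow_le; lra]. }
  replace (B / (2 * K) * exp (2 * K * r) * (/ 2) ^ n) with (B / (2 * K) * (/ 2) ^ n * exp (2 * K * r)) by ring.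
  now apply Rmult_le_compat_l. }
set (y := fun i x => real (Lim_seq (fun n => phi n i x))).
assert (Hlim : forall r, 0 < r -> exists M, 0 <= M /\ forall n i x, Rabs (x - A) <= r ->
   Rabs (phi n i x - y i x) <= M * (/ 2) ^ n).
{ intros r Hr; destruct (Hstep r Hr) as (M & HM & H). exists (2 * M); split; [lra|].
  intros n i x Hx. apply (geometric_limit (fun n => phi n i x)). intros k; now apply H. }
assert (yC : forall i x, continuous (y i) x).
{ intros i x. apply continuity_pt_filterlim. intros e He.
  assert (Hr : 0 < Rabs (x - A) + 1) by (abs_ge0 (x - A); lra).
  destruct (Hlim _ Hr) as (M & HM & H).
  destruct (half_pow_small M (e / 3)) as (n & Hn); [lra|].
  pose proof (phiC n i x) as Hp. apply continuity_pt_filterlim in Hp.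
  destruct (Hp (e / 3)) as (d & Hd & Hd'); [lra|].
  exists (Rmin d 1); split; [apply Rmin_pos; lra|].
  intros z (Hz1 & Hz2); simpl in *. unfold Rdist in *.
  assert (Hz3 : Rabs (z - x) < d) by (eapply Rlt_le_trans; [exact Hz2|apply Rmin_l]).
  assert (Hz4 : Rabs (z - x) < 1) by (eapply Rlt_le_trans; [exact Hz2|apply Rmin_r]).
  specialize (Hd' z (conj Hz1 Hz3)).
  assert (H1 := H n i x ltac:(lra)).
  assert (H2 : Rabs (phi n i z - y i z) <= M * (/ 2) ^ n).
  { apply H. replace (z - A) with ((z - x) + (x - A)) by ring.
    eapply Rle_trans; [apply Rabs_triang|lra]. }
  rewrite Rabs_minus_sym in H2.
  replace (y i z - y i x) with ((y i z - phi n i z) + ((phi n i z - phi n i x) + (phi n i x - y i x))) by ring.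
  eapply Rle_lt_trans; [apply Rabs_triang|].
  eapply Rle_lt_trans; [apply Rplus_le_compat_l, Rabs_triang|]. lra. }
assert (FC : forall i x, continuous (fun t => F t (fun j => y j t) i) x) by (intros; apply HC; auto).
(* The integral equation passes to the limit with an explicit error: [phi (S n)] and the integral of
   [F] along [phi n] are both within a multiple of [(/ 2) ^ n] of their limits. *)
assert (Hint : forall i x, y i x = y0 i + RInt (fun t => F t (fun j => y j t) i) A x).
{ intros i x.
  assert (Hr : 0 < Rabs (x - A) + 1) by (abs_ge0 (x - A); lra).
  destruct (Hlim _ Hr) as (M & HM & H). destruct (HL _ Hr) as (K & B & HK & HB & HF).
  apply Rminus_diag_uniq. apply Rabs_eq_0.
  apply Rle_antisym; [|apply Rabs_pos]. apply le_epsilon; intros e He. rewrite Rplus_0_l.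
  destruct (half_pow_small (M + Rabs (x - A) * (K * M)) e He) as (n & Hn). left.
  eapply Rle_lt_trans; [|exact Hn].
  set (I := RInt (fun t => F t (fun j => y j t) i) A x).
  replace (y i x - (y0 i + I)) with (- (phi (S n) i x - y i x) + (phi (S n) i x - y0 i - I)) by ring.
  eapply Rle_trans; [apply Rabs_triang|]. rewrite Rabs_Ropp.
  assert (H1 := H (S n) i x ltac:(lra)).
  assert (H2 : Rabs (phi (S n) i x - y0 i - I) <= Rabs (x - A) * (K * (M * (/ 2) ^ n))).
  { apply (norm_RInt_le_const_abs (fun t => F t (fun j => phi n j t) i - F t (fun j => y j t) i) A x).
    - intros t Ht.
      assert (Ht' : Rabs (t - A) <= Rabs (x - A)).
      { unfold Rmin, Rmax in Ht; destruct (Rle_dec A x).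
        - rewrite !Rabs_right; lra.
        - rewrite !Rabs_left1; lra. }
      apply (proj2 (HF t ltac:(lra))). intros j; apply H; lra.
    - replace (phi (S n) i x - y0 i - I) with (minus (RInt (fun t => F t (fun j => phi n j t) i) A x) I).
      + apply (is_RInt_minus (V:=R_NormedModule)); apply (RInt_correct (V:=R_CompleteNormedModule)), (ex_RInt_continuous (V:=R_CompleteNormedModule)); intros; auto.
      + unfold minus, plus, opp; simpl. ring. }
  rewrite <- tech_pow_Rmult in H1. assert (0 <= M * (/ 2) ^ n) by (apply Rmult_le_pos; [lra|apply pow_le; lra]). lra. }
exists y; split.
- intros i; rewrite Hint, RInt_point. unfold zero; simpl; ring.
- intros i x. apply is_derive_ext with (fun x => y0 i + RInt (fun t => F t (fun j => y j t) i) A x).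
  + intros t; symmetry; apply Hint.
  + eapply is_derive_eq; [eapply derP; [apply derC|apply (cont_RInt (fun t => F t (fun j => y j t) i)); auto]|ring].
Qed.

(** * The Schroedinger equation at complex energy *)

(** A complex solution split into real functions as in [is_sol_C]: [y = Y1 + i Y2] and
    [y' = Z1 + i Z2]. *)
Record sol := Sol { Y1 : R -> R; Y2 : R -> R; Z1 : R -> R; Z2 : R -> R }.

Definition solves (q : R -> R) (A mu eps : R) (s : sol) : Prop :=
  is_sol_C q A (mu, eps) (Y1 s) (Y2 s) (Z1 s) (Z2 s).

Definition sqY (s : sol) (x : R) : R := Y1 s x ^ 2 + Y2 s x ^ 2.
Definition sqZ (s : sol) (x : R) : R := Z1 s x ^ 2 + Z2 s x ^ 2.
(* real and imaginary parts of [conj y * y'] *)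
Definition reYZ (s : sol) (x : R) : R := Y1 s x * Z1 s x + Y2 s x * Z2 s x.
Definition imYZ (s : sol) (x : R) : R := Y1 s x * Z2 s x - Y2 s x * Z1 s x.
Definition energy (s : sol) (x : R) : R := sqY s x + sqZ s x.

(* [u + (p + i h) v] *)
Definition comb (u : sol) (p h : R) (v : sol) : sol :=
  Sol (fun x => Y1 u x + p * Y1 v x - h * Y2 v x) (fun x => Y2 u x + p * Y2 v x + h * Y1 v x)
      (fun x => Z1 u x + p * Z1 v x - h * Z2 v x) (fun x => Z2 u x + p * Z2 v x + h * Z1 v x).

Section Schroedinger.
Variables (q : R -> R) (A : R).
Hypothesis qC : forall x, A <= x -> continuous q x.

Lemma solves_der mu eps s x : solves q A mu eps s -> A <= x ->
  is_derive (Y1 s) x (Z1 s x) /\ is_derive (Y2 s) x (Z2 s x) /\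
  is_derive (Z1 s) x ((q x - mu) * Y1 s x + eps * Y2 s x) /\
  is_derive (Z2 s) x ((q x - mu) * Y2 s x - eps * Y1 s x).
Proof. intros H Hx; exact (H x Hx). Qed.

Ltac sol_der H Hx := destruct (solves_der _ _ _ _ H Hx) as (? & ? & ? & ?).

Lemma solves_cont mu eps s x : solves q A mu eps s -> A <= x ->
  continuous (Y1 s) x /\ continuous (Y2 s) x /\ continuous (Z1 s) x /\ continuous (Z2 s) x.
Proof.
intros H Hx; destruct (H x Hx) as (H1 & H2 & H3 & H4).
repeat split; eapply der_cont; eassumption.
Qed.

Lemma sqY_nonneg s x : 0 <= sqY s x.
Proof. unfold sqY; nra. Qed.
Lemma sqZ_nonneg s x : 0 <= sqZ s x.
Proof. unfold sqZ; nra. Qed.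

Lemma sqY_cont mu eps s x : solves q A mu eps s -> A <= x -> continuous (sqY s) x.
Proof. intros H Hx; destruct (solves_cont _ _ _ _ H Hx) as (H1 & H2 & H3 & H4). unfold sqY; cont idtac. Qed.
Lemma sqZ_cont mu eps s x : solves q A mu eps s -> A <= x -> continuous (sqZ s) x.
Proof. intros H Hx; destruct (solves_cont _ _ _ _ H Hx) as (H1 & H2 & H3 & H4). unfold sqZ; cont idtac. Qed.
Lemma energy_cont mu eps s x : solves q A mu eps s -> A <= x -> continuous (energy s) x.
Proof. intros H Hx; unfold energy; apply cont_P; [eapply sqY_cont|eapply sqZ_cont]; eauto. Qed.
Lemma energy_nonneg s x : 0 <= energy s x.
Proof. unfold energy; pose proof (sqY_nonneg s x); pose proof (sqZ_nonneg s x); lra. Qed.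

Lemma sqY_der mu eps s x : solves q A mu eps s -> A <= x -> is_derive (sqY s) x (2 * reYZ s x).
Proof.
intros H Hx; sol_der H Hx.
unfold sqY, reYZ; eapply is_derive_eq; [der idtac|cbv beta; ring].
Qed.
Lemma sqZ_der mu eps s x : solves q A mu eps s -> A <= x ->
  is_derive (sqZ s) x (2 * (q x - mu) * reYZ s x - 2 * eps * imYZ s x).
Proof.
intros H Hx; sol_der H Hx.
unfold sqZ, reYZ, imYZ; eapply is_derive_eq; [der idtac|cbv beta; ring].
Qed.
Lemma reYZ_der mu eps s x : solves q A mu eps s -> A <= x ->
  is_derive (reYZ s) x (sqZ s x + (q x - mu) * sqY s x).
Proof.
intros H Hx; sol_der H Hx.
unfold sqY, sqZ, reYZ; eapply is_derive_eq; [der idtac|cbv beta; ring].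
Qed.
Lemma imYZ_der mu eps s x : solves q A mu eps s -> A <= x ->
  is_derive (imYZ s) x (- eps * sqY s x).
Proof.
intros H Hx; sol_der H Hx.
unfold sqY, imYZ; eapply is_derive_eq; [der idtac|cbv beta; ring].
Qed.

Lemma reYZ_le s x : Rabs (reYZ s x) <= energy s x / 2.
Proof.
unfold reYZ, energy, sqY, sqZ.
sq_ge0 (Y1 s x + Z1 s x); sq_ge0 (Y1 s x - Z1 s x).
sq_ge0 (Y2 s x + Z2 s x); sq_ge0 (Y2 s x - Z2 s x).
apply Rabs_le; split; lra.
Qed.
Lemma imYZ_le s x : Rabs (imYZ s x) <= energy s x / 2.
Proof.
unfold imYZ, energy, sqY, sqZ.
sq_ge0 (Y1 s x + Z2 s x); sq_ge0 (Y1 s x - Z2 s x).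
sq_ge0 (Y2 s x + Z1 s x); sq_ge0 (Y2 s x - Z1 s x).
apply Rabs_le; split; lra.
Qed.

(** Gronwall in both directions. The upper bound gives uniqueness and continuity in the spectral
    parameter, the lower bound that a nontrivial solution never has [y = y' = 0]. *)
Lemma energy_growth mu eps s M X : solves q A mu eps s -> A <= X ->
  (forall x, A <= x <= X -> Rabs (q x) <= M) ->
  energy s X <= energy s A * exp ((1 + M + Rabs mu + Rabs eps) * (X - A)) /\
  energy s A * exp (- (1 + M + Rabs mu + Rabs eps) * (X - A)) <= energy s X.
Proof.
intros H HX HM.
assert (Hd : forall x, A <= x <= X -> exists l : R, is_derive (energy s) x l /\
   Rabs l <= (1 + M + Rabs mu + Rabs eps) * energy s x).
{ intros x Hx; eexists; split.
  - unfold energy; apply derP; [eapply sqY_der|eapply sqZ_der]; eauto; lra.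
  - pose proof (reYZ_le s x) as H1; pose proof (imYZ_le s x) as H2.
    pose proof (energy_nonneg s x) as H0. specialize (HM x Hx).
    replace (2 * reYZ s x + (2 * (q x - mu) * reYZ s x - 2 * eps * imYZ s x))
      with (2 * reYZ s x + (2 * (q x * reYZ s x) + ((- 2) * (mu * reYZ s x) + (- 2) * (eps * imYZ s x)))) by ring.
    eapply Rle_trans; [apply Rabs_triang4|].
    rewrite !Rabs_mult, (Rabs_right 2), (Rabs_left (-2)) by lra.
    abs_ge0 (q x); abs_ge0 mu; abs_ge0 eps.
    abs_ge0 (reYZ s x); abs_ge0 (imYZ s x).
    assert (Rabs (q x) * Rabs (reYZ s x) <= M * (energy s x / 2)) by (apply Rmult_le_compat; lra).
    assert (Rabs mu * Rabs (reYZ s x) <= Rabs mu * (energy s x / 2)) by (apply Rmult_le_compat_l; lra).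
    assert (Rabs eps * Rabs (imYZ s x) <= Rabs eps * (energy s x / 2)) by (apply Rmult_le_compat_l; lra).
    lra. }
split.
- apply gronwall_up; auto. intros x Hx; destruct (Hd x Hx) as (l & Hl & Hb).
  exists l; split; auto. pose proof (Rle_abs l); lra.
- apply gronwall_dn; auto. intros x Hx; destruct (Hd x Hx) as (l & Hl & Hb).
  exists l; split; auto. apply Rabs_le_between in Hb. lra.
Qed.

Lemma q_bounded X : A <= X -> exists M, 0 <= M /\ forall x, A <= x <= X -> Rabs (q x) <= M.
Proof. intros HX; apply bounded_on; auto. intros; apply qC; lra. Qed.

Lemma energy_pos mu eps s x : solves q A mu eps s -> 0 < energy s A -> A <= x -> 0 < energy s x.
Proof.
intros H H0 Hx. destruct (q_bounded x Hx) as (M & HM0 & HM).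
destruct (energy_growth mu eps s M x H Hx HM) as (_ & Hl).
eapply Rlt_le_trans; [|exact Hl]. apply Rmult_lt_0_compat; auto. apply exp_pos.
Qed.

Lemma comb_solves mu eps u p h v : solves q A mu eps u -> solves q A mu eps v ->
  solves q A mu eps (comb u p h v).
Proof.
intros Hu Hv x Hx.
sol_der Hu Hx; sol_der Hv Hx.
split; [|split; [|split]]; cbn [Y1 Y2 Z1 Z2 comb]; (eapply is_derive_eq; [der idtac|unfold Re, Im; cbn; ring]).
Qed.

Lemma solves_unique mu eps s s' : solves q A mu eps s -> solves q A mu eps s' ->
  Y1 s A = Y1 s' A -> Y2 s A = Y2 s' A -> Z1 s A = Z1 s' A -> Z2 s A = Z2 s' A ->
  forall x, A <= x -> Y1 s x = Y1 s' x /\ Y2 s x = Y2 s' x /\ Z1 s x = Z1 s' x /\ Z2 s x = Z2 s' x.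
Proof.
intros H H' E1 E2 E3 E4 x Hx.
destruct (q_bounded x Hx) as (M & HM0 & HM).
destruct (energy_growth mu eps (comb s (-1) 0 s') M x) as (Hl & _); auto.
{ now apply comb_solves. }
assert (H0 : energy (comb s (-1) 0 s') A = 0).
{ unfold energy, sqY, sqZ; simpl. rewrite E1, E2, E3, E4; ring. }
rewrite H0, Rmult_0_l in Hl. unfold energy, sqY, sqZ in Hl; cbn [Y1 Y2 Z1 Z2 comb] in Hl.
apply sum_sq4_le_0 in Hl as (G1 & G2 & G3 & G4).
repeat split; lra.
Qed.

Lemma solves_exists mu eps a1 a2 b1 b2 : exists s, solves q A mu eps s /\
  Y1 s A = a1 /\ Y2 s A = a2 /\ Z1 s A = b1 /\ Z2 s A = b2.
Proof.
(* [q] frozen to the left of [A], so that the derivatives at [A] are two-sided *)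
set (qt := fun t => q ((A + t + Rabs (t - A)) / 2)).
assert (Hge : forall t, A <= (A + t + Rabs (t - A)) / 2).
{ intros t. destruct (Rle_lt_dec A t); [rewrite Rabs_right|rewrite Rabs_left]; lra. }
assert (qtC : forall t, continuous qt t).
{ intros t. apply (continuous_comp (fun t => (A + t + Rabs (t - A)) / 2) q); [|now apply qC].
  unfold Rdiv; cont ltac:(apply continuous_id). }
set (F := fun t (y : nat -> R) (i : nat) => match i with
  | 0%nat => y 2%nat | 1%nat => y 3%nat
  | 2%nat => (qt t - mu) * y 0%nat + eps * y 1%nat
  | 3%nat => (qt t - mu) * y 1%nat - eps * y 0%nat
  | _ => 0 end).
set (y0 := fun i : nat => match i with
  | 0%nat => a1 | 1%nat => a2 | 2%nat => b1 | 3%nat => b2 | _ => 0 end).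
destruct (ode_exists F A y0) as (y & Hy0 & Hy).
- intros y Hy i x. destruct i as [|[|[|[|i]]]]; simpl;
    cont ltac:(first [apply qtC|apply Hy]).
- intros r Hr.
  destruct (bounded_on qt (A - r) (A + r)) as (M & HM0 & HM); [lra|auto|].
  set (K := 1 + M + Rabs mu + Rabs eps).
  set (D := Rabs a1 + Rabs a2 + Rabs b1 + Rabs b2).
  abs_ge0 a1; abs_ge0 a2; abs_ge0 b1; abs_ge0 b2.
  abs_ge0 mu; abs_ge0 eps.
  assert (HF : forall t y d, Rabs (t - A) <= r -> (forall j, Rabs (y j) <= d) -> forall i, Rabs (F t y i) <= K * d).
  { intros t y' d Ht Hd i.
    assert (Hq : Rabs (qt t) <= M) by (apply HM; apply Rabs_le_between in Ht; lra).
    assert (Hd0 : 0 <= d) by (specialize (Hd 0%nat); abs_ge0 (y' 0%nat); lra).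
    assert (Hgen : forall z w, Rabs z <= d -> Rabs w <= d -> Rabs ((qt t - mu) * z + eps * w) <= K * d).
    { intros z w Hz Hw. eapply Rle_trans; [apply Rabs_triang|]. rewrite !Rabs_mult.
      assert (Rabs (qt t - mu) <= M + Rabs mu).
      { unfold Rminus; eapply Rle_trans; [apply Rabs_triang|]. rewrite Rabs_Ropp; lra. }
      assert (Rabs (qt t - mu) * Rabs z <= (M + Rabs mu) * d) by (apply Rmult_le_compat; auto; apply Rabs_pos).
      assert (Rabs eps * Rabs w <= Rabs eps * d) by (apply Rmult_le_compat_l; auto).
      unfold K; lra. }
    assert (HK : d <= K * d) by (unfold K; nra).
    destruct i as [|[|[|[|i]]]]; simpl.
    - eapply Rle_trans; [apply Hd|auto].
    - eapply Rle_trans; [apply Hd|auto].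
    - apply Hgen; auto.
    - replace ((qt t - mu) * y' 1%nat - eps * y' 0%nat) with ((qt t - mu) * y' 1%nat + eps * - y' 0%nat) by ring.
      apply Hgen; auto. now rewrite Rabs_Ropp.
    - rewrite Rabs_R0; lra. }
  exists K, (K * D); split; [unfold K; lra|]; split; [apply Rmult_le_pos; unfold K, D; lra|].
  intros t Ht; split.
  + intros i; apply HF; auto. intros [|[|[|[|j]]]]; simpl; try rewrite Rabs_R0; unfold D; lra.
  + intros y y' d Hd i.
    replace (F t y i - F t y' i) with (F t (fun j => y j - y' j) i).
    * now apply HF.
    * destruct i as [|[|[|[|i]]]]; simpl; ring.
- exists (Sol (y 0%nat) (y 1%nat) (y 2%nat) (y 3%nat)); simpl.
  split; [|repeat split; apply Hy0].
  intros x Hx; simpl.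
  assert (Hqt : qt x = q x) by (unfold qt; f_equal; rewrite Rabs_right by lra; field).
  rewrite <- Hqt.
split; [apply (Hy 0%nat x)|split; [apply (Hy 1%nat x)|split; [apply (Hy 2%nat x)|apply (Hy 3%nat x)]]].
Qed.

Definition square_integrable (s : sol) : Prop :=
  exists B, forall X, A <= X -> RInt (sqY s) A X <= B.

Definition initial (s : sol) (a1 a2 b1 b2 : R) : Prop :=
  Y1 s A = a1 /\ Y2 s A = a2 /\ Z1 s A = b1 /\ Z2 s A = b2.

(* [s] is the Weyl solution at [mu + i eps], with Titchmarsh-Weyl value [p + i h] *)
Definition weyl (mu eps p h : R) (s : sol) : Prop :=
  solves q A mu eps s /\ initial s 1 0 p h /\
  exists B, forall X, A <= X -> RInt (energy s) A X <= B.

(** Comparisons need the solutions to be small at one common point, so the energies are summed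
    before the point is chosen; a solution may be repeated to fill the three places. *)
Lemma weyl_small3 mu1 e1 p1 h1 s1 mu2 e2 p2 h2 s2 mu3 e3 p3 h3 s3 :
  weyl mu1 e1 p1 h1 s1 -> weyl mu2 e2 p2 h2 s2 -> weyl mu3 e3 p3 h3 s3 ->
  forall e X0, 0 < e -> exists x, A <= x /\ X0 <= x /\ energy s1 x + energy s2 x + energy s3 x < e.
Proof.
intros (S1 & _ & B1 & HB1) (S2 & _ & B2 & HB2) (S3 & _ & B3 & HB3).
assert (C1 := fun x => energy_cont _ _ _ x S1).
assert (C2 := fun x => energy_cont _ _ _ x S2).
assert (C3 := fun x => energy_cont _ _ _ x S3).
apply (small_often (fun x => energy s1 x + energy s2 x + energy s3 x) A (B1 + B2 + B3)).
- intros x Hx; cont ltac:(auto).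
- intros x Hx; pose proof (energy_nonneg s1 x); pose proof (energy_nonneg s2 x); pose proof (energy_nonneg s3 x); lra.
- intros X HX. rewrite (RInt_from_plus (fun x => energy s1 x + energy s2 x) (energy s3) A) by (auto; try lra; intros; cont ltac:(auto)).
  rewrite (RInt_from_plus (energy s1) (energy s2) A) by (auto; lra).
  specialize (HB1 X HX); specialize (HB2 X HX); specialize (HB3 X HX); lra.
Qed.

(* real and imaginary parts of the Wronskian [y1' y2 - y1 y2'] *)
Definition wrR (s t : sol) (x : R) : R :=
  Z1 s x * Y1 t x - Z2 s x * Y2 t x - (Y1 s x * Z1 t x - Y2 s x * Z2 t x).
Definition wrI (s t : sol) (x : R) : R :=
  Z1 s x * Y2 t x + Z2 s x * Y1 t x - (Y1 s x * Z2 t x + Y2 s x * Z1 t x).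

Lemma wrR_der mu1 e1 s mu2 e2 t x : solves q A mu1 e1 s -> solves q A mu2 e2 t -> A <= x ->
  is_derive (wrR s t) x (- (mu1 - mu2) * (Y1 s x * Y1 t x - Y2 s x * Y2 t x)
                         + (e1 - e2) * (Y1 s x * Y2 t x + Y2 s x * Y1 t x)).
Proof.
intros Hu Hv Hx.
sol_der Hu Hx; sol_der Hv Hx.
unfold wrR; eapply is_derive_eq; [der idtac|cbv beta; ring].
Qed.
Lemma wrI_der mu1 e1 s mu2 e2 t x : solves q A mu1 e1 s -> solves q A mu2 e2 t -> A <= x ->
  is_derive (wrI s t) x (- (mu1 - mu2) * (Y1 s x * Y2 t x + Y2 s x * Y1 t x)
                         - (e1 - e2) * (Y1 s x * Y1 t x - Y2 s x * Y2 t x)).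
Proof.
intros Hu Hv Hx.
sol_der Hu Hx; sol_der Hv Hx.
unfold wrI; eapply is_derive_eq; [der idtac|cbv beta; ring].
Qed.
Lemma wrR_le s t x : Rabs (wrR s t x) <= energy s x + energy t x.
Proof.
pose proof (energy_nonneg s x) as Es; pose proof (energy_nonneg t x) as Et.
unfold wrR, energy, sqY, sqZ in *; apply Rabs_le; split.
- sq_ge0 (Z1 s x + Y1 t x); sq_ge0 (Z2 s x - Y2 t x); sq_ge0 (Y1 s x - Z1 t x); sq_ge0 (Y2 s x + Z2 t x). lra.
- sq_ge0 (Z1 s x - Y1 t x); sq_ge0 (Z2 s x + Y2 t x); sq_ge0 (Y1 s x + Z1 t x); sq_ge0 (Y2 s x - Z2 t x). lra.
Qed.
Lemma wrI_le s t x : Rabs (wrI s t x) <= energy s x + energy t x.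
Proof.
pose proof (energy_nonneg s x) as Es; pose proof (energy_nonneg t x) as Et.
unfold wrI, energy, sqY, sqZ in *; apply Rabs_le; split.
- sq_ge0 (Z1 s x + Y2 t x); sq_ge0 (Z2 s x + Y1 t x); sq_ge0 (Y1 s x - Z2 t x); sq_ge0 (Y2 s x - Z1 t x). lra.
- sq_ge0 (Z1 s x - Y2 t x); sq_ge0 (Z2 s x - Y1 t x); sq_ge0 (Y1 s x + Z2 t x); sq_ge0 (Y2 s x + Z1 t x). lra.
Qed.

(** At equal energies the Wronskian of two Weyl solutions is constant, equal to the difference of
    the two coefficients, and it is small at some far points. *)
Lemma weyl_unique mu eps p h s p' h' s' :
  weyl mu eps p h s -> weyl mu eps p' h' s' -> p = p' /\ h = h'.
Proof.
intros W W'. pose proof (weyl_small3 _ _ _ _ _ _ _ _ _ _ _ _ _ _ _ W W' W') as Hs.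
destruct W as (S & (I1 & I2 & I3 & I4) & _). destruct W' as (S' & (I1' & I2' & I3' & I4') & _).
assert (HR : forall x, A <= x -> wrR s s' x = p - p').
{ intros x Hx. rewrite (der_zero (wrR s s') A x Hx).
  - unfold wrR; rewrite I1, I2, I3, I4, I1', I2', I3', I4'; ring.
  - intros t Ht; eapply is_derive_eq; [eapply wrR_der; eauto; lra|ring]. }
assert (HI : forall x, A <= x -> wrI s s' x = h - h').
{ intros x Hx. rewrite (der_zero (wrI s s') A x Hx).
  - unfold wrI; rewrite I1, I2, I3, I4, I1', I2', I3', I4'; ring.
  - intros t Ht; eapply is_derive_eq; [eapply wrI_der; eauto; lra|ring]. }
assert (forall e, 0 < e -> Rabs (p - p') < e /\ Rabs (h - h') < e) as Hsm.
{ intros e He; destruct (Hs e A He) as (x & Hx & _ & Hlt).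
  rewrite <- (HR x Hx) at 1. rewrite <- (HI x Hx).
  pose proof (wrR_le s s' x); pose proof (wrI_le s s' x); pose proof (energy_nonneg s' x). lra. }
split; apply Rminus_diag_uniq, Rabs_eq_0, Rle_antisym; try apply Rabs_pos;
apply le_epsilon; intros e He; destruct (Hsm e He); lra.
Qed.

Lemma imYZ_int mu eps s X : solves q A mu eps s -> A <= X ->
  imYZ s X = imYZ s A - eps * RInt (sqY s) A X.
Proof.
intros H HX.
assert (HI : RInt (fun x => - eps * sqY s x) A X = imYZ s X - imYZ s A).
{ apply RInt_of_derive; auto; intros x Hx.
  - eapply imYZ_der; eauto.
  - apply (cont_M (fun _ => - eps)); [apply cont_C|]. eapply sqY_cont; eauto. }
rewrite (RInt_from_scal (sqY s) A) in HI; try lra.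
intros; eapply sqY_cont; eauto.
Qed.

Lemma zero_on_der (f : R -> R) (a b x l : R) : (forall t, a < t < b -> f t = 0) -> a < x < b ->
  is_derive f x l -> l = 0.
Proof.
intros Hf Hx Hd.
assert (is_derive f x 0).
{ apply is_derive_ext_loc with (fun _ => 0); [|apply derC].
  assert (Hp : 0 < Rmin (x - a) (b - x)) by (apply Rmin_pos; lra).
  exists (mkposreal _ Hp); intros y Hy.
  unball Hy.
  min_le (x - a) (b - x).
  apply Rabs_def2 in Hy. symmetry; apply Hf; lra. }
now rewrite <- (is_derive_unique _ _ _ Hd), <- (is_derive_unique _ _ _ H).
Qed.

Lemma imYZ_decr mu eps s x y : 0 <= eps -> solves q A mu eps s -> A <= x -> x <= y ->
  imYZ s y <= imYZ s x.
Proof.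
intros He H Hx Hy; apply der_decr; auto. intros t Ht; eexists; split.
- eapply imYZ_der; eauto; lra.
- pose proof (sqY_nonneg s t); nra.
Qed.

(** Without strict decrease [|y|^2] would vanish on an interval; so would its derivative and then
    that of [reYZ], which forces [y' = 0] as well, against [energy_pos]. *)
Lemma imYZ_strict mu eps s X : 0 < eps -> solves q A mu eps s -> 0 < energy s A -> A < X ->
  imYZ s X < imYZ s A.
Proof.
intros He H HE HX. apply Rnot_le_lt; intros Hle.
assert (HJ : forall x, A < x < X -> imYZ s x - imYZ s A = 0).
{ intros x Hx.
  assert (imYZ s X <= imYZ s x) by (eapply imYZ_decr; eauto; lra).
  assert (imYZ s x <= imYZ s A) by (eapply imYZ_decr; eauto; lra). lra. }
assert (HN : forall x, A < x < X -> sqY s x = 0).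
{ intros x Hx. assert (- eps * sqY s x - 0 = 0); [|nra].
  apply (zero_on_der (fun x => imYZ s x - imYZ s A) A X x); auto.
  apply derB; [eapply imYZ_der; eauto; lra|apply derC]. }
assert (HC : forall x, A < x < X -> reYZ s x = 0).
{ intros x Hx. assert (2 * reYZ s x = 0); [|lra].
  apply (zero_on_der (sqY s) A X x); auto. eapply sqY_der; eauto; lra. }
set (x := (A + X) / 2). assert (Hx : A < x < X) by (unfold x; lra).
assert (HZ : sqZ s x + (q x - mu) * sqY s x = 0).
{ apply (zero_on_der (reYZ s) A X x); auto. eapply reYZ_der; eauto; lra. }
rewrite (HN x Hx), Rmult_0_r, Rplus_0_r in HZ.
assert (0 < energy s x) by (eapply energy_pos; eauto; lra).
unfold energy in H0; rewrite HZ, (HN x Hx) in H0; lra.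
Qed.

End Schroedinger.

(** * Existence and uniqueness of the Weyl solution *)

Section Weyl.
Variables (q : R -> R) (A : R).
Hypothesis qC : forall x, A <= x -> continuous q x.
(** A common form of the two cases: [B = 0] and [g = |q|] in case (a), [q] bounded and [g = 0] in
    case (b). It serves to make [y'] square integrable together with [y]. *)
Hypothesis q_tame : exists B G (g : R -> R), 0 <= B /\ 0 <= G /\
  (forall x, A <= x -> continuous g x /\ 0 <= g x /\ Rabs (q x) <= B + g x) /\
  (forall X, A <= X -> RInt g A X <= G).

(* If [int |y'|^2] were unbounded then [(|y|^2)'] would tend to infinity. *)
Lemma energy_integrable mu eps s : solves q A mu eps s -> square_integrable A s ->
  exists B, forall X, A <= X -> RInt (energy s) A X <= B.
Proof.
intros H (L & HL). destruct q_tame as (B & G & g & HB & HG & Hg & HGi).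
assert (NC := fun x => sqY_cont q A mu eps s x H). assert (ZC := fun x => sqZ_cont q A mu eps s x H).
assert (Nd := fun x => sqY_der q A mu eps s x H). assert (Cd := fun x => reYZ_der q A mu eps s x H).
assert (CC : forall x, A <= x -> continuous (reYZ s) x) by (intros x Hx; exact (der_cont _ _ _ (Cd x Hx))).
assert (gC : forall x, A <= x -> continuous g x) by (intros; now apply Hg).
assert (HL0 : 0 <= L) by (specialize (HL A (Rle_refl _)); rewrite RInt_point in HL; exact HL).
set (T := fun X => RInt (sqZ s) A X).
(* Chosen so that [t * G <= / 2]: the pointwise bound [Nle] on [|y|^2] contains [t * T X], and after
   integration against [g] this part is absorbed by half of [T X]. *)
set (t := / (2 * (G + 1))).
assert (Ht : 0 < t) by (apply Rinv_0_lt_compat; lra).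
assert (Hti : / t = 2 * (G + 1)) by (unfold t; field; lra).
assert (T0 : forall a b, A <= a -> a <= b -> 0 <= RInt (sqZ s) a b).
{ intros a b Ha Hb; apply RInt_from_nonneg with A; auto; intros; apply sqZ_nonneg. }
assert (Tm : forall a b, A <= a -> a <= b -> T a <= T b).
{ intros a b Ha Hb; unfold T; rewrite (RInt_from_Chasles _ A A a b) by (auto; lra).
  specialize (T0 a b Ha Hb); lra. }
(* Integrate [(|y|^2)' = 2 Re (conj y y') <= t |y'|^2 + / t |y|^2]. *)
assert (Nle : forall x X, A <= x -> x <= X -> sqY s x <= sqY s A + (t * T X + / t * L)).
{ intros x X Hx HX.
  assert (E : RInt (fun x => 2 * reYZ s x) A x = sqY s x - sqY s A).
  { apply RInt_of_derive; auto. intros; cont ltac:(auto). }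
  assert (E2 : RInt (fun x => 2 * reYZ s x) A x <= RInt (fun x => t * sqZ s x + / t * sqY s x) A x).
  { apply RInt_from_le with A; try lra; intros y Hy; [cont ltac:(auto)|cont ltac:(auto)|].
    unfold reYZ, sqZ, sqY.
    assert (0 <= t * ((Z1 s y - / t * Y1 s y) ^ 2 + (Z2 s y - / t * Y2 s y) ^ 2)).
    { apply Rmult_le_pos; [lra|]. sq_ge0 (Z1 s y - / t * Y1 s y); sq_ge0 (Z2 s y - / t * Y2 s y); lra. }
    replace (t * ((Z1 s y - / t * Y1 s y) ^ 2 + (Z2 s y - / t * Y2 s y) ^ 2)) with
      (t * (Z1 s y ^ 2 + Z2 s y ^ 2) + / t * (Y1 s y ^ 2 + Y2 s y ^ 2)
       - 2 * (Y1 s y * Z1 s y + Y2 s y * Z2 s y)) in H0 by (field; lra). lra. }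
  rewrite E in E2.
  rewrite (RInt_from_plus (fun x => t * sqZ s x) (fun x => / t * sqY s x) A) in E2;
    try lra; try (intros; cont ltac:(auto)).
  rewrite !(RInt_from_scal _ A) in E2; auto; try lra.
  specialize (HL x Hx). specialize (Tm x X Hx HX).
  assert (/ t * RInt (sqY s) A x <= / t * L) by (apply Rmult_le_compat_l; [rewrite Hti|]; lra).
  assert (t * RInt (sqZ s) A x <= t * T X) by (apply Rmult_le_compat_l; [lra|exact Tm]). lra. }
set (K := - reYZ s A + (B + Rabs mu) * L + (sqY s A + / t * L) * G).
assert (HT : forall X, A <= X -> T X / 2 <= reYZ s X + K).
{ intros X HX.
  set (S := sqY s A + (t * T X + / t * L)).
  set (f := fun x => (sqZ s x + (q x - mu) * sqY s x) + ((B + Rabs mu) * sqY s x + S * g x)).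
  assert (E : T X <= RInt f A X).
  { unfold T; apply RInt_le; auto.
    - apply ex_RInt_from with A; auto; lra.
    - apply ex_RInt_from with A; try lra. unfold f; intros; cont ltac:(auto).
    - intros x Hx. unfold f.
      assert (Hgx := Hg x ltac:(lra)). assert (Hn := Nle x X ltac:(lra) ltac:(lra)). fold S in Hn.
      pose proof (sqY_nonneg s x).
      destruct Hgx as (_ & Hg0 & Hq).
      assert (- (B + g x) - Rabs mu <= q x - mu).
      { apply Rabs_le_between in Hq. pose proof (Rle_abs mu). lra. }
      nra. }
  unfold f in E.
  rewrite (RInt_from_plus (fun x => sqZ s x + (q x - mu) * sqY s x)
    (fun x => (B + Rabs mu) * sqY s x + S * g x) A) in E;
    try lra; try (intros; cont ltac:(auto)).
  rewrite (RInt_from_plus (fun x => (B + Rabs mu) * sqY s x) (fun x => S * g x) A) in E;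
    try lra; try (intros; cont ltac:(auto)).
  rewrite !(RInt_from_scal _ A) in E; auto; try lra.
  rewrite (RInt_of_derive (reYZ s) (fun x => sqZ s x + (q x - mu) * sqY s x)) in E; auto;
    [|intros; cont ltac:(auto)].
  specialize (HL X HX); specialize (HGi X HX).
  assert (HS : 0 <= S).
  { unfold S; pose proof (sqY_nonneg s A). assert (0 <= T X) by (apply T0; lra).
    assert (0 <= / t * L) by (apply Rmult_le_pos; [rewrite Hti|]; lra). nra. }
  assert ((B + Rabs mu) * RInt (sqY s) A X <= (B + Rabs mu) * L).
  { apply Rmult_le_compat_l; auto. abs_ge0 mu; lra. }
  assert (S * RInt g A X <= S * G) by (apply Rmult_le_compat_l; auto).
  assert (t * T X * G <= T X / 2).
  { assert (0 <= T X) by (apply T0; lra).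
    assert (t * G <= / 2).
    { unfold t. apply Rmult_le_reg_l with (2 * (G + 1)); [lra|]. rewrite <- Rmult_assoc, Rinv_r; lra. }
    nra. }
  unfold K, S in *. lra. }
(* Otherwise [reYZ > 1] from [X1] on, so [sqY s x - 2 * x] increases and [sqY] is at least 2 beyond
   [X1 + 1]; but square integrability yields a point there with [sqY < 1]. *)
assert (HTb : forall X, A <= X -> T X <= 2 * Rabs K + 2).
{ intros X1 HX1. apply Rnot_lt_le; intros Hlt.
  destruct (small_often (sqY s) A L NC) with (e := 1) (X0 := X1 + 1) as (x & Hx & Hx' & Hs); auto.
  - intros; apply sqY_nonneg.
  - lra.
  - assert (sqY s X1 - 2 * X1 <= sqY s x - 2 * x).
    { apply (der_incr (fun x => sqY s x - 2 * x)); [lra|]. intros y Hy. eexists; split.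
      - eapply derB; [apply Nd; lra|eapply derM; [apply derC|apply derI]].
      - specialize (HT y ltac:(lra)); specialize (Tm X1 y HX1 ltac:(lra)).
        pose proof (Rle_abs K). cbv beta. lra. }
    pose proof (sqY_nonneg s X1). lra. }
exists (L + (2 * Rabs K + 2)); intros X HX.
unfold energy; rewrite (RInt_from_plus (sqY s) (sqZ s) A) by (auto; lra).
specialize (HL X HX); specialize (HTb X HX); unfold T in HTb; lra.
Qed.

(** [crossP] and [crossH] are the linear coefficients in [p] and [h] of [imYZ (comb u p h v)], a
    quadratic polynomial whose level sets are the Weyl circles. *)
Definition crossP (u v : sol) (x : R) : R :=
  Y1 u x * Z2 v x - Y2 u x * Z1 v x + Y1 v x * Z2 u x - Y2 v x * Z1 u x.
Definition crossH (u v : sol) (x : R) : R :=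
  Y1 u x * Z1 v x + Y2 u x * Z2 v x - Y1 v x * Z1 u x - Y2 v x * Z2 u x.

Lemma imYZ_comb u v p h x : imYZ (comb u p h v) x =
  imYZ u x + p * crossP u v x + h * crossH u v x + (p ^ 2 + h ^ 2) * imYZ v x.
Proof. unfold imYZ, crossP, crossH; cbn [Y1 Y2 Z1 Z2 comb]; ring. Qed.

(** The discriminant of that polynomial is the squared modulus of a Wronskian, hence constant along
    solutions at one energy; this is why the radius of a Weyl disc depends on [imYZ v] alone. *)
Lemma cross_wronskian u v x : crossP u v x ^ 2 + crossH u v x ^ 2 - 4 * imYZ v x * imYZ u x =
  wrR v u x ^ 2 + wrI v u x ^ 2.
Proof. unfold imYZ, crossP, crossH, wrR, wrI; ring. Qed.

(* The Weyl disc at [x] is [imYZ (comb u p h v) x >= 0]; its radius is [/ (2 * - imYZ v x)]. *)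
Lemma weyl_disc u v x p h : wrR v u x = 1 -> wrI v u x = 0 -> imYZ v x < 0 ->
  - imYZ (comb u p h v) x =
  - imYZ v x * ((p - crossP u v x / (2 * - imYZ v x)) ^ 2 + (h - crossH u v x / (2 * - imYZ v x)) ^ 2)
  - / (4 * - imYZ v x).
Proof.
intros HR HI Hv. rewrite imYZ_comb.
pose proof (cross_wronskian u v x) as E. rewrite HR, HI in E.
replace (/ (4 * - imYZ v x)) with
  ((crossP u v x ^ 2 + crossH u v x ^ 2 - 4 * imYZ v x * imYZ u x) / (4 * - imYZ v x)) by (rewrite E; field; lra).
field; lra.
Qed.

(* The centres of the nested Weyl discs form a Cauchy sequence. *)
Lemma weyl_exists mu eps : 0 < eps -> exists p h s, weyl q A mu eps p h s.
Proof.
intros He.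
destruct (solves_exists q A qC mu eps 1 0 0 0) as (u & Hu & U1 & U2 & U3 & U4).
destruct (solves_exists q A qC mu eps 0 0 1 0) as (v & Hv & V1 & V2 & V3 & V4).
assert (HR : forall x, A <= x -> wrR v u x = 1).
{ intros x Hx; rewrite (der_zero (wrR v u) A x Hx).
  - unfold wrR; rewrite U1, U2, U3, U4, V1, V2, V3, V4; ring.
  - intros t Ht; eapply is_derive_eq; [eapply wrR_der; eauto; lra|ring]. }
assert (HI : forall x, A <= x -> wrI v u x = 0).
{ intros x Hx; rewrite (der_zero (wrI v u) A x Hx).
  - unfold wrI; rewrite U1, U2, U3, U4, V1, V2, V3, V4; ring.
  - intros t Ht; eapply is_derive_eq; [eapply wrI_der; eauto; lra|ring]. }
assert (HA : imYZ v A = 0) by (unfold imYZ; rewrite V1, V2; ring).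
assert (Hneg : forall x, A < x -> imYZ v x < 0).
{ intros x Hx; rewrite <- HA. apply (imYZ_strict q A qC mu eps); auto.
  unfold energy, sqY, sqZ; rewrite V1, V2, V3, V4; lra. }
assert (Hcomb : forall p h, solves q A mu eps (comb u p h v)) by (intros; now apply comb_solves).
set (X := fun n : nat => A + 1 + INR n).
assert (HX : forall n, A + 1 <= X n) by (intros n; unfold X; pose proof (pos_INR n); lra).
set (s := fun n => - imYZ v (X n)).
set (P := fun n => crossP u v (X n) / (2 * s n)). set (H := fun n => crossH u v (X n) / (2 * s n)).
set (w := fun n => / (4 * s n)).
assert (s0 : forall n, 0 < s n) by (intros n; unfold s; specialize (Hneg (X n)); specialize (HX n); lra).
assert (sm : forall n, s 0%nat <= s n).
{ intros n; unfold s. apply Ropp_le_contravar, (imYZ_decr q A mu eps); auto; try lra.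
  - specialize (HX 0%nat); lra.
  - unfold X; simpl; pose proof (pos_INR n); lra. }
assert (Hdisc : forall n p h, - imYZ (comb u p h v) (X n) = s n * ((p - P n) ^ 2 + (h - H n) ^ 2) - w n).
{ intros n p h. specialize (HX n). apply weyl_disc; [apply HR|apply HI|apply Hneg]; lra. }
(* Test the centre of disc [m] at both points. At [X m] the value of [- imYZ] is [- w m]; at [X n]
   it is smaller, since [imYZ] decreases in [x], and there it contains the squared distance of the
   centres. So [w] decreases and controls the Cauchy property. *)
assert (Hnest : forall n m, (n <= m)%nat -> s 0%nat * ((P m - P n) ^ 2 + (H m - H n) ^ 2) <= w n - w m).
{ intros n m Hnm.
  assert (E1 := Hdisc n (P m) (H m)). assert (E2 := Hdisc m (P m) (H m)).
  assert (imYZ (comb u (P m) (H m) v) (X m) <= imYZ (comb u (P m) (H m) v) (X n)).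
  { apply (imYZ_decr q A mu eps); auto; try lra.
    - specialize (HX n); lra.
    - unfold X; apply le_INR in Hnm; lra. }
  specialize (sm n). sq_ge0 (P m - P n); sq_ge0 (H m - H n). nra. }
assert (w0 : forall n, 0 < w n) by (intros n; unfold w; apply Rinv_0_lt_compat; specialize (s0 n); lra).
assert (Hw : ex_finite_lim_seq w).
{ apply ex_finite_lim_seq_decr with 0.
  - intros n. specialize (Hnest n (S n) ltac:(lia)). specialize (s0 0%nat).
    sq_ge0 (P (S n) - P n); sq_ge0 (H (S n) - H n). nra.
  - intros n; specialize (w0 n); lra. }
assert (HC : forall e : posreal, exists N : nat, forall n m, (N <= n)%nat -> (N <= m)%nat ->
   Rabs (P n - P m) < e /\ Rabs (H n - H m) < e).
{ intros e. apply ex_lim_seq_cauchy_corr in Hw.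
  assert (He2 : 0 < s 0%nat * e ^ 2).
  { apply Rmult_lt_0_compat; auto. apply pow_lt, cond_pos. }
  destruct (Hw (mkposreal _ He2)) as (N & HN). exists N.
  assert (Hsq : forall a, s 0%nat * a ^ 2 < s 0%nat * e ^ 2 -> Rabs a < e).
  { intros a Ha. apply Rmult_lt_reg_l in Ha; auto. rewrite <- (Rabs_right e) by (left; apply cond_pos).
    apply Rsqr_lt_abs_0; unfold Rsqr; simpl in Ha; lra. }
  assert (Hlt : forall n m, (N <= n)%nat -> (n <= m)%nat -> Rabs (P m - P n) < e /\ Rabs (H m - H n) < e).
  { intros n m Hn Hm. specialize (HN n m Hn ltac:(lia)). simpl in HN. apply Rabs_def2 in HN.
    specialize (Hnest n m Hm). specialize (s0 0%nat).
    sq_ge0 (P m - P n); sq_ge0 (H m - H n).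
    split; apply Hsq; nra. }
  intros n m Hn Hm. destruct (Nat.le_ge_cases n m) as [Hc|Hc].
  - rewrite (Rabs_minus_sym (P n)), (Rabs_minus_sym (H n)). auto.
  - auto. }
assert (HP : ex_finite_lim_seq P).
{ apply ex_lim_seq_cauchy_corr; intros e; destruct (HC e) as (N & HN); exists N; intros; now apply HN. }
assert (HH : ex_finite_lim_seq H).
{ apply ex_lim_seq_cauchy_corr; intros e; destruct (HC e) as (N & HN); exists N; intros; now apply HN. }
destruct HP as (p & HP). destruct HH as (h & HH).
(* For [X n >= x] the solution built on centre [n] has [imYZ] at [x] at least its value [w n > 0] at
   [X n]; let the centres converge with [x] fixed. *)
assert (HJ : forall x, A <= x -> 0 <= imYZ (comb u p h v) x).
{ intros x Hx. rewrite imYZ_comb.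
  apply (is_lim_seq_le_loc (fun _ => 0) (fun n => imYZ u x + P n * crossP u v x + H n * crossH u v x + (P n * P n + H n * H n) * imYZ v x) (Finite 0)
    (Finite (imYZ u x + p * crossP u v x + h * crossH u v x + (p ^ 2 + h ^ 2) * imYZ v x))).
  - destruct (nfloor_ex (Rmax 0 (x - A))) as (N & HN); [apply Rmax_l|].
    exists N; intros n Hn.
    replace (P n * P n + H n * H n) with (P n ^ 2 + H n ^ 2) by ring.
    rewrite <- imYZ_comb. apply Rle_trans with (imYZ (comb u (P n) (H n) v) (X n)).
    + specialize (Hdisc n (P n) (H n)); specialize (w0 n). rewrite !Rminus_diag in Hdisc. lra.
    + apply (imYZ_decr q A mu eps); auto; try lra.
      unfold X. apply le_INR in Hn. pose proof (Rmax_r 0 (x - A)). lra.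
  - apply is_lim_seq_const.
  - replace (p ^ 2 + h ^ 2) with (p * p + h * h) by ring.
    apply is_lim_seq_plus'; [apply is_lim_seq_plus'; [apply is_lim_seq_plus'; [apply is_lim_seq_const|]|]|];
      apply is_lim_seq_mult'; try assumption; try apply is_lim_seq_const.
    apply is_lim_seq_plus'; apply is_lim_seq_mult'; assumption. }
exists p, h, (comb u p h v). split; [auto|]; split.
- unfold initial; cbn [Y1 Y2 Z1 Z2 comb]; rewrite U1, U2, U3, U4, V1, V2, V3, V4; repeat split; ring.
- apply (energy_integrable mu eps); auto.
  (* [eps] times the integral of [|y|^2] is the drop of [imYZ] from its initial value [h], and
     [imYZ] stays nonnegative. *)
  exists (h / eps); intros x Hx.
  specialize (HJ x Hx). rewrite (imYZ_int q A mu eps) in HJ; auto.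
  rewrite imYZ_comb, HA in HJ.
  unfold crossP, crossH, imYZ at 1 in HJ. rewrite U1, U2, U3, U4, V1, V2, V3, V4 in HJ.
  apply Rmult_le_reg_l with eps; auto. replace (eps * (h / eps)) with h by (field; lra). lra.
Qed.

Lemma weyl_imYZ_nonneg mu eps p h s x : 0 < eps -> weyl q A mu eps p h s -> A <= x -> 0 <= imYZ s x.
Proof.
intros He W Hx. pose proof (weyl_small3 q A _ _ _ _ _ _ _ _ _ _ _ _ _ _ _ W W W) as Hs.
apply Rnot_lt_le; intros Hlt.
destruct (Hs (- imYZ s x) x) as (y & Hy & Hxy & Hsm); [lra|].
assert (imYZ s y <= imYZ s x) by (eapply imYZ_decr; [| apply W | |]; lra).
pose proof (imYZ_le s y) as Hb; apply Rabs_le_between in Hb.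
pose proof (energy_nonneg s y). lra.
Qed.

Lemma weyl_imYZ_A mu eps p h s : weyl q A mu eps p h s -> imYZ s A = h.
Proof. intros (_ & (I1 & I2 & I3 & I4) & _). unfold imYZ; rewrite I1, I2, I3, I4; ring. Qed.

Lemma weyl_is_TW mu eps p h s : 0 < eps -> weyl q A mu eps p h s -> is_TW q A (mu, eps) (p, h).
Proof.
intros He W u1 u2 du1 du2 v1 v2 dv1 dv2 Hu Hv A1 A2 A3 A4 B1 B2 B3 B4.
set (u := Sol u1 u2 du1 du2). set (v := Sol v1 v2 dv1 dv2).
assert (S' : solves q A mu eps (comb u p h v)) by (apply comb_solves; assumption).
destruct W as (Ss & (I1 & I2 & I3 & I4) & B & HB).
assert (Heq := solves_unique q A qC mu eps (comb u p h v) s S' Ss).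
assert (Hc := fun x => sqY_cont q A mu eps _ x S').
apply (L2_of_bounded (sqY (comb u p h v)) A B Hc).
- intros; apply sqY_nonneg.
- intros X HX. eapply Rle_trans; [|apply (HB X HX)].
  apply RInt_le; auto.
  + apply ex_RInt_from with A; auto; lra.
  + apply ex_RInt_from with A; try lra. intros; eapply energy_cont; eauto.
  + intros x Hx. unfold sqY at 1.
    destruct Heq with x as (E1 & E2 & _); try lra;
      try (cbn [Y1 Y2 Z1 Z2 comb u v]; rewrite ?A1, ?A2, ?A3, ?A4, ?B1, ?B2, ?B3, ?B4, ?I1, ?I2, ?I3, ?I4; ring).
    rewrite E1, E2. unfold energy. fold (sqY s x). pose proof (sqZ_nonneg s x). lra.
Qed.

(** [is_TW] quantifies universally over the fundamental system, so one must be constructed before it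
    says anything about [m]. Square integrability is then upgraded to integrable energy, and
    uniqueness of Weyl solutions applies. With existence, this pins down the [epsilon] in [mA]. *)
Lemma TW_unique mu eps p h s m : 0 < eps -> weyl q A mu eps p h s -> is_TW q A (mu, eps) m -> m = (p, h).
Proof.
intros He W Hm.
destruct (solves_exists q A qC mu eps 1 0 0 0) as (u & Hu & U1 & U2 & U3 & U4).
destruct (solves_exists q A qC mu eps 0 0 1 0) as (v & Hv & V1 & V2 & V3 & V4).
specialize (Hm _ _ _ _ _ _ _ _ Hu Hv U1 U2 U3 U4 V1 V2 V3 V4).
destruct m as (p', h').
assert (S' : solves q A mu eps (comb u p' h' v)) by (apply comb_solves; assumption).
assert (W' : weyl q A mu eps p' h' (comb u p' h' v)).
{ split; [auto|]; split.
  - unfold initial; cbn [Y1 Y2 Z1 Z2 comb]; rewrite U1, U2, U3, U4, V1, V2, V3, V4; repeat split; ring.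
  - apply (energy_integrable mu eps); auto.
    apply (gen_int_bounded (sqY (comb u p' h' v))); auto.
    + intros; eapply sqY_cont; eauto.
    + intros; apply sqY_nonneg. }
destruct (weyl_unique q A mu eps p h s p' h' _ W W'). subst; reflexivity.
Qed.

Lemma TW_epsilon mu eps : 0 < eps -> exists s,
  weyl q A mu eps (Re (epsilon (inhabits (RtoC 0)) (is_TW q A (mu, eps))))
                  (Im (epsilon (inhabits (RtoC 0)) (is_TW q A (mu, eps)))) s.
Proof.
intros He. destruct (weyl_exists mu eps He) as (p & h & s & W). exists s.
assert (E : epsilon (inhabits (RtoC 0)) (is_TW q A (mu, eps)) = (p, h)).
{ apply (TW_unique mu eps p h s); auto. apply epsilon_spec. exists (p, h).
  now apply (weyl_is_TW mu eps p h s). }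
rewrite E; exact W.
Qed.

End Weyl.

(** * Holomorphy of the Titchmarsh-Weyl function *)

(** [f] is replaced by the constant [f A] to the left of [A], so that the derivative at [A] is
    two-sided as [is_derive] demands. *)
Lemma primitive_exists (f : R -> R) A : (forall x, A <= x -> continuous f x) ->
  exists P, P A = 0 /\ forall x, A <= x -> is_derive P x (f x).
Proof.
intros Hf. set (g := fun t => f ((A + t + Rabs (t - A)) / 2)).
assert (gC : forall t, continuous g t).
{ intros t. apply (continuous_comp (fun t => (A + t + Rabs (t - A)) / 2) f).
  - unfold Rdiv; cont ltac:(apply continuous_id).
  - apply Hf. destruct (Rle_lt_dec A t); [rewrite Rabs_right|rewrite Rabs_left]; lra. }
exists (fun x => RInt g A x); split; [rewrite RInt_point; reflexivity|].
intros x Hx. eapply is_derive_eq; [apply cont_RInt; auto|].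
unfold g; f_equal; rewrite Rabs_right by lra; field.
Qed.

Lemma quad_derive (f : R -> R) (x l K r : R) : 0 < r ->
  (forall y, Rabs (y - x) < r -> Rabs (f y - f x - l * (y - x)) <= K * (y - x) ^ 2) ->
  is_derive f x l.
Proof.
intros Hr H. apply is_derive_Reals. intros e He.
set (K' := Rabs K + 1). assert (HK : 0 < K') by (unfold K'; abs_ge0 K; lra).
assert (Hd : 0 < Rmin r (e / K')) by (apply Rmin_pos; auto; apply Rdiv_lt_0_compat; lra).
exists (mkposreal _ Hd). intros t Ht Hlt; simpl in Hlt.
min_le r (e / K').
specialize (H (x + t)). replace (x + t - x) with t in H by ring. specialize (H ltac:(lra)).
replace ((f (x + t) - f x) / t - l) with ((f (x + t) - f x - l * t) / t) by (field; auto).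
unfold Rdiv; rewrite Rabs_mult, Rabs_inv.
assert (Hp : 0 < Rabs t) by (now apply Rabs_pos_lt).
apply Rmult_lt_reg_r with (Rabs t); auto. rewrite Rmult_assoc, Rinv_l, Rmult_1_r by lra.
eapply Rle_lt_trans; [exact H|].
replace (t ^ 2) with (Rabs t * Rabs t) by (rewrite <- Rabs_mult; rewrite Rabs_right; [ring|apply Rle_ge, Rle_0_sqr]).
assert (Rabs t * K' < e).
{ apply Rmult_lt_reg_r with (/ K'); [now apply Rinv_0_lt_compat|].
  rewrite Rmult_assoc, Rinv_r by lra. unfold Rdiv in *. lra. }
assert (K * (Rabs t * Rabs t) <= K' * (Rabs t * Rabs t)).
{ apply Rmult_le_compat_r; [nra|]. unfold K'; pose proof (Rle_abs K); lra. }
nra.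
Qed.

Section Analytic.
Variables (q : R -> R) (A : R).
Hypothesis qC : forall x, A <= x -> continuous q x.

Lemma weyl_h_nonneg mu eps p h s : 0 < eps -> weyl q A mu eps p h s -> 0 <= h.
Proof.
intros He W; rewrite <- (weyl_imYZ_A q A mu eps p h s W).
apply (weyl_imYZ_nonneg q A mu eps p h); auto; lra.
Qed.

Lemma sqY_comb_minus s1 s2 x : energy (comb s1 (-1) 0 s2) x <= 2 * (energy s1 x + energy s2 x).
Proof.
unfold energy, sqY, sqZ; cbn [Y1 Y2 Z1 Z2 comb].
sq_ge0 (Y1 s1 x + Y1 s2 x); sq_ge0 (Y2 s1 x + Y2 s2 x).
sq_ge0 (Z1 s1 x + Z1 s2 x); sq_ge0 (Z2 s1 x + Z2 s2 x). lra.
Qed.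

Lemma cross_le t a b c d : 0 < t ->
  Rabs (a * d + b * c) <= (t * (a ^ 2 + b ^ 2) + / t * (c ^ 2 + d ^ 2)) / 2.
Proof.
intros Ht.
assert (H : forall sg : R, sg = 1 \/ sg = -1 ->
  0 <= t * (a ^ 2 + b ^ 2) + / t * (c ^ 2 + d ^ 2) + 2 * sg * (a * d + b * c)).
{ intros sg Hsg. apply Rle_trans with (t * ((a + sg * / t * d) ^ 2 + (b + sg * / t * c) ^ 2)).
  - apply Rmult_le_pos; [lra|]. apply Rplus_le_le_0_compat; apply pow2_ge_0.
  - right; destruct Hsg; subst sg; field; lra. }
pose proof (H 1 (or_introl eq_refl)). pose proof (H (-1) (or_intror eq_refl)). apply Rabs_le; split; lra.
Qed.

(** A Harnack-type inequality. [wrI s1 s2] equals [h1 - h2] at [A]; its derivative is a product of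
    the two solutions, split with weight [t] into [|y|^2] terms that the decrease of the two [imYZ]
    compensates. The weight stays free so that the [h1] term on the right can be absorbed when [e1]
    is small. *)
Lemma weyl_im_compare mu1 e1 p1 h1 s1 mu2 e2 p2 h2 s2 t : 0 < e1 -> 0 < e2 -> 0 < t ->
  weyl q A mu1 e1 p1 h1 s1 -> weyl q A mu2 e2 p2 h2 s2 ->
  h1 <= h2 + (Rabs (mu1 - mu2) + Rabs (e1 - e2)) / 2 * (t * h1 / e1 + h2 / (t * e2)).
Proof.
intros He1 He2 Ht W1 W2.
pose proof (weyl_small3 q A _ _ _ _ _ _ _ _ _ _ _ _ _ _ _ W1 W2 W2) as Hs.
pose proof (weyl_imYZ_A _ _ _ _ _ _ _ W1) as J1. pose proof (weyl_imYZ_A _ _ _ _ _ _ _ W2) as J2.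
assert (J1p := fun x => weyl_imYZ_nonneg q A _ _ _ _ _ x He1 W1).
assert (J2p := fun x => weyl_imYZ_nonneg q A _ _ _ _ _ x He2 W2).
destruct W1 as (S1 & (I1 & I2 & I3 & I4) & _). destruct W2 as (S2 & (K1 & K2 & K3 & K4) & _).
set (D := (Rabs (mu1 - mu2) + Rabs (e1 - e2)) / 2).
assert (HD : 0 <= D) by (unfold D; abs_ge0 (mu1 - mu2); abs_ge0 (e1 - e2); lra).
assert (Hc1 : 0 <= D * t / e1) by (apply Rdiv_le_0_compat; nra).
assert (Hc2 : 0 <= D / (t * e2)) by (apply Rdiv_le_0_compat; nra).
assert (HF : wrI s1 s2 A - (D * t / e1 * imYZ s1 A + D / (t * e2) * imYZ s2 A) <= 0).
{ apply (compare_at_infinity (fun x => wrI s1 s2 x - (D * t / e1 * imYZ s1 x + D / (t * e2) * imYZ s2 x))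
    (fun x => energy s1 x + energy s2 x + energy s2 x) A 1); auto.
  - intros x Hx. eexists; split.
    + eapply derB; [eapply wrI_der; eauto|].
      apply derP; (eapply derM; [apply derC|eapply imYZ_der; eauto]).
    + cbv beta. unfold sqY.
      set (a := Y1 s1 x); set (b := Y2 s1 x); set (c := Y1 s2 x); set (d := Y2 s2 x).
      pose proof (cross_le t a b c d Ht) as Hs1.
      pose proof (cross_le t a (- b) d c Ht) as Hs2.
      replace (a * c + - b * d) with (a * c - b * d) in Hs2 by ring.
      replace (t * (a ^ 2 + (- b) ^ 2) + / t * (d ^ 2 + c ^ 2)) with
        (t * (a ^ 2 + b ^ 2) + / t * (c ^ 2 + d ^ 2)) in Hs2 by ring.
      set (Bd := (t * (a ^ 2 + b ^ 2) + / t * (c ^ 2 + d ^ 2)) / 2) in *.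
      replace (- (mu1 - mu2) * (a * d + b * c) - (e1 - e2) * (a * c - b * d) -
        (0 * imYZ s1 x + D * t / e1 * (- e1 * (a ^ 2 + b ^ 2)) +
         (0 * imYZ s2 x + D / (t * e2) * (- e2 * (c ^ 2 + d ^ 2))))) with
        (2 * D * Bd - ((mu1 - mu2) * (a * d + b * c) + (e1 - e2) * (a * c - b * d))) by (unfold Bd; field; lra).
      assert (E1 : (mu1 - mu2) * (a * d + b * c) <= Rabs (mu1 - mu2) * Bd).
      { eapply Rle_trans; [apply Rle_abs|]. rewrite Rabs_mult. apply Rmult_le_compat_l; auto; apply Rabs_pos. }
      assert (E2 : (e1 - e2) * (a * c - b * d) <= Rabs (e1 - e2) * Bd).
      { eapply Rle_trans; [apply Rle_abs|]. rewrite Rabs_mult. apply Rmult_le_compat_l; auto; apply Rabs_pos. }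
      unfold D; lra.
  - intros x Hx. specialize (J1p x Hx); specialize (J2p x Hx).
    pose proof (wrI_le s1 s2 x) as Hb. apply Rabs_le_between in Hb. pose proof (energy_nonneg s2 x).
    assert (0 <= D * t / e1 * imYZ s1 x) by (apply Rmult_le_pos; auto).
    assert (0 <= D / (t * e2) * imYZ s2 x) by (apply Rmult_le_pos; auto). lra.
  - intros x Hx. pose proof (energy_nonneg s1 x). pose proof (energy_nonneg s2 x). lra. }
assert (E : wrI s1 s2 A = h1 - h2) by (unfold wrI; rewrite I1, I2, I3, I4, K1, K2, K3, K4; ring).
rewrite E, J1, J2 in HF.
replace (D * (t * h1 / e1 + h2 / (t * e2))) with (D * t / e1 * h1 + D / (t * e2) * h2) by (field; lra). lra.
Qed.

(** Monotonicity upgrades smallness at some far points to convergence. *)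
Lemma weyl_imYZ_to_0 mu eps p h s : 0 < eps -> weyl q A mu eps p h s ->
  forall e, 0 < e -> exists X, A <= X /\ forall x, X <= x -> 0 <= imYZ s x < e.
Proof.
intros He W e Hp. pose proof (weyl_small3 q A _ _ _ _ _ _ _ _ _ _ _ _ _ _ _ W W W) as Hs.
destruct (Hs e A Hp) as (X & HX & _ & Hlt). exists X; split; auto. intros x Hx; split.
- apply (weyl_imYZ_nonneg q A mu eps p h); auto; lra.
- apply Rle_lt_trans with (imYZ s X).
  + apply (imYZ_decr q A mu eps); try lra; auto. apply W.
  + pose proof (imYZ_le s X) as Hb; apply Rabs_le_between in Hb.
    pose proof (energy_nonneg s X); lra.
Qed.

(* Absolute convergence: [|P'| <= |y|^2 = - (Im conj y y')' / eps]. *)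
Lemma weyl_primitive_cv mu eps p h s (P f : R -> R) : 0 < eps -> weyl q A mu eps p h s ->
  (forall x, A <= x -> is_derive P x (f x)) -> (forall x, A <= x -> Rabs (f x) <= sqY s x) ->
  exists l, forall e, 0 < e -> exists X, A <= X /\ forall x, X <= x -> Rabs (P x - l) < e.
Proof.
intros He W Hd Hf. assert (HJ := fun x => weyl_imYZ_nonneg q A _ _ _ _ _ x He W).
assert (Hei : 0 < / eps) by (now apply Rinv_0_lt_compat).
assert (Hm : forall (sg : R), sg = 1 \/ sg = -1 -> forall x y, A <= x -> x <= y ->
   sg * P x - / eps * imYZ s x <= sg * P y - / eps * imYZ s y).
{ intros sg Hsg x y Hx Hy. apply (der_incr (fun x => sg * P x - / eps * imYZ s x)); auto.
  intros t Ht. eexists; split.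
  - eapply derB; (eapply derM; [apply derC|]); [apply Hd; lra|eapply imYZ_der; [apply W|lra]].
  - cbv beta. specialize (Hf t ltac:(lra)). apply Rabs_le_between in Hf.
    replace (0 * P t + sg * f t - (0 * imYZ s t + / eps * (- eps * sqY s t)))
      with (sg * f t + sqY s t) by (field; lra). destruct Hsg; subst sg; lra. }
destruct (incr_bounded_cv (fun x => 1 * P x - / eps * imYZ s x) A (P A + / eps * imYZ s A)) as (l & Hl & Hcv).
- apply Hm; auto.
- intros x Hx. specialize (Hm (-1) ltac:(auto) A x ltac:(lra) Hx).
  assert (0 <= / eps * imYZ s x) by (apply Rmult_le_pos; [lra|auto]). lra.
- exists l; intros e Hp.
  destruct (Hcv (e / 2) ltac:(lra)) as (X1 & HX1 & H1).
  destruct (weyl_imYZ_to_0 mu eps p h s He W (eps * (e / 2))) as (X2 & HX2 & H2); [nra|].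
  exists (Rmax X1 X2); max_ge X1 X2; split; [lra|].
  intros x Hx. specialize (H1 x ltac:(lra)); specialize (H2 x ltac:(lra)); specialize (Hl x ltac:(lra)).
  assert (0 <= / eps * imYZ s x < e / 2).
  { split; [apply Rmult_le_pos; lra|]. apply Rmult_lt_reg_l with eps; auto.
    rewrite <- Rmult_assoc, Rinv_r; lra. }
  apply Rabs_def1; lra.
Qed.

(** Replacing [s1] by [s2] in [W'] gives the derivatives of [P] and [Q]; the error pairs the
    difference [s1 - s2] with [s2], with a factor of the size of the energy difference. The square
    of the difference is paid for by [imYZ] of the difference, which vanishes at [A] and is small
    far out. The free pair [a], [b] lets one one-sided bound serve both Wronskian parts and both
    signs. *)
Lemma weyl_quadratic mu1 e1 p1 h1 s1 mu2 e2 p2 h2 s2 (P Q W : R -> R) l1 l2 a b : 0 < e1 -> 0 < e2 ->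
  weyl q A mu1 e1 p1 h1 s1 -> weyl q A mu2 e2 p2 h2 s2 ->
  P A = 0 -> Q A = 0 ->
  (forall x, A <= x -> is_derive P x (Y1 s2 x ^ 2 - Y2 s2 x ^ 2)) ->
  (forall x, A <= x -> is_derive Q x (2 * Y1 s2 x * Y2 s2 x)) ->
  (forall e, 0 < e -> exists X, A <= X /\ forall x, X <= x -> Rabs (P x - l1) < e) ->
  (forall e, 0 < e -> exists X, A <= X /\ forall x, X <= x -> Rabs (Q x - l2) < e) ->
  a ^ 2 + b ^ 2 = (mu1 - mu2) ^ 2 + (e1 - e2) ^ 2 ->
  (forall x, A <= x -> is_derive W x (- a * (Y1 s1 x * Y1 s2 x - Y2 s1 x * Y2 s2 x)
                         + b * (Y1 s1 x * Y2 s2 x + Y2 s1 x * Y1 s2 x))) ->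
  (forall x, A <= x -> W x <= energy s1 x + energy s2 x) ->
  W A - a * l1 + b * l2 <= (a ^ 2 + b ^ 2) * ((1 + / e1 ^ 2) * (h2 / e2)).
Proof.
intros He1 He2 W1 W2 PA QA HP HQ LP LQ Hab HW HWb.
pose proof (weyl_small3 q A _ _ _ _ _ _ _ _ _ _ _ _ _ _ _ W1 W2 W2) as Hs.
pose proof (weyl_imYZ_A _ _ _ _ _ _ _ W2) as J2.
assert (J2p := fun x => weyl_imYZ_nonneg q A _ _ _ _ _ x He2 W2).
destruct W1 as (S1 & (I1 & I2 & I3 & I4) & _). destruct W2 as (S2 & (K1 & K2 & K3 & K4) & _).
set (X := comb s1 (-1) 0 s2). set (d2 := a ^ 2 + b ^ 2) in *.
assert (Hd2 : 0 <= d2) by (unfold d2; nra).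
(* [k * imYZ s2] decreases at rate [d2 / 2 * (1 + / e1 ^ 2) * |y2|^2], exactly what the two
   completed squares [H1] and [H2] leave over. *)
set (k := d2 / 2 * (1 + / e1 ^ 2) / e2).
assert (Hi1 : 0 < / e1) by (now apply Rinv_0_lt_compat).
assert (Hi2 : 0 < / e1 ^ 2) by (apply Rinv_0_lt_compat, pow_lt; lra).
assert (Hk : 0 <= k) by (unfold k; apply Rdiv_le_0_compat; nra).
assert (HF : W A + a * (P A - l1) - b * (Q A - l2) - (/ e1 * imYZ X A + k * imYZ s2 A) <= 0).
{ apply (compare_at_infinity (fun x => W x + a * (P x - l1) - b * (Q x - l2) - (/ e1 * imYZ X x + k * imYZ s2 x))
    (fun x => energy s1 x + energy s2 x + energy s2 x + (Rabs (P x - l1) + Rabs (Q x - l2))) A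
    (1 + / e1 + Rabs a + Rabs b)).
  - intros x Hx.
    destruct (solves_der q A _ _ _ _ S1 Hx) as (A1 & A2 & A3 & A4).
    destruct (solves_der q A _ _ _ _ S2 Hx) as (B1 & B2 & B3 & B4).
    set (y1 := Y1 s1 x - Y1 s2 x). set (y2 := Y2 s1 x - Y2 s2 x).
    set (c := Y1 s2 x). set (d := Y2 s2 x).
    assert (JX : is_derive (imYZ X) x (- e1 * (y1 ^ 2 + y2 ^ 2)
       - ((mu1 - mu2) * (d * y1 - c * y2) + (e1 - e2) * (c * y1 + d * y2)))).
    { unfold imYZ, X; cbn [Y1 Y2 Z1 Z2 comb]. eapply is_derive_eq; [der idtac|].
      unfold y1, y2, c, d; cbv beta; ring. }
    eexists; split.
    + eapply derB; [eapply derB; [eapply derP; [apply HW, Hx|]|]|].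
      * eapply derM; [apply derC|eapply derB; [apply HP, Hx|apply derC]].
      * eapply derM; [apply derC|eapply derB; [apply HQ, Hx|apply derC]].
      * eapply derP; (eapply derM; [apply derC|]); [exact JX|eapply imYZ_der; eauto].
    + cbv beta. unfold sqY. fold c d.
      replace (Y1 s1 x) with (y1 + c) by (unfold y1, c; ring).
      replace (Y2 s1 x) with (y2 + d) by (unfold y2, d; ring).
      match goal with |- 0 <= ?g => replace g with
        ((y1 ^ 2 + y2 ^ 2) + / e1 * ((mu1 - mu2) * (d * y1 - c * y2) + (e1 - e2) * (c * y1 + d * y2))
         + d2 / 2 * (1 + / e1 ^ 2) * (c ^ 2 + d ^ 2)
         + (- a * (y1 * c - y2 * d) + b * (y1 * d + y2 * c))) by (unfold k; field; lra) end.
      assert (H1 : - (y1 ^ 2 + y2 ^ 2) / 2 - d2 / 2 * (c ^ 2 + d ^ 2) <= - a * (y1 * c - y2 * d) + b * (y1 * d + y2 * c)).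
      { assert (E : (y1 ^ 2 + y2 ^ 2) + d2 * (c ^ 2 + d ^ 2) + 2 * (- a * (y1 * c - y2 * d) + b * (y1 * d + y2 * c))
          = (y1 + (- a * c + b * d)) ^ 2 + (y2 + (a * d + b * c)) ^ 2) by (unfold d2; ring).
        sq_ge0 (y1 + (- a * c + b * d)); sq_ge0 (y2 + (a * d + b * c)). lra. }
      assert (H2 : - (y1 ^ 2 + y2 ^ 2) / 2 - d2 / 2 * / e1 ^ 2 * (c ^ 2 + d ^ 2) <=
         / e1 * ((mu1 - mu2) * (d * y1 - c * y2) + (e1 - e2) * (c * y1 + d * y2))).
      { assert (E : (y1 ^ 2 + y2 ^ 2) + d2 * / e1 ^ 2 * (c ^ 2 + d ^ 2) + 2 * (/ e1 * ((mu1 - mu2) * (d * y1 - c * y2) + (e1 - e2) * (c * y1 + d * y2)))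
          = (y1 + / e1 * ((mu1 - mu2) * d + (e1 - e2) * c)) ^ 2 + (y2 + / e1 * (- (mu1 - mu2) * c + (e1 - e2) * d)) ^ 2)
          by (rewrite Hab; field; lra).
        sq_ge0 (y1 + / e1 * ((mu1 - mu2) * d + (e1 - e2) * c)).
        sq_ge0 (y2 + / e1 * (- (mu1 - mu2) * c + (e1 - e2) * d)). lra. }
      lra.
  - intros x Hx. specialize (J2p x Hx).
    assert (0 <= k * imYZ s2 x) by (apply Rmult_le_pos; auto).
    assert (- (/ e1 * imYZ X x) <= / e1 * (energy s1 x + energy s2 x)).
    { pose proof (imYZ_le X x) as Hb. apply Rabs_le_between in Hb.
      pose proof (sqY_comb_minus s1 s2 x) as Hc. fold X in Hc.
      replace (- (/ e1 * imYZ X x)) with (/ e1 * - imYZ X x) by ring.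
      apply Rmult_le_compat_l; lra. }
    specialize (HWb x Hx).
    assert (Ha : a * (P x - l1) <= Rabs a * Rabs (P x - l1)) by (rewrite <- Rabs_mult; apply Rle_abs).
    assert (Hb : - (b * (Q x - l2)) <= Rabs b * Rabs (Q x - l2)) by (rewrite <- Rabs_mult, <- Rabs_Ropp; apply Rle_abs).
    pose proof (energy_nonneg s1 x); pose proof (energy_nonneg s2 x).
    abs_ge0 a; abs_ge0 b; abs_ge0 (P x - l1); abs_ge0 (Q x - l2).
    set (E := energy s1 x + energy s2 x) in *. set (pp := Rabs (P x - l1)) in *. set (qq := Rabs (Q x - l2)) in *.
    assert (HE : 0 <= E) by (unfold E; lra).
    assert (0 <= Rabs a * E /\ 0 <= Rabs b * E /\ 0 <= / e1 * (energy s2 x + pp + qq) /\ 0 <= Rabs a * (energy s2 x + qq)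
      /\ 0 <= Rabs b * (energy s2 x + pp)) as (G1 & G2 & G3 & G4 & G5) by (repeat split; apply Rmult_le_pos; lra).
    lra.
  - intros x Hx. pose proof (energy_nonneg s1 x); pose proof (energy_nonneg s2 x).
    abs_ge0 (P x - l1); abs_ge0 (Q x - l2). lra.
  - intros e X0 He.
    destruct (LP (e / 3) ltac:(lra)) as (X1 & HX1 & H1). destruct (LQ (e / 3) ltac:(lra)) as (X2 & HX2 & H2).
    destruct (Hs (e / 3) (Rmax X0 (Rmax X1 X2)) ltac:(lra)) as (x & Hx & Hxx & Hlt).
    max_ge X0 (Rmax X1 X2).
    max_ge X1 X2.
    exists x; split; [auto|split; [lra|]]. specialize (H1 x ltac:(lra)); specialize (H2 x ltac:(lra)). lra. }
assert (JX0 : imYZ X A = 0) by (unfold imYZ, X; cbn [Y1 Y2 Z1 Z2 comb]; rewrite I1, I2, K1, K2; ring).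
rewrite JX0, PA, QA, J2 in HF.
assert (Hh : 0 <= h2) by (rewrite <- J2; apply J2p; lra).
assert (Hq2 : 0 <= d2 * ((1 + / e1 ^ 2) * (h2 / e2))).
{ apply Rmult_le_pos; auto. apply Rmult_le_pos; [lra|]. apply Rdiv_le_0_compat; lra. }
replace (k * h2) with (/ 2 * (d2 * ((1 + / e1 ^ 2) * (h2 / e2)))) in HF by (unfold k; field; lra).
lra.
Qed.

(** Complex differentiability with derivative [D1 + i D2]. The remainder is explicit in both points,
    so that exchanging their roles also controls how the derivative varies. *)
Definition expansion (p h : R -> R -> R) (x y D1 D2 : R) : Prop :=
  forall x1 y1, 0 < y1 ->
  Rabs (p x1 y1 - p x y - ((x1 - x) * D1 - (y1 - y) * D2)) <=
    ((x1 - x) ^ 2 + (y1 - y) ^ 2) * ((1 + / y1 ^ 2) * (h x y / y)) /\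
  Rabs (h x1 y1 - h x y - ((x1 - x) * D2 + (y1 - y) * D1)) <=
    ((x1 - x) ^ 2 + (y1 - y) ^ 2) * ((1 + / y1 ^ 2) * (h x y / y)).

(** The derivative of [m_A] is the integral of [psi^2] over [[A, oo)]; [l1] and [l2] are its real
    and imaginary parts. [weyl_quadratic] is applied with [(d, e)] to [wrR] and with [(e, - d)] to
    [wrI]. *)
Lemma weyl_expansion (p h : R -> R -> R) :
  (forall x y, 0 < y -> exists s, weyl q A x y (p x y) (h x y) s) ->
  forall x y, 0 < y -> exists D1 D2, expansion p h x y D1 D2.
Proof.
intros Hm x y Hy. destruct (Hm x y Hy) as (s & W).
assert (SC := fun t => solves_cont q A x y s t (proj1 W)).
destruct (primitive_exists (fun t => Y1 s t ^ 2 - Y2 s t ^ 2) A) as (P & PA & HP).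
{ intros t Ht; destruct (SC t Ht) as (C1 & C2 & _). cont idtac. }
destruct (primitive_exists (fun t => 2 * Y1 s t * Y2 s t) A) as (Q & QA & HQ).
{ intros t Ht; destruct (SC t Ht) as (C1 & C2 & _). cont idtac. }
destruct (weyl_primitive_cv _ _ _ _ _ P _ Hy W HP) as (l1 & L1).
{ intros t _; unfold sqY; apply Rabs_le; split; nra. }
destruct (weyl_primitive_cv _ _ _ _ _ Q _ Hy W HQ) as (l2 & L2).
{ intros t _; unfold sqY.
  sq_ge0 (Y1 s t + Y2 s t); sq_ge0 (Y1 s t - Y2 s t).
  apply Rabs_le; split; lra. }
exists l1, l2. intros x1 y1 Hy1. destruct (Hm x1 y1 Hy1) as (s1 & W1).
assert (S1 := proj1 W1). assert (S := proj1 W).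
destruct (proj1 (proj2 W)) as (K1 & K2 & K3 & K4). destruct (proj1 (proj2 W1)) as (I1 & I2 & I3 & I4).
assert (ER : wrR s1 s A = p x1 y1 - p x y) by (unfold wrR; rewrite I1, I2, I3, I4, K1, K2, K3, K4; ring).
assert (EI : wrI s1 s A = h x1 y1 - h x y) by (unfold wrI; rewrite I1, I2, I3, I4, K1, K2, K3, K4; ring).
set (d := x1 - x). set (e := y1 - y).
set (K := (d ^ 2 + e ^ 2) * ((1 + / y1 ^ 2) * (h x y / y))).
assert (HG : forall (F : R -> R) a b, a ^ 2 + b ^ 2 = d ^ 2 + e ^ 2 ->
  (forall t, A <= t -> is_derive F t (- a * (Y1 s1 t * Y1 s t - Y2 s1 t * Y2 s t)
                                    + b * (Y1 s1 t * Y2 s t + Y2 s1 t * Y1 s t))) ->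
  (forall t, Rabs (F t) <= energy s1 t + energy s t) -> Rabs (F A - (a * l1 - b * l2)) <= K).
{ intros F a b Hab HF Hb.
  assert (B1 : F A - a * l1 + b * l2 <= K).
  { unfold K; rewrite <- Hab. apply (weyl_quadratic _ _ _ _ _ _ _ _ _ _ P Q F l1 l2 a b Hy1 Hy W1 W PA QA HP HQ L1 L2 Hab HF).
    intros t _; eapply Rle_trans; [apply Rle_abs|apply Hb]. }
  assert (Hab' : (- a) ^ 2 + (- b) ^ 2 = d ^ 2 + e ^ 2) by (rewrite <- Hab; ring).
  assert (B2 : - F A - - a * l1 + - b * l2 <= K).
  { unfold K; rewrite <- Hab'.
    apply (weyl_quadratic _ _ _ _ _ _ _ _ _ _ P Q (fun t => - F t) l1 l2 (- a) (- b) Hy1 Hy W1 W PA QA HP HQ L1 L2 Hab').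
    - intros t Ht; eapply is_derive_eq; [apply derN, HF, Ht|ring].
    - intros t _; eapply Rle_trans; [apply Rle_abs|]. rewrite Rabs_Ropp; apply Hb. }
  apply Rabs_le; split; lra. }
rewrite <- ER, <- EI. split.
- apply HG; [reflexivity| |intros; apply wrR_le].
  intros t Ht; eapply is_derive_eq; [eapply wrR_der; eauto|unfold d, e; ring].
- replace (d * l2 + e * l1) with (e * l1 - - d * l2) by ring.
  apply HG; [ring| |intros; apply wrI_le].
  intros t Ht; eapply is_derive_eq; [eapply wrI_der; eauto|unfold d, e; ring].
Qed.

End Analytic.

Lemma lipschitz_continuity_2d (f : R -> R -> R) x y K r : 0 < r ->
  (forall u v, Rabs (u - x) < r -> Rabs (v - y) < r ->
     Rabs (f u v - f x y) <= K * (Rabs (u - x) + Rabs (v - y))) ->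
  continuity_2d_pt f x y.
Proof.
intros Hr H e. set (K' := Rabs K + 1). assert (HK : 0 < K') by (unfold K'; abs_ge0 K; lra).
assert (Hd : 0 < Rmin r (e / (2 * K'))).
{ apply Rmin_pos; auto; apply Rdiv_lt_0_compat; [apply cond_pos|lra]. }
exists (mkposreal _ Hd); simpl; intros u v Hu Hv.
min_le r (e / (2 * K')).
eapply Rle_lt_trans; [apply H; lra|].
assert (Hs : Rabs (u - x) + Rabs (v - y) < e / K').
{ replace (e / K') with (e / (2 * K') + e / (2 * K')) by (field; lra). lra. }
apply Rmult_lt_compat_r with (r := K') in Hs; auto.
replace (e / K' * K') with (pos e) in Hs by (field; lra).
abs_ge0 (u - x); abs_ge0 (v - y). pose proof (Rle_abs K).
unfold K' in *. nra.
Qed.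

Lemma expansion_lipschitz p h x y D1 D2 : 0 < y -> 0 <= h x y -> expansion p h x y D1 D2 ->
  exists K, 0 <= K /\ forall u v, Rabs (u - x) < Rmin 1 (y / 2) -> Rabs (v - y) < Rmin 1 (y / 2) ->
    Rabs (p u v - p x y) <= K * (Rabs (u - x) + Rabs (v - y)) /\
    Rabs (h u v - h x y) <= K * (Rabs (u - x) + Rabs (v - y)).
Proof.
intros Hy Hh H. set (c := (1 + 4 / y ^ 2) * (h x y / y)).
assert (Hy2 : 0 < y ^ 2) by (apply pow_lt; lra).
assert (Hc : 0 <= c).
{ apply Rmult_le_pos; [|apply Rdiv_le_0_compat; lra]. assert (0 < 4 / y ^ 2) by (apply Rdiv_lt_0_compat; lra). lra. }
exists (Rabs D1 + Rabs D2 + c). abs_ge0 D1; abs_ge0 D2. split; [lra|].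
intros u v Hu Hv. min_le 1 (y / 2).
assert (Hv0 : y / 2 < v) by (apply Rabs_def2 in Hv; lra).
destruct (H u v ltac:(lra)) as (E1 & E2).
set (d := u - x) in *. set (e := v - y) in *.
assert (Hb : (d ^ 2 + e ^ 2) * ((1 + / v ^ 2) * (h x y / y)) <= c * (Rabs d + Rabs e)).
{ rewrite Rmult_comm. apply Rmult_le_compat.
  - apply Rmult_le_pos; [|apply Rdiv_le_0_compat; lra].
    assert (0 < / v ^ 2) by (apply Rinv_0_lt_compat, pow_lt; lra). lra.
  - nra.
  - apply Rmult_le_compat_r; [apply Rdiv_le_0_compat; lra|]. apply Rplus_le_compat_l.
    replace (4 / y ^ 2) with (/ (y / 2) ^ 2) by (field; lra).
    apply Rinv_le_contravar; [apply pow_lt; lra|apply pow_incr; lra].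
  - rewrite <- (pow2_abs d), <- (pow2_abs e). abs_ge0 d; abs_ge0 e. nra. }
abs_ge0 d; abs_ge0 e.
assert (Hlin : forall a b, Rabs (d * a + e * b) <= (Rabs a + Rabs b) * (Rabs d + Rabs e)).
{ intros a b. eapply Rle_trans; [apply Rabs_triang|]. rewrite !Rabs_mult.
  abs_ge0 a; abs_ge0 b. nra. }
split.
- replace (p u v - p x y) with ((p u v - p x y - (d * D1 - e * D2)) + (d * D1 + e * - D2)) by ring.
  eapply Rle_trans; [apply Rabs_triang|]. specialize (Hlin D1 (- D2)). rewrite Rabs_Ropp in Hlin. lra.
- replace (h u v - h x y) with ((h u v - h x y - (d * D2 + e * D1)) + (d * D2 + e * D1)) by ring.
  eapply Rle_trans; [apply Rabs_triang|]. specialize (Hlin D2 D1). lra.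
Qed.

(** Adding the expansions at the two points cancels the values and leaves the complex product of the
    displacement with the difference of the derivatives, of quadratic size. Dividing by the
    displacement needs distinct points. *)
Lemma expansion_deriv_lipschitz p h x y D1 D2 : 0 < y ->
  (forall u v, 0 < v -> 0 <= h u v) -> expansion p h x y D1 D2 ->
  exists K, forall u v E1 E2, Rabs (u - x) < Rmin 1 (y / 2) -> Rabs (v - y) < Rmin 1 (y / 2) ->
    u <> x \/ v <> y -> expansion p h u v E1 E2 ->
    Rabs (E1 - D1) <= K * (Rabs (u - x) + Rabs (v - y)) /\
    Rabs (E2 - D2) <= K * (Rabs (u - x) + Rabs (v - y)).
Proof.
intros Hy Hh H.
destruct (expansion_lipschitz p h x y D1 D2 Hy (Hh x y Hy) H) as (L & HL & HLip).
set (c := (1 + 4 / y ^ 2) * ((h x y + 2 * L) / (y / 2))).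
assert (Hhxy := Hh x y Hy).
assert (Hy2 : 0 < y ^ 2) by (apply pow_lt; lra).
assert (H4 : 0 < 4 / y ^ 2) by (apply Rdiv_lt_0_compat; lra).
assert (Hc : 0 <= c) by (apply Rmult_le_pos; [lra|apply Rdiv_le_0_compat; lra]).
exists (4 * c). intros u v E1 E2 Hu Hv Hne HE.
destruct (HLip u v Hu Hv) as (_ & Lh).
min_le 1 (y / 2).
assert (Hv0 : y / 2 < v) by (apply Rabs_def2 in Hv; lra).
destruct (H u v ltac:(lra)) as (A1 & A2). destruct (HE x y Hy) as (B1 & B2).
assert (Hhu := Hh u v ltac:(lra)).
assert (Hhu' : h u v <= h x y + 2 * L) by (assert (L * (Rabs (u - x) + Rabs (v - y)) <= L * 2) by (apply Rmult_le_compat_l; lra);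
  apply Rabs_le_between in Lh; lra).
assert (Hvi : 0 < / v ^ 2 <= 4 / y ^ 2).
{ split; [apply Rinv_0_lt_compat, pow_lt; lra|].
  replace (4 / y ^ 2) with (/ (y / 2) ^ 2) by (field; lra).
  apply Rinv_le_contravar; [apply pow_lt; lra|apply pow_incr; lra]. }
assert (Hyi : 0 < / y ^ 2 <= 4 / y ^ 2).
{ split; [apply Rinv_0_lt_compat; lra|]. unfold Rdiv. pose proof (Rinv_0_lt_compat _ Hy2); lra. }
assert (Cb : forall k w z, 0 < k <= 4 / y ^ 2 -> 0 <= w <= h x y + 2 * L -> y / 2 <= z -> (1 + k) * (w / z) <= c).
{ intros k w z Hk Hw Hz. apply Rmult_le_compat; try lra.
  - apply Rdiv_le_0_compat; lra.
  - unfold Rdiv at 1 2. apply Rmult_le_compat; try lra; [left; apply Rinv_0_lt_compat; lra|]. apply Rinv_le_contravar; lra. }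
assert (C1 : (1 + / v ^ 2) * (h x y / y) <= c) by (apply Cb; lra).
assert (C2 : (1 + / y ^ 2) * (h u v / v) <= c) by (apply Cb; lra).
set (d := u - x) in *. set (e := v - y) in *.
replace (x - u) with (- d) in B1, B2 by (unfold d; ring).
replace (y - v) with (- e) in B1, B2 by (unfold e; ring).
replace ((- d) ^ 2 + (- e) ^ 2) with (d ^ 2 + e ^ 2) in B1, B2 by ring.
set (n := d ^ 2 + e ^ 2) in *.
assert (Hn : 0 <= n) by (unfold n; nra).
assert (F1 : n * ((1 + / v ^ 2) * (h x y / y)) <= n * c) by (apply Rmult_le_compat_l; auto).
assert (F2 : n * ((1 + / y ^ 2) * (h u v / v)) <= n * c) by (apply Rmult_le_compat_l; auto).
apply Rabs_le_between in A1, A2, B1, B2.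
set (a := E1 - D1). set (b := E2 - D2).
assert (G1 : Rabs (d * a - e * b) <= 2 * c * n) by (unfold a, b; apply Rabs_le; split; lra).
assert (G2 : Rabs (d * b + e * a) <= 2 * c * n) by (unfold a, b; apply Rabs_le; split; lra).
assert (G : n * (a ^ 2 + b ^ 2) <= n * (8 * c ^ 2 * n)).
{ replace (n * (a ^ 2 + b ^ 2)) with ((d * a - e * b) ^ 2 + (d * b + e * a) ^ 2) by (unfold n; ring).
  rewrite <- (pow2_abs (d * a - e * b)), <- (pow2_abs (d * b + e * a)).
  pose proof (pow_incr _ _ 2 (conj (Rabs_pos _) G1)). pose proof (pow_incr _ _ 2 (conj (Rabs_pos _) G2)). lra. }
pose proof (Rabs_pos d) as Pd; pose proof (Rabs_pos e) as Pe.
assert (Hlt : 0 < n).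
{ apply Rnot_le_lt; intros Hle. unfold n in Hle. sq_ge0 d; sq_ge0 e.
  assert (d = 0) by (apply pow2_le_0; lra). assert (e = 0) by (apply pow2_le_0; lra).
  unfold d, e in *; destruct Hne; lra. }
apply Rmult_le_reg_l in G; auto.
assert (Hsq : 8 * c ^ 2 * n <= (4 * c * (Rabs d + Rabs e)) ^ 2).
{ replace ((4 * c * (Rabs d + Rabs e)) ^ 2) with (8 * c ^ 2 * (2 * (Rabs d + Rabs e) ^ 2)) by ring.
  apply Rmult_le_compat_l; [sq_ge0 c; lra|]. unfold n; rewrite <- (pow2_abs d), <- (pow2_abs e). nra. }
assert (Hp : 0 <= 4 * c * (Rabs d + Rabs e)) by (apply Rmult_le_pos; lra).
sq_ge0 a; sq_ge0 b.
split; rewrite <- (Rabs_right (4 * c * (Rabs d + Rabs e))) by lra; apply Rsqr_le_abs_0; unfold Rsqr; simpl in *; lra.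
Qed.

(* [D1 + i D2] is the complex derivative of [p + i h] *)
Definition holo (p h D1 D2 : R -> R -> R) : Prop := forall x y, 0 < y ->
  (is_derive (fun t => p t y) x (D1 x y) /\ is_derive (fun t => p x t) y (- D2 x y) /\
   is_derive (fun t => h t y) x (D2 x y) /\ is_derive (fun t => h x t) y (D1 x y)) /\
  (continuity_2d_pt p x y /\ continuity_2d_pt h x y /\
   continuity_2d_pt D1 x y /\ continuity_2d_pt D2 x y).

Lemma expansion_holo (p h : R -> R -> R) : (forall x y, 0 < y -> 0 <= h x y) ->
  (forall x y, 0 < y -> exists D1 D2, expansion p h x y D1 D2) -> exists D1 D2, holo p h D1 D2.
Proof.
intros Hh Hex.
assert (HD : forall x y, exists D : R * R, 0 < y -> expansion p h x y (fst D) (snd D)).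
{ intros x y. destruct (Rlt_dec 0 y) as [Hy|Hn].
  - destruct (Hex x y Hy) as (D1 & D2 & HE). now exists (D1, D2).
  - exists (0, 0); intros; contradiction. }
set (D := fun x y => proj1_sig (constructive_indefinite_description _ (HD x y))).
assert (DE : forall x y, 0 < y -> expansion p h x y (fst (D x y)) (snd (D x y))).
{ intros x y; unfold D; destruct (constructive_indefinite_description _ (HD x y)); auto. }
exists (fun x y => fst (D x y)), (fun x y => snd (D x y)). intros x y Hy.
assert (Hr : 0 < Rmin 1 (y / 2)) by (apply Rmin_pos; lra).
pose proof (Rmin_l 1 (y / 2)) as M1; pose proof (Rmin_r 1 (y / 2)) as M2.
assert (E := DE x y Hy). split.
- assert (Hx : forall t, Rabs (t - x) < 1 ->
    ((t - x) ^ 2 + (y - y) ^ 2) * ((1 + / y ^ 2) * (h x y / y)) <= (1 + / y ^ 2) * (h x y / y) * (t - x) ^ 2).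
  { intros; right; ring. }
  assert (HY : forall t, Rabs (t - y) < Rmin 1 (y / 2) -> 0 < t /\
    ((x - x) ^ 2 + (t - y) ^ 2) * ((1 + / t ^ 2) * (h x y / y)) <= (1 + 4 / y ^ 2) * (h x y / y) * (t - y) ^ 2).
  { intros t Ht. assert (y / 2 < t) by (apply Rabs_def2 in Ht; lra). split; [lra|].
    rewrite Rminus_diag. replace (0 ^ 2 + (t - y) ^ 2) with ((t - y) ^ 2) by ring. rewrite Rmult_comm.
    apply Rmult_le_compat_r; [apply pow2_ge_0|].
    apply Rmult_le_compat_r; [apply Rdiv_le_0_compat; auto|]. apply Rplus_le_compat_l.
    replace (4 / y ^ 2) with (/ (y / 2) ^ 2) by (field; lra).
    apply Rinv_le_contravar; [apply pow_lt; lra|apply pow_incr; lra]. }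
  split; [|split; [|split]].
  + apply (quad_derive _ x _ ((1 + / y ^ 2) * (h x y / y)) 1); [lra|]. intros t Ht.
    eapply Rle_trans; [|apply Hx, Ht]. destruct (E t y Hy) as (E1 & _).
    eapply Rle_trans; [right|exact E1]. f_equal. ring.
  + apply (quad_derive _ y _ ((1 + 4 / y ^ 2) * (h x y / y)) (Rmin 1 (y / 2))); [lra|]. intros t Ht.
    destruct (HY t Ht) as (Ht0 & Hb). eapply Rle_trans; [|exact Hb]. destruct (E x t Ht0) as (E1 & _).
    eapply Rle_trans; [right|exact E1]. f_equal. ring.
  + apply (quad_derive _ x _ ((1 + / y ^ 2) * (h x y / y)) 1); [lra|]. intros t Ht.
    eapply Rle_trans; [|apply Hx, Ht]. destruct (E t y Hy) as (_ & E1).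
    eapply Rle_trans; [right|exact E1]. f_equal. ring.
  + apply (quad_derive _ y _ ((1 + 4 / y ^ 2) * (h x y / y)) (Rmin 1 (y / 2))); [lra|]. intros t Ht.
    destruct (HY t Ht) as (Ht0 & Hb). eapply Rle_trans; [|exact Hb]. destruct (E x t Ht0) as (_ & E1).
    eapply Rle_trans; [right|exact E1]. f_equal. ring.
- destruct (expansion_lipschitz p h x y _ _ Hy (Hh x y Hy) E) as (K & _ & HK).
  destruct (expansion_deriv_lipschitz p h x y _ _ Hy Hh E) as (K' & HK').
  assert (Hpos : forall v, Rabs (v - y) < Rmin 1 (y / 2) -> 0 < v).
  { intros v Hv; apply Rabs_def2 in Hv; lra. }
  assert (HD' : forall u v, Rabs (u - x) < Rmin 1 (y / 2) -> Rabs (v - y) < Rmin 1 (y / 2) ->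
    Rabs (fst (D u v) - fst (D x y)) <= K' * (Rabs (u - x) + Rabs (v - y)) /\
    Rabs (snd (D u v) - snd (D x y)) <= K' * (Rabs (u - x) + Rabs (v - y))).
  { intros u v Hu Hv. destruct (classic (u <> x \/ v <> y)) as [Hne|Heq].
    - apply HK'; auto.
    - assert (u = x) by tauto. assert (v = y) by tauto. subst u v. rewrite !Rminus_diag, Rabs_R0. split; lra. }
  split; [|split; [|split]].
  + apply (lipschitz_continuity_2d _ x y K _ Hr); intros u v Hu Hv; now apply HK.
  + apply (lipschitz_continuity_2d _ x y K _ Hr); intros u v Hu Hv; now apply HK.
  + apply (lipschitz_continuity_2d _ x y K' _ Hr); intros u v Hu Hv; now apply HD'.
  + apply (lipschitz_continuity_2d _ x y K' _ Hr); intros u v Hu Hv; now apply HD'.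
Qed.

(** * Closed forms and the maximum principle *)

Lemma mvt_bound (f df : R -> R) a b M :
  (forall x, Rmin a b <= x <= Rmax a b -> is_derive f x (df x) /\ Rabs (df x) <= M) ->
  Rabs (f b - f a) <= M * Rabs (b - a).
Proof.
intros H. destruct (MVT_gen f a b df) as (c & Hc & Hd).
- intros x Hx; apply H; lra.
- intros x Hx; apply continuity_pt_filterlim; eapply der_cont; apply H; auto.
- rewrite Hd, Rabs_mult. apply Rmult_le_compat_r; [apply Rabs_pos|]. now apply H.
Qed.

Lemma continuity_2d_fst (f : R -> R -> R) (x y : R) : continuity_2d_pt f x y -> continuous (fun t => f t y) x.
Proof.
intros H. apply continuity_pt_filterlim. intros e He.
destruct (H (mkposreal e He)) as (d & Hd). exists d; split; [apply cond_pos|].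
intros t (_ & Ht). apply Hd; auto. rewrite Rminus_diag, Rabs_R0; apply cond_pos.
Qed.

Lemma continuity_2d_snd (f : R -> R -> R) (x y : R) : continuity_2d_pt f x y -> continuous (fun t => f x t) y.
Proof.
intros H. apply continuity_pt_filterlim. intros e He.
destruct (H (mkposreal e He)) as (d & Hd). exists d; split; [apply cond_pos|].
intros t (_ & Ht). apply Hd; auto. rewrite Rminus_diag, Rabs_R0; apply cond_pos.
Qed.

Lemma partials_continuity_2d (f F G : R -> R -> R) x y : 0 < y ->
  (forall u v, 0 < v -> is_derive (fun t => f t v) u (F u v) /\ is_derive (fun t => f u t) v (G u v)) ->
  continuity_2d_pt F x y -> continuity_2d_pt G x y -> continuity_2d_pt f x y.
Proof.
intros Hy Hd HF HG.
destruct (HF (mkposreal 1 Rlt_0_1)) as (d1 & H1). destruct (HG (mkposreal 1 Rlt_0_1)) as (d2 & H2).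
simpl in H1, H2.
set (r := Rmin (Rmin d1 d2) y).
assert (Hr : 0 < r) by (repeat apply Rmin_pos; auto; apply cond_pos).
pose proof (Rmin_l (Rmin d1 d2) y) as R1; pose proof (Rmin_r (Rmin d1 d2) y) as R2; fold r in R1, R2.
min_le d1 d2.
set (M := Rabs (F x y) + Rabs (G x y) + 1).
abs_ge0 (F x y); abs_ge0 (G x y).
apply (lipschitz_continuity_2d f x y M r Hr). intros u v Hu Hv.
assert (Hv0 : 0 < v) by (apply Rabs_def2 in Hv; lra).
assert (Hbd : forall a b, Rabs (a - x) < r -> Rabs (b - y) < r -> Rabs (F a b) <= M /\ Rabs (G a b) <= M).
{ intros a b Ha Hb. specialize (H1 a b ltac:(lra) ltac:(lra)). specialize (H2 a b ltac:(lra) ltac:(lra)).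
  pose proof (Rabs_triang_inv (F a b) (F x y)); pose proof (Rabs_triang_inv (G a b) (G x y)).
  unfold M; lra. }
replace (f u v - f x y) with ((f u v - f x v) + (f x v - f x y)) by ring.
eapply Rle_trans; [apply Rabs_triang|]. rewrite Rmult_plus_distr_l. apply Rplus_le_compat.
- apply (mvt_bound (fun t => f t v) (fun t => F t v)). intros t Ht. split; [apply Hd; auto|].
  apply Hbd; auto. eapply Rle_lt_trans; [|exact Hu].
  unfold Rmin, Rmax in Ht; destruct (Rle_dec x u); [rewrite !Rabs_right|rewrite !Rabs_left1]; lra.
- apply (mvt_bound (fun t => f x t) (fun t => G x t)). intros t Ht.
  assert (Hty : Rabs (t - y) < r).
  { eapply Rle_lt_trans; [|exact Hv].
    unfold Rmin, Rmax in Ht; destruct (Rle_dec y v); [rewrite !Rabs_right|rewrite !Rabs_left1]; lra. }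
  split; [apply Hd; apply Rabs_def2 in Hty; lra|].
  apply Hbd; auto. rewrite Rminus_diag, Rabs_R0; auto.
Qed.

(** Integrate along the L-shaped path from [(0, 1)], horizontally and then vertically. The common
    cross derivative [D] turns differentiation under the integral into an exact increment of [F]. *)
Lemma exact_form (F G D : R -> R -> R) :
  (forall x y, 0 < y -> is_derive (fun t => F x t) y (D x y) /\ is_derive (fun t => G t y) x (D x y)) ->
  (forall x y, 0 < y -> continuity_2d_pt F x y /\ continuity_2d_pt G x y /\ continuity_2d_pt D x y) ->
  exists W : R -> R -> R, forall x y, 0 < y ->
    is_derive (fun t => W t y) x (F x y) /\ is_derive (fun t => W x t) y (G x y) /\ continuity_2d_pt W x y.
Proof.
intros Hd Hc.
set (W := fun x y => RInt (fun t => F t 1) 0 x + RInt (fun s => G x s) 1 y).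
assert (HG : forall x s, 0 < s -> continuous (fun t => G x t) s).
{ intros x s Hs; apply (continuity_2d_snd G); now apply Hc. }
assert (HF1 : forall x, continuous (fun t => F t 1) x).
{ intros x; apply (continuity_2d_fst F); apply Hc; lra. }
assert (Hseg : forall y t, 0 < y -> Rmin 1 y <= t <= Rmax 1 y -> 0 < t).
{ intros y t Hy Ht; unfold Rmin in Ht; destruct (Rle_dec 1 y); lra. }
assert (Hex : forall x y, 0 < y -> ex_RInt (fun s => G x s) 1 y).
{ intros x y Hy; apply (ex_RInt_continuous (V:=R_CompleteNormedModule)).
  intros s Hs; apply HG; now apply Hseg with y. }
assert (HW : forall x y, 0 < y -> is_derive (fun t => W t y) x (F x y) /\ is_derive (fun t => W x t) y (G x y)).
{ intros x y Hy; split; unfold W.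
  - eapply is_derive_eq; [apply derP|].
    + apply (cont_RInt (fun t => F t 1)); auto.
    + apply (is_derive_RInt_param G 1 y x).
      * apply filter_forall; intros u t Ht. eexists; apply Hd; now apply Hseg with y.
      * intros t Ht. apply continuity_2d_pt_ext_loc with D.
        -- assert (Ht0 : 0 < t) by now apply Hseg with y.
           exists (mkposreal t Ht0); simpl; intros u v _ Hv.
           symmetry; apply is_derive_unique, Hd. apply Rabs_def2 in Hv; lra.
        -- apply Hc; now apply Hseg with y.
      * apply filter_forall; intros u; apply Hex; auto.
    + rewrite (RInt_ext _ (fun t => D x t)).
      * rewrite (is_RInt_unique (V:=R_CompleteNormedModule) (fun t => D x t) 1 y (minus (F x y) (F x 1))).
        -- unfold minus, plus, opp; simpl; ring.
        -- apply (is_RInt_derive (V:=R_CompleteNormedModule) (fun t => F x t)); intros t Ht.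
           ++ apply Hd; now apply Hseg with y.
           ++ apply (continuity_2d_snd D), Hc; now apply Hseg with y.
      * intros t Ht. apply is_derive_unique, Hd. apply Hseg with y; lra.
  - eapply is_derive_eq; [apply derP; [apply derC|]|].
    + apply (is_derive_RInt (fun s => G x s) (fun t => RInt (fun s => G x s) 1 t) 1 y); [|now apply HG].
      exists (mkposreal y Hy); intros t Ht. apply (RInt_correct (fun s => G x s) 1 t), Hex.
      unball Ht.
      apply Rabs_def2 in Ht; lra.
    + apply Rplus_0_l. }
exists W; intros x y Hy; split; [|split]; try now apply HW.
destruct (Hc x y Hy) as (C1 & C2 & _).
now apply (partials_continuity_2d W F G).
Qed.

(** Maximise first in [y], then in [x]; uniform continuity on the rectangle makes the partial
    maximum continuous. *)
Lemma max_2d (f : R -> R -> R) a b c d : a <= b -> c <= d ->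
  (forall x y, a <= x <= b -> c <= y <= d -> continuity_2d_pt f x y) ->
  exists x0 y0, a <= x0 <= b /\ c <= y0 <= d /\
    forall x y, a <= x <= b -> c <= y <= d -> f x y <= f x0 y0.
Proof.
intros Hab Hcd Hc.
assert (Hm : forall x, exists m : R, a <= x <= b -> exists y0, c <= y0 <= d /\ m = f x y0 /\ forall y, c <= y <= d -> f x y <= m).
{ intros x. destruct (classic (a <= x <= b)) as [Hx|Hn]; [|exists 0; intros; contradiction].
  destruct (continuity_ab_maj (f x) c d Hcd) as (y0 & H1 & H2).
  - intros y Hy; apply continuity_pt_filterlim, (continuity_2d_snd f); auto.
  - exists (f x y0); intros _. exists y0; repeat split; auto; lra. }
set (m := fun x => proj1_sig (constructive_indefinite_description _ (Hm x))).
assert (mE : forall x, a <= x <= b -> exists y0, c <= y0 <= d /\ m x = f x y0 /\ forall y, c <= y <= d -> f x y <= m x).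
{ intros x; unfold m; destruct (constructive_indefinite_description _ (Hm x)) as (r & Hr); exact Hr. }
(* [m] is continuous on the segment; extend it by clamping the argument *)
set (cl := fun x => Rmax a (Rmin b x)).
assert (Hcl : forall x, a <= cl x <= b).
{ intros x; unfold cl; split; [apply Rmax_l|]. apply Rmax_lub; auto. apply Rmin_l. }
assert (Hcl' : forall x, a <= x <= b -> cl x = x).
{ intros x Hx; unfold cl; rewrite Rmin_right, Rmax_right; lra. }
assert (HclL : forall x y, Rabs (cl x - cl y) <= Rabs (x - y)).
{ intros x y; unfold cl, Rmax, Rmin. repeat destruct Rle_dec; try lra;
    unfold Rabs; repeat destruct Rcase_abs; lra. }
destruct (continuity_ab_maj (fun x => m (cl x)) a b Hab) as (x0 & H1 & H2).
- intros x Hx e He.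
  destruct (uniform_continuity_2d f a b c d Hc (mkposreal e He)) as (r & Hr); simpl in Hr.
  assert (Hone : forall s t, a <= s <= b -> a <= t <= b -> Rabs (s - t) < r -> m s - m t < e).
  { intros s t Hs Ht Hst. destruct (mE s Hs) as (ys & Hys & Es & _). destruct (mE t Ht) as (_ & _ & _ & Ub).
    specialize (Ub ys Hys). specialize (Hr t ys s ys Ht Hys Hs Hys Hst).
    rewrite Rminus_diag, Rabs_R0 in Hr. specialize (Hr (cond_pos r)). apply Rabs_def2 in Hr. lra. }
  exists r; split; [apply cond_pos|]. intros t (_ & Ht). simpl in *; unfold Rdist in *.
  assert (Ht' : Rabs (cl t - cl x) < r) by (eapply Rle_lt_trans; [apply HclL|exact Ht]).
  apply Rabs_def1.
  + now apply Hone.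
  + assert (m (cl x) - m (cl t) < e); [|lra]. apply Hone; auto. now rewrite Rabs_minus_sym.
- destruct (mE x0 H2) as (y0 & Hy0 & E0 & _).
  exists x0, y0; split; [auto|split; [auto|]]. intros x y Hx Hy.
  destruct (mE x Hx) as (_ & _ & _ & Ub). specialize (Ub y Hy). specialize (H1 x Hx).
  rewrite !Hcl' in H1 by auto. lra.
Qed.

(** If [l > 0], then [f1 x >= l / 2 * (x - x0)] just to the right of [x0], so [f] grows there at
    least like the parabola [l / 4 * (x - x0) ^ 2]. *)
Lemma second_derivative_at_max (f f1 : R -> R) a b x0 l : a < x0 < b ->
  (forall x, a < x < b -> is_derive f x (f1 x)) -> is_derive f1 x0 l ->
  (forall x, a < x < b -> f x <= f x0) -> l <= 0.
Proof.
intros Hx Hd Hl Hmax.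
assert (H0 : f1 x0 = 0).
{ assert (pr := Hd x0 Hx). apply is_derive_Reals in pr.
  pose proof (deriv_maximum f a b x0 (exist _ _ pr) ltac:(lra) ltac:(lra) (fun x A B => Hmax x (conj A B))) as E.
  exact E. }
apply Rnot_lt_le; intros Hpos.
apply is_derive_Reals in Hl. destruct (Hl (l / 2)) as (r & Hr); [lra|].
set (t := Rmin (r / 2) ((b - x0) / 2)).
assert (Ht : 0 < t) by (apply Rmin_pos; [pose proof (cond_pos r)|]; lra).
pose proof (Rmin_l (r / 2) ((b - x0) / 2)) as T1; pose proof (Rmin_r (r / 2) ((b - x0) / 2)) as T2; fold t in T1, T2.
assert (f x0 - l / 4 * (x0 - x0) ^ 2 <= f (x0 + t) - l / 4 * (x0 + t - x0) ^ 2).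
{ apply (der_incr (fun x => f x - l / 4 * (x - x0) ^ 2)); [lra|]. intros x Hxx. eexists; split.
  - eapply derB; [apply Hd; lra|]. eapply derM; [apply derC|]. apply derX2, derB; [apply derI|apply derC].
  - cbv beta. destruct (Req_dec x x0) as [->|Hne]; [rewrite H0; lra|].
    assert (Hs : 0 < x - x0) by lra.
    specialize (Hr (x - x0) ltac:(lra)). rewrite Rabs_right in Hr by lra.
    specialize (Hr ltac:(pose proof (cond_pos r); lra)).
    replace (x0 + (x - x0)) with x in Hr by ring. rewrite H0, Rminus_0_r in Hr.
    apply Rabs_def2 in Hr. destruct Hr as (_ & Hr).
    assert (l / 2 * (x - x0) <= f1 x).
    { apply Rmult_le_reg_r with (/ (x - x0)); [now apply Rinv_0_lt_compat|].
      rewrite Rmult_assoc, Rinv_r by lra. unfold Rdiv in *; lra. }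
    lra. }
specialize (Hmax (x0 + t) ltac:(lra)).
replace (x0 + t - x0) with t in H by ring. assert (0 < l / 4 * t ^ 2) by (apply Rmult_lt_0_compat; [lra|apply pow_lt; lra]).
rewrite Rminus_diag in H. lra.
Qed.

Lemma max_principle (f fx fxx fy fyy : R -> R -> R) a b c d : a < b -> c < d ->
  (forall x y, a <= x <= b -> c <= y <= d -> continuity_2d_pt f x y) ->
  (forall x y, a < x < b -> c < y < d ->
     is_derive (fun t => f t y) x (fx x y) /\ is_derive (fun t => fx t y) x (fxx x y) /\
     is_derive (fun t => f x t) y (fy x y) /\ is_derive (fun t => fy x t) y (fyy x y) /\
     fxx x y + fyy x y = 0) ->
  (forall x, a <= x <= b -> f x c <= 0 /\ f x d <= 0) ->
  (forall y, c <= y <= d -> f a y <= 0 /\ f b y <= 0) ->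
  forall x y, a <= x <= b -> c <= y <= d -> f x y <= 0.
Proof.
intros Hab Hcd Hc Hd B1 B2 x1 y1 Hx1 Hy1. apply Rnot_lt_le; intros Hpos.
(* The added parabola makes the Laplacian strictly positive, which excludes an interior maximum; [k]
   is small enough to keep [g] positive at [(x1, y1)], while on the boundary [g <= 0]. *)
set (k := f x1 y1 / (2 * (b - a) ^ 2)).
assert (Hba : 0 < (b - a) ^ 2) by (apply pow_lt; lra).
assert (Hk : 0 < k) by (apply Rdiv_lt_0_compat; lra).
assert (Hkb : k * (b - a) ^ 2 = f x1 y1 / 2) by (unfold k; field; lra).
set (g := fun x y => f x y + k * ((x - a) ^ 2 - (b - a) ^ 2)).
destruct (max_2d g a b c d) as (x0 & y0 & Hx0 & Hy0 & Hmax); try lra.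
{ intros x y Hx Hy. apply continuity_2d_pt_plus; auto.
  apply (continuity_1d_2d_pt_comp (fun t => k * ((t - a) ^ 2 - (b - a) ^ 2)) (fun u _ => u)).
  - apply derivable_continuous_pt. apply ex_derive_Reals_0. auto_derive; auto.
  - apply continuity_2d_pt_id1. }
assert (Hsq : forall x, a <= x <= b -> (x - a) ^ 2 <= (b - a) ^ 2) by (intros; apply pow_incr; lra).
assert (Hg1 : 0 < g x1 y1).
{ unfold g. sq_ge0 (x1 - a). nra. }
assert (Hg0 : 0 < g x0 y0) by (eapply Rlt_le_trans; [exact Hg1|auto]).
assert (Hfg : forall x y, a <= x <= b -> f x y <= 0 -> g x y <= 0).
{ intros x y Hx Hf. unfold g. specialize (Hsq x Hx). nra. }
assert (Hx0' : a < x0 < b).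
{ split; apply Rnot_le_lt; intros Hle.
  - assert (x0 = a) by lra; subst x0. destruct (B2 y0 Hy0) as (Z & _). specialize (Hfg a y0 Hx0 Z). lra.
  - assert (x0 = b) by lra; subst x0. destruct (B2 y0 Hy0) as (_ & Z). specialize (Hfg b y0 Hx0 Z). lra. }
assert (Hy0' : c < y0 < d).
{ split; apply Rnot_le_lt; intros Hle.
  - assert (y0 = c) by lra; subst y0. destruct (B1 x0 Hx0) as (Z & _). specialize (Hfg x0 c Hx0 Z). lra.
  - assert (y0 = d) by lra; subst y0. destruct (B1 x0 Hx0) as (_ & Z). specialize (Hfg x0 d Hx0 Z). lra. }
assert (Hxx : fxx x0 y0 + 2 * k <= 0).
{ apply (second_derivative_at_max (fun t => g t y0) (fun t => fx t y0 + 2 * k * (t - a)) a b x0); auto.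
  - intros x Hx. unfold g. destruct (Hd x y0 Hx Hy0') as (D1 & _ & _ & _ & _).
    eapply is_derive_eq; [der idtac|cbv beta; ring].
  - destruct (Hd x0 y0 Hx0' Hy0') as (_ & D2 & _ & _ & _).
    eapply is_derive_eq; [der idtac|cbv beta; ring].
  - intros x Hx; apply Hmax; lra. }
assert (Hyy : fyy x0 y0 <= 0).
{ apply (second_derivative_at_max (fun t => g x0 t) (fun t => fy x0 t) c d y0); auto.
  - intros y Hy. unfold g. destruct (Hd x0 y Hx0' Hy) as (_ & _ & D3 & _ & _).
    eapply is_derive_eq; [der idtac|apply Rplus_0_r].
  - apply (Hd x0 y0 Hx0' Hy0').
  - intros y Hy; apply Hmax; lra. }
destruct (Hd x0 y0 Hx0' Hy0') as (_ & _ & _ & _ & E). lra.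
Qed.

(** * Boundary behaviour at the origin *)

(* [b] is the imaginary part of a primitive of [p + i h], and [V] that of a second primitive *)
Definition potentials (p h b a V : R -> R -> R) : Prop := forall x y, 0 < y ->
  is_derive (fun t => b t y) x (h x y) /\ is_derive (fun t => b x t) y (p x y) /\
  is_derive (fun t => a t y) x (p x y) /\ is_derive (fun t => a x t) y (- h x y) /\
  is_derive (fun t => V t y) x (b x y) /\ is_derive (fun t => V x t) y (a x y) /\
  continuity_2d_pt V x y.

(** All three forms are closed by the Cauchy-Riemann equations, with common cross derivatives [D1],
    [- D2] and [p]. Thus [a + i b] is a complex primitive of [p + i h]. *)
Lemma potentials_exist p h D1 D2 : holo p h D1 D2 -> exists b a V, potentials p h b a V.
Proof.
intros H.
destruct (exact_form h p D1) as (b & Hb).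
{ intros x y Hy; split; apply (H x y Hy). }
{ intros x y Hy; destruct (H x y Hy) as (_ & ? & ? & ? & ?); auto. }
destruct (exact_form p (fun x y => - h x y) (fun x y => - D2 x y)) as (a & Ha).
{ intros x y Hy; split; [apply (H x y Hy)|apply derN, (H x y Hy)]. }
{ intros x y Hy; destruct (H x y Hy) as (_ & ? & ? & ? & ?).
  split; [auto|split; now apply continuity_2d_pt_opp]. }
destruct (exact_form b a p) as (V & HV).
{ intros x y Hy; destruct (Hb x y Hy) as (_ & ? & _); destruct (Ha x y Hy) as (? & _ & _); auto. }
{ intros x y Hy; destruct (Hb x y Hy) as (_ & _ & ?); destruct (Ha x y Hy) as (_ & _ & ?).
  destruct (H x y Hy) as (_ & ? & _); auto. }
exists b, a, V; intros x y Hy.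
destruct (Hb x y Hy) as (? & ? & ?); destruct (Ha x y Hy) as (? & ? & ?); destruct (HV x y Hy) as (? & ? & ?).
tauto.
Qed.

(** Sampling at [(/ 4) ^ n] turns the square-root modulus into a geometric series of ratio [/ 2]. *)
Lemma sqrt_limit (f : R -> R) M : 0 <= M ->
  (forall y y', 0 < y -> y <= y' -> y' <= 1 -> Rabs (f y' - f y) <= M * sqrt y') ->
  exists k, forall y, 0 < y <= 1 -> Rabs (f y - k) <= M * sqrt y.
Proof.
intros HM H. set (u := fun n => f ((/ 4) ^ n)).
assert (Hs : forall n, sqrt ((/ 4) ^ n) = (/ 2) ^ n).
{ intros n. replace ((/ 4) ^ n) with (((/ 2) ^ n) ^ 2).
  - apply sqrt_pow2, pow_le; lra.
  - rewrite <- pow_mult, Nat.mul_comm, pow_mult. f_equal; field. }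
assert (Hp : forall n, 0 < (/ 4) ^ n <= 1).
{ intros n; split; [apply pow_lt; lra|]. rewrite <- (pow1 n). apply pow_incr; lra. }
assert (Hu : forall n, Rabs (u n - real (Lim_seq u)) <= 2 * M * (/ 2) ^ n).
{ apply geometric_limit. intros n; unfold u. rewrite Rabs_minus_sym, <- Hs. apply H.
  - apply Hp.
  - simpl; specialize (Hp n); lra.
  - apply Hp. }
exists (real (Lim_seq u)); intros y Hy. apply le_epsilon; intros e He.
assert (Hsy : 0 < sqrt y) by (apply sqrt_lt_R0; lra).
assert (Hm : 0 < Rmin e (sqrt y)) by (apply Rmin_pos; auto).
destruct (half_pow_small (2 * M + 1) (Rmin e (sqrt y)) Hm) as (n & Hn).
min_le e (sqrt y).
assert (H2 : 0 < (/ 2) ^ n) by (apply pow_lt; lra).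
assert (Hny : (/ 4) ^ n <= y).
{ apply sqrt_le_0; try lra; [left; apply Hp|]. rewrite Hs. nra. }
specialize (Hu n). specialize (H _ y (proj1 (Hp n)) Hny (proj2 Hy)).
replace (f y - real (Lim_seq u)) with ((f y - u n) + (u n - real (Lim_seq u))) by ring.
eapply Rle_trans; [apply Rabs_triang|]. unfold u at 1. lra.
Qed.

Lemma le_0_of_sqrt z c : (forall y, 0 < y <= 1 -> z <= c * sqrt y) -> z <= 0.
Proof.
intros H. apply le_epsilon; intros e He. rewrite Rplus_0_l.
set (c' := Rabs c + 1). assert (Hc : 0 < c') by (unfold c'; abs_ge0 c; lra).
set (s := Rmin 1 (e / c')).
assert (Hs : 0 < s) by (apply Rmin_pos; [lra|apply Rdiv_lt_0_compat; lra]).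
pose proof (Rmin_l 1 (e / c')) as S1; pose proof (Rmin_r 1 (e / c')) as S2; fold s in S1, S2.
specialize (H (s ^ 2)). rewrite sqrt_pow2 in H by lra.
assert (Hs2 : 0 < s ^ 2 <= 1) by (split; [apply pow_lt; lra|rewrite <- (pow1 2); apply pow_incr; lra]).
specialize (H Hs2). pose proof (Rle_abs c).
assert (c' * s <= c' * (e / c')) by (apply Rmult_le_compat_l; lra).
replace (c' * (e / c')) with e in * by (field; lra). unfold c' in *; nra.
Qed.

Lemma monotone_limit_0 (f : R -> R) B :
  (forall x y, 0 < x -> x <= y -> y <= 1 -> f x <= f y) -> (forall x, 0 < x <= 1 -> B <= f x) ->
  exists l, forall e, 0 < e -> exists d, 0 < d <= 1 /\ forall x, 0 < x <= d -> Rabs (f x - l) <= e.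
Proof.
intros Hm Hb.
destruct (completeness (fun r => exists x, 0 < x <= 1 /\ r = - f x)) as (l & Hu & Hl).
- exists (- B); intros r (x & Hx & ->). specialize (Hb x Hx); lra.
- exists (- f 1), 1; split; auto; lra.
- exists (- l); intros e He.
  destruct (classic (exists x, 0 < x <= 1 /\ l - e < - f x)) as [(x & Hx & Hlt)|Hn].
  + exists x; split; auto; intros y Hy. specialize (Hm y x ltac:(lra) ltac:(lra) ltac:(lra)).
    assert (- f y <= l) by (apply Hu; exists y; split; auto; lra). apply Rabs_le; lra.
  + exfalso. assert (l <= l - e); [|lra].
    apply Hl; intros r (x & Hx & ->).
    destruct (Rle_lt_dec (- f x) (l - e)); auto. exfalso; apply Hn; now exists x.
Qed.

Lemma derivative_bound_0 (f : R -> R) (l M d : R) : 0 < d -> f 0 = 0 -> is_derive f 0 l ->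
  (forall x, 0 < x <= d -> Rabs (f x) <= M * x) -> Rabs l <= M.
Proof.
intros Hd H0 Hf Hb. apply le_epsilon; intros e He.
apply is_derive_Reals in Hf. destruct (Hf e He) as (r & Hr).
set (x := Rmin (r / 2) d).
assert (Hx : 0 < x) by (apply Rmin_pos; auto; pose proof (cond_pos r); lra).
pose proof (Rmin_l (r / 2) d) as X1; pose proof (Rmin_r (r / 2) d) as X2; fold x in X1, X2.
specialize (Hr x ltac:(lra)). rewrite Rabs_right in Hr by lra.
specialize (Hr ltac:(pose proof (cond_pos r); lra)). rewrite Rplus_0_l, H0, Rminus_0_r in Hr.
specialize (Hb x ltac:(lra)).
assert (Hq : Rabs (f x / x) <= M).
{ unfold Rdiv; rewrite Rabs_mult, Rabs_inv, (Rabs_right x) by lra.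
  apply Rmult_le_reg_r with x; auto. rewrite Rmult_assoc, Rinv_l; lra. }
replace l with (f x / x - (f x / x - l)) by ring.
unfold Rminus at 1; eapply Rle_trans; [apply Rabs_triang|]. rewrite Rabs_Ropp. lra.
Qed.

Section Boundary.
Variables (p h b a V : R -> R -> R).
Hypothesis HV : potentials p h b a V.
Hypothesis h_nonneg : forall x y, 0 < y -> 0 <= h x y.
Hypothesis h_bound : exists C, forall x y, Rabs x <= 1 -> 0 < y <= 1 -> h x y <= C / y.

Lemma der_inv_sqrt (t : R) : 0 < t -> is_derive (fun t => / sqrt t) t (- / (2 * t * sqrt t)).
Proof.
intros Ht. assert (Hs : 0 < sqrt t) by now apply sqrt_lt_R0.
auto_derive; [split; auto; split; auto; lra|].
replace (2 * t * sqrt t) with (2 * (sqrt t * sqrt t) * sqrt t) by (rewrite sqrt_sqrt; lra). field; lra.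
Qed.

Lemma der_sqrt (t : R) : 0 < t -> is_derive sqrt t (/ (2 * sqrt t)).
Proof. intros Ht. auto_derive; auto. field. pose proof (sqrt_lt_R0 t Ht); lra. Qed.

(** Since [a] has vertical derivative [- h], the bound [C / y] lets [a] grow at most
    logarithmically; the cruder bound by [/ sqrt y] is already integrable and gives [V] boundary
    values with modulus [sqrt y]. *)
Lemma V_boundary : exists M K, 0 <= M /\ forall x y, Rabs x <= 1 -> 0 < y <= 1 -> Rabs (V x y - K x) <= M * sqrt y.
Proof.
destruct h_bound as (C & HC).
assert (HC0 : 0 <= C).
{ specialize (HC 0 1 ltac:(rewrite Rabs_R0; lra) ltac:(lra)). specialize (h_nonneg 0 1 ltac:(lra)). lra. }
destruct (bounded_on (fun x => a x 1) (-1) 1) as (C0 & HC0' & Ha1); [lra| |].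
{ intros x _. destruct (HV x 1 Rlt_0_1) as (_ & _ & H3 & _). exact (der_cont _ _ _ H3). }
assert (Ha : forall x y, Rabs x <= 1 -> 0 < y <= 1 -> Rabs (a x y) <= C0 + 2 * C * / sqrt y).
{ intros x y Hx Hy. assert (Hx' := Hx). apply Rabs_le_between in Hx'.
  specialize (Ha1 x Hx'). apply Rabs_le_between in Ha1.
  assert (Hsy : 0 < sqrt y) by (apply sqrt_lt_R0; lra).
  assert (0 <= C * / sqrt y) by (apply Rmult_le_pos; auto; left; now apply Rinv_0_lt_compat).
  assert (L1 : a x 1 <= a x y).
  { apply (der_decr (a x)); [lra|]. intros t Ht. assert (Ht0 : 0 < t) by lra.
    destruct (HV x t Ht0) as (_ & _ & _ & Hat & _). eexists; split; [exact Hat|].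
    specialize (h_nonneg x t Ht0); lra. }
  assert (L2 : a x y - 2 * C * / sqrt y <= a x 1 - 2 * C * / sqrt 1).
  { apply (der_incr (fun t => a x t - 2 * C * / sqrt t)); [lra|]. intros t Ht.
    assert (Ht0 : 0 < t) by lra. destruct (HV x t Ht0) as (_ & _ & _ & Hat & _).
    pose proof (der_inv_sqrt t Ht0) as Hst. eexists; split; [der idtac|].
    cbv beta. assert (Hs : 0 < sqrt t) by now apply sqrt_lt_R0.
    specialize (HC x t Hx ltac:(lra)).
    assert (Hs1 : sqrt t <= 1) by (rewrite <- sqrt_1; apply sqrt_le_1; lra).
    assert (C / t <= C * / (t * sqrt t)).
    { apply Rmult_le_compat_l; auto. apply Rinv_le_contravar; nra. }
    replace (2 * C * - / (2 * t * sqrt t)) with (- (C * / (t * sqrt t))) by (field; lra). lra. }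
  rewrite sqrt_1, Rinv_1 in L2. apply Rabs_le; split; lra. }
assert (HK : forall x, exists k, Rabs x <= 1 -> forall y, 0 < y <= 1 -> Rabs (V x y - k) <= (C0 + 4 * C) * sqrt y).
{ intros x. destruct (Rle_dec (Rabs x) 1) as [Hx|Hn]; [|exists 0; intros; contradiction].
  destruct (sqrt_limit (V x) (C0 + 4 * C)) as (k & Hk); [lra| |now exists k].
  intros y y' Hy Hyy Hy1.
  assert (Hb : forall (sg : R), sg = 1 \/ sg = -1 -> sg * V x y' - (C0 * y' + 4 * C * sqrt y') <= sg * V x y - (C0 * y + 4 * C * sqrt y)).
  { intros sg Hsg. apply (der_decr (fun t => sg * V x t - (C0 * t + 4 * C * sqrt t))); auto. intros t Ht.
    assert (Ht0 : 0 < t) by lra. destruct (HV x t Ht0) as (_ & _ & _ & _ & _ & HVt & _).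
    pose proof (der_sqrt t Ht0) as Hst. eexists; split; [der idtac|].
    cbv beta. specialize (Ha x t Hx ltac:(lra)). apply Rabs_le_between in Ha.
    assert (Hs : 0 < sqrt t) by now apply sqrt_lt_R0.
    replace (4 * C * / (2 * sqrt t)) with (2 * C * / sqrt t) by (field; lra). destruct Hsg; subst sg; lra. }
  assert (B1 := Hb 1 (or_introl eq_refl)). assert (B2 := Hb (-1) (or_intror eq_refl)).
  assert (Hs : 0 <= sqrt y) by apply sqrt_pos.
  assert (Hyy' : y' <= sqrt y').
  { assert (sqrt y' <= 1) by (rewrite <- sqrt_1; apply sqrt_le_1; lra).
    assert (0 <= sqrt y') by apply sqrt_pos. rewrite <- (sqrt_sqrt y') at 1 by lra. nra. }
  assert (0 <= C * sqrt y) by (apply Rmult_le_pos; auto).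
  apply Rabs_le; split; nra. }
exists (C0 + 4 * C), (fun x => proj1_sig (constructive_indefinite_description _ (HK x))).
split; [lra|]. intros x y Hx Hy. destruct (constructive_indefinite_description _ (HK x)) as (k & Hk); simpl; auto.
Qed.

(* Convexity of [V] in [x] passes to its boundary values [K], so [K] has one-sided derivatives at 0. *)
Lemma boundary_symmetric_derivative M K :
  (forall x y, Rabs x <= 1 -> 0 < y <= 1 -> Rabs (V x y - K x) <= M * sqrt y) ->
  exists d, forall e, 0 < e -> exists r, 0 < r <= 1 /\
    forall x, 0 < x <= r -> Rabs ((K x - K (- x)) / 2 - d * x) <= e * x.
Proof.
intros HK.
(* The slope inequality, cross-multiplied. At height [y] it holds for [V] with intermediate slope
   [b t y], because [h >= 0] makes [b] nondecreasing in [x]; replacing [V] by [K] costs a multiple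
   of [sqrt y]. *)
assert (Hconv : forall s t x, -1 <= s -> s < t -> t < x -> x <= 1 ->
  (K t - K s) * (x - t) <= (t - s) * (K x - K t)).
{ intros s t x Hs Hst Htx Hx.
  apply Rminus_le. apply le_0_of_sqrt with (4 * 2 * M). intros y Hy.
  assert (Hb : forall u v, u <= v -> V v y - V u y <= (v - u) * b v y /\ (v - u) * b u y <= V v y - V u y).
  { intros u v Huv.
    assert (Hbm : forall u v, u <= v -> b u y <= b v y).
    { intros u' v' H'. apply (der_incr (fun t => b t y)); auto. intros t' _.
      destruct (HV t' y (proj1 Hy)) as (Hbx & _). eexists; split; [exact Hbx|]. apply h_nonneg; lra. }
    split.
    - assert (V v y - b v y * v <= V u y - b v y * u); [|lra].
      apply (der_decr (fun t => V t y - b v y * t)); auto. intros t' Ht'.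
      destruct (HV t' y (proj1 Hy)) as (_ & _ & _ & _ & HVx & _). eexists; split; [der idtac|].
      specialize (Hbm t' v ltac:(lra)). cbv beta; lra.
    - assert (V u y - b u y * u <= V v y - b u y * v); [|lra].
      apply (der_incr (fun t => V t y - b u y * t)); auto. intros t' Ht'.
      destruct (HV t' y (proj1 Hy)) as (_ & _ & _ & _ & HVx & _). eexists; split; [der idtac|].
      specialize (Hbm u t' ltac:(lra)). cbv beta; lra. }
  destruct (Hb s t ltac:(lra)) as (B1 & _). destruct (Hb t x ltac:(lra)) as (_ & B2).
  assert (E1 := HK s y ltac:(apply Rabs_le; lra) Hy). assert (E2 := HK t y ltac:(apply Rabs_le; lra) Hy).
  assert (E3 := HK x y ltac:(apply Rabs_le; lra) Hy).
  apply Rabs_le_between in E1, E2, E3. set (w := M * sqrt y) in *.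
  assert (Hw : 0 <= w) by lra.
  assert (H1 : (K t - K s) * (x - t) <= (t - s) * b t y * (x - t) + 2 * w * (x - t)) by nra.
  assert (H2 : (t - s) * ((x - t) * b t y) <= (t - s) * (K x - K t) + 2 * w * (t - s)) by nra.
  replace (4 * 2 * M * sqrt y) with (8 * w) by (unfold w; ring). nra. }
assert (Hr : exists l, forall e, 0 < e -> exists d, 0 < d <= 1 /\ forall x, 0 < x <= d -> Rabs ((K x - K 0) / x - l) <= e).
{ apply (monotone_limit_0 (fun x => (K x - K 0) / x) (K 0 - K (-1))).
  - intros x y Hx Hxy Hy. destruct (Rle_lt_or_eq_dec x y Hxy) as [Hlt| ->]; [|lra].
    specialize (Hconv 0 x y ltac:(lra) Hx Hlt Hy).
    apply Rmult_le_reg_r with (x * y); [nra|].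
    replace ((K x - K 0) / x * (x * y)) with ((K x - K 0) * y) by (field; lra).
    replace ((K y - K 0) / y * (x * y)) with ((K y - K 0) * x) by (field; lra). nra.
  - intros x Hx. specialize (Hconv (-1) 0 x ltac:(lra) ltac:(lra) ltac:(lra) ltac:(lra)).
    apply Rmult_le_reg_r with x; [lra|].
    replace ((K x - K 0) / x * x) with (K x - K 0) by (field; lra). lra. }
assert (Hl : exists l, forall e, 0 < e -> exists d, 0 < d <= 1 /\ forall x, 0 < x <= d -> Rabs ((K (- x) - K 0) / x - l) <= e).
{ apply (monotone_limit_0 (fun x => (K (- x) - K 0) / x) (K 0 - K 1)).
  - intros x y Hx Hxy Hy. destruct (Rle_lt_or_eq_dec x y Hxy) as [Hlt| ->]; [|lra].
    specialize (Hconv (- y) (- x) 0 ltac:(lra) ltac:(lra) ltac:(lra) ltac:(lra)).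
    apply Rmult_le_reg_r with (x * y); [nra|].
    replace ((K (- x) - K 0) / x * (x * y)) with ((K (- x) - K 0) * y) by (field; lra).
    replace ((K (- y) - K 0) / y * (x * y)) with ((K (- y) - K 0) * x) by (field; lra). nra.
  - intros x Hx. specialize (Hconv (- x) 0 1 ltac:(lra) ltac:(lra) ltac:(lra) ltac:(lra)).
    apply Rmult_le_reg_r with x; [lra|].
    replace ((K (- x) - K 0) / x * x) with (K (- x) - K 0) by (field; lra). lra. }
destruct Hr as (lr & Hr). destruct Hl as (ll & Hl).
(* [ll] is taken along [- x], so it is minus the left derivative and the witness is the mean of the
   two one-sided derivatives. *)
exists ((lr - ll) / 2); intros e He.
destruct (Hr e He) as (r1 & R1 & HR1). destruct (Hl e He) as (r2 & R2 & HR2).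
min_le r1 r2.
exists (Rmin r1 r2); split; [split; [apply Rmin_pos; lra|lra]|].
intros x Hx. specialize (HR1 x ltac:(lra)). specialize (HR2 x ltac:(lra)).
apply Rabs_le_between in HR1, HR2.
set (s1 := (K x - K 0) / x) in *. set (s2 := (K (- x) - K 0) / x) in *.
replace ((K x - K (- x)) / 2 - (lr - ll) / 2 * x) with (((s1 - lr) - (s2 - ll)) / 2 * x) by (unfold s1, s2; field; lra).
rewrite Rabs_mult, (Rabs_right x) by lra. apply Rmult_le_compat_r; [lra|]. apply Rabs_le; lra.
Qed.

(* Barrier argument: the odd part in [x] of [V - d x] is [o(x)] on the boundary, hence so is it,
   up to [O(x y)], inside. *)
Lemma b_limit_0 : exists d, forall e, 0 < e -> exists r, 0 < r /\ forall y, 0 < y < r -> Rabs (b 0 y - d) <= e.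
Proof.
destruct V_boundary as (M & K & HM & HK).
destruct (boundary_symmetric_derivative M K HK) as (d & Hd).
exists d; intros e He. destruct (Hd (e / 4) ltac:(lra)) as (r & Hr & Hr').
set (th := e / 4) in *.
set (O := fun x y => (V x y - V (- x) y) / 2 - d * x).
set (Ox := fun x y => (b x y + b (- x) y) / 2 - d). set (Oxx := fun x y => (h x y - h (- x) y) / 2).
set (Oy := fun x y => (a x y - a (- x) y) / 2). set (Oyy := fun x y => (- h x y + h (- x) y) / 2).
assert (Hrefl : forall (f f' : R -> R) (x : R), is_derive f (- x) (f' (- x)) -> is_derive (fun t => f (- t)) x (- f' (- x))).
{ intros f f' x H. eapply is_derive_eq.
  - apply (is_derive_comp f (fun t => - t)); [exact H|apply derN, derI].
  - unfold scal; simpl; unfold mult; simpl; ring. }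
assert (OD : forall x y, 0 < y -> is_derive (fun t => O t y) x (Ox x y) /\ is_derive (fun t => Ox t y) x (Oxx x y) /\
   is_derive (fun t => O x t) y (Oy x y) /\ is_derive (fun t => Oy x t) y (Oyy x y)).
{ intros x y Hy. destruct (HV x y Hy) as (H1 & H2 & H3 & H4 & H5 & H6 & _).
  destruct (HV (- x) y Hy) as (G1 & G2 & G3 & G4 & G5 & G6 & _).
  pose proof (Hrefl (fun t => V t y) (fun t => b t y) x G5) as F1.
  pose proof (Hrefl (fun t => b t y) (fun t => h t y) x G1) as F2. cbv beta in F1, F2.
  unfold O, Ox, Oy, Rdiv; split; [|split; [|split]]; (eapply is_derive_eq; [der idtac|unfold Ox, Oxx, Oy, Oyy; cbv beta; field]). }
assert (OC : forall x y, 0 < y -> continuity_2d_pt O x y).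
{ intros x y Hy. unfold O.
  apply continuity_2d_pt_ext with (fun x y => / 2 * (V x y - V (- x) y) - d * x); [intros; field|].
  apply continuity_2d_pt_minus.
  - apply continuity_2d_pt_mult; [apply continuity_2d_pt_const|]. apply continuity_2d_pt_minus; [apply (HV x y Hy)|].
    destruct (HV (- x) y Hy) as (_ & _ & _ & _ & _ & _ & HC). intros eps. destruct (HC eps) as (dl & Hdl).
    exists dl; intros u v Hu Hv. apply Hdl; auto. replace (- u - - x) with (- (u - x)) by ring. now rewrite Rabs_Ropp.
  - apply continuity_2d_pt_mult; [apply continuity_2d_pt_const|apply continuity_2d_pt_id1]. }
assert (O0 : forall y, O 0 y = 0) by (intros y; unfold O; rewrite Ropp_0; field).
assert (Ob : forall x y, 0 < x <= r -> 0 < y <= 1 -> Rabs (O x y) <= th * x + M * sqrt y).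
{ intros x y Hx Hy. specialize (Hr' x Hx).
  assert (E1 := HK x y ltac:(apply Rabs_le; lra) Hy). assert (E2 := HK (- x) y ltac:(apply Rabs_le; lra) Hy).
  apply Rabs_le_between in E1, E2, Hr'. apply Rabs_le; unfold O; split; lra. }
destruct (bounded_on (fun x => Ox x r) 0 r) as (L & HL & HLb); [lra| |].
{ intros x _; eapply der_cont; apply (OD x r); lra. }
assert (Otop : forall x, 0 <= x <= r -> Rabs (O x r) <= L * x).
{ intros x Hx. replace (O x r) with (O x r - O 0 r) by (rewrite O0; ring).
  replace x with (Rabs (x - 0)) at 2 by (rewrite Rminus_0_r, Rabs_right; lra).
  apply (mvt_bound (fun t => O t r) (fun t => Ox t r)). rewrite Rmin_left, Rmax_right by lra.
  intros t Ht; split; [apply OD; lra|apply HLb; lra]. }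
assert (Hth : 0 < th) by (unfold th; lra).
(* The first term serves the side [x = r], where [M * sqrt y <= th * r + M ^ 2 / (4 * th * r) * y]
   by completing a square; the second serves the top [y = r], where [|O x r| <= L * x]. *)
set (c1 := M ^ 2 / (4 * th * r ^ 2) + L / r).
assert (Hr2 : 0 < r ^ 2) by (apply pow_lt; lra).
assert (Hc1 : 0 <= M ^ 2 / (4 * th * r ^ 2)) by (apply Rdiv_le_0_compat; [apply pow2_ge_0|nra]).
assert (Hc2 : 0 <= L / r) by (apply Rdiv_le_0_compat; lra).
assert (Oside : forall y, 0 < y <= r -> M * sqrt y <= th * r + c1 * r * y).
{ intros y Hy. set (z := sqrt y). assert (Ez : y = z ^ 2) by (unfold z; rewrite pow2_sqrt; lra).
  rewrite Ez. assert (M ^ 2 / (4 * th * r ^ 2) * r * z ^ 2 + th * r - M * z = (th * r - M * z / 2) ^ 2 / (th * r)) by (field; lra).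
  assert (0 <= (th * r - M * z / 2) ^ 2 / (th * r)) by (apply Rdiv_le_0_compat; [apply pow2_ge_0|nra]).
  assert (0 <= L / r * r * z ^ 2) by (apply Rmult_le_pos; [nra|apply pow2_ge_0]). unfold c1; lra. }
assert (Hmain : forall (sg : R), sg = 1 \/ sg = -1 -> forall x y, 0 <= x <= r -> 0 < y <= r ->
   sg * O x y <= 2 * th * x + c1 * x * y).
{ intros sg Hsg x y Hx Hy. apply Rminus_le. apply le_0_of_sqrt with M. intros eta Heta.
  destruct (Rle_lt_dec y eta) as [Hle|Hlt].
  { destruct (Rle_lt_or_eq_dec 0 x (proj1 Hx)) as [Hx0|<-].
    - specialize (Ob x y ltac:(lra) ltac:(lra)). apply Rabs_le_between in Ob.
      assert (sqrt y <= sqrt eta) by (apply sqrt_le_1; lra).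
      assert (M * sqrt y <= M * sqrt eta) by (apply Rmult_le_compat_l; auto).
      assert (0 <= c1 * x * y) by (apply Rmult_le_pos; [apply Rmult_le_pos; unfold c1; lra|lra]).
      destruct Hsg; subst sg; nra.
    - rewrite O0. assert (0 <= M * sqrt eta) by (apply Rmult_le_pos; auto; apply sqrt_pos). lra. }
  assert (Hse : 0 <= M * sqrt eta) by (apply Rmult_le_pos; auto; apply sqrt_pos).
  apply Rminus_le.
  apply (max_principle (fun x y => sg * O x y - (2 * th * x + c1 * x * y) - M * sqrt eta)
    (fun x y => sg * Ox x y - (2 * th + c1 * y)) (fun x y => sg * Oxx x y)
    (fun x y => sg * Oy x y - c1 * x) (fun x y => sg * Oyy x y) 0 r eta r); try lra.
  - intros u v Hu Hv. apply continuity_2d_pt_minus; [apply continuity_2d_pt_minus|apply continuity_2d_pt_const].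
    + apply continuity_2d_pt_mult; [apply continuity_2d_pt_const|apply OC; lra].
    + apply continuity_2d_pt_plus; repeat apply continuity_2d_pt_mult;
        first [apply continuity_2d_pt_const|apply continuity_2d_pt_id1|apply continuity_2d_pt_id2].
  - intros u v Hu Hv. assert (Hv0 : 0 < v) by lra. destruct (OD u v Hv0) as (D1 & D2 & D3 & D4).
    split; [|split; [|split; [|split]]].
    + eapply is_derive_eq; [der idtac|cbv beta; ring].
    + eapply is_derive_eq; [der idtac|cbv beta; ring].
    + eapply is_derive_eq; [der idtac|cbv beta; ring].
    + eapply is_derive_eq; [der idtac|cbv beta; ring].
    + unfold Oxx, Oyy; field.
  - intros u Hu. assert (0 <= c1) by (unfold c1; lra). split.
    + assert (0 <= c1 * u * eta) by (apply Rmult_le_pos; [apply Rmult_le_pos|]; lra).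
      destruct (Rle_lt_or_eq_dec 0 u (proj1 Hu)) as [Hu0|<-].
      * specialize (Ob u eta ltac:(lra) ltac:(lra)). apply Rabs_le_between in Ob.
        assert (0 <= th * u) by nra. destruct Hsg; subst sg; lra.
      * rewrite O0; lra.
    + specialize (Otop u Hu). apply Rabs_le_between in Otop.
      assert (0 <= th * u) by nra.
      assert (L * u <= c1 * u * r).
      { replace (c1 * u * r) with (M ^ 2 / (4 * th * r ^ 2) * u * r + L * u) by (unfold c1; field; lra).
        assert (0 <= M ^ 2 / (4 * th * r ^ 2) * u * r) by (apply Rmult_le_pos; [apply Rmult_le_pos|]; lra). lra. }
      destruct Hsg; subst sg; lra.
  - intros v Hv. split.
    + rewrite O0; lra.
    + specialize (Ob r v ltac:(lra) ltac:(lra)). specialize (Oside v ltac:(lra)). apply Rabs_le_between in Ob.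
      destruct Hsg; subst sg; lra. }
exists (Rmin r (e / (2 * (c1 + 1)))). assert (Hc0 : 0 <= c1) by (unfold c1; lra).
split; [apply Rmin_pos; [lra|apply Rdiv_lt_0_compat; lra]|].
intros y Hy. min_le r (e / (2 * (c1 + 1))).
assert (Hcy : c1 * y <= e / 2).
{ assert ((c1 + 1) * y <= (c1 + 1) * (e / (2 * (c1 + 1)))) by (apply Rmult_le_compat_l; lra).
  replace ((c1 + 1) * (e / (2 * (c1 + 1)))) with (e / 2) in * by (field; lra). lra. }
(* The derivative of [O] in [x] at 0 is [b 0 y - d], so the linear barrier through the origin bounds
   exactly this quantity. *)
apply Rle_trans with (2 * th + c1 * y); [|unfold th; lra].
apply (derivative_bound_0 (fun t => O t y) _ _ r); [lra|apply O0| |].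
- destruct (OD 0 y ltac:(lra)) as (D1 & _). eapply is_derive_eq; [exact D1|].
  unfold Ox; rewrite Ropp_0; field.
- intros x Hx. assert (P1 := Hmain 1 (or_introl eq_refl) x y ltac:(lra) ltac:(lra)).
  assert (P2 := Hmain (-1) (or_intror eq_refl) x y ltac:(lra) ltac:(lra)).
  apply Rabs_le; split; lra.
Qed.

End Boundary.

(** * Boundary values on the positive half-line *)

(* For [k = k1 + i k2], the quantities [|y' + i k y|^2] and [|y' - i k y|^2]. *)
Definition sqP (k1 k2 y1 y2 z1 z2 : R) : R := (z1 - (k1 * y2 + k2 * y1)) ^ 2 + (z2 + (k1 * y1 - k2 * y2)) ^ 2.
Definition sqM (k1 k2 y1 y2 z1 z2 : R) : R := (z1 + (k1 * y2 + k2 * y1)) ^ 2 + (z2 - (k1 * y1 - k2 * y2)) ^ 2.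

(** Young's inequality with weight [k], scaled by [g]; the case [g = 0] is separate because the
    completed square is divided by [g]. *)
Lemma two_dot_le a1 a2 f1 f2 g N k : 0 < k -> 0 <= g -> f1 ^ 2 + f2 ^ 2 <= g ^ 2 * N ->
  Rabs (2 * (a1 * f1 + a2 * f2)) <= g * ((a1 ^ 2 + a2 ^ 2) / k + k * N).
Proof.
intros Hk Hg Hf. set (S := a1 ^ 2 + a2 ^ 2).
destruct (Rle_lt_or_eq_dec 0 g Hg) as [Hg0|<-].
- assert (Hb : forall sg : R, sg = 1 \/ sg = -1 -> sg * (2 * (a1 * f1 + a2 * f2)) <= g * (S / k + k * N)).
  { intros sg Hsg. apply Rmult_le_reg_r with (k * g); [nra|].
    replace (g * (S / k + k * N) * (k * g)) with (g ^ 2 * S + k ^ 2 * (g ^ 2 * N)) by (field; lra).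
    assert (k ^ 2 * (f1 ^ 2 + f2 ^ 2) <= k ^ 2 * (g ^ 2 * N)) by (apply Rmult_le_compat_l; auto; apply pow2_ge_0).
    sq_ge0 (g * a1 - sg * k * f1); sq_ge0 (g * a2 - sg * k * f2).
    assert (Hs2 : sg ^ 2 = 1) by (destruct Hsg; subst sg; ring).
    replace ((g * a1 - sg * k * f1) ^ 2) with (g ^ 2 * a1 ^ 2 + sg ^ 2 * (k ^ 2 * f1 ^ 2) - 2 * sg * k * g * (a1 * f1)) in * by ring.
    replace ((g * a2 - sg * k * f2) ^ 2) with (g ^ 2 * a2 ^ 2 + sg ^ 2 * (k ^ 2 * f2 ^ 2) - 2 * sg * k * g * (a2 * f2)) in * by ring.
    rewrite Hs2 in *. unfold S. lra. }
  pose proof (Hb 1 (or_introl eq_refl)). pose proof (Hb (-1) (or_intror eq_refl)). apply Rabs_le; lra.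
- rewrite Rmult_0_l. assert (f1 = 0) by (apply pow2_le_0; sq_ge0 f2; lra).
  assert (f2 = 0) by (apply pow2_le_0; sq_ge0 f1; lra). subst f1 f2.
  rewrite Rabs_right; lra.
Qed.

Section Cone.
Variables (q : R -> R) (A : R).
Hypothesis qC : forall x, A <= x -> continuous q x.

(* With [a = y' + i k y], [b = y' - i k y] and [k^2 = lambda - s0] one has
   [a' = i k a + O(g) y] and [b' = - i k b + O(g) y], so [|b|^2/|a|^2] grows at rate [4 k2] up to [O(g)];
   being at most 2 it must be bounded by the tail of the integral of [g]. *)
Lemma cone mu eps s X (k1 k2 dk1 dk2 s0 g : R -> R) kap kmin G :
  A <= X -> solves q A mu eps s -> 0 < energy s A -> (forall x, A <= x -> 0 <= imYZ s x) ->
  0 < kap -> 0 < kmin ->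
  (forall x, X <= x -> is_derive k1 x (dk1 x) /\ is_derive k2 x (dk2 x)) ->
  (forall x, X <= x -> k1 x ^ 2 - k2 x ^ 2 = mu - s0 x /\ 2 * k1 x * k2 x = eps) ->
  (forall x, X <= x -> kmin <= k1 x /\ kap <= k2 x /\ 3 * k2 x <= k1 x) ->
  (forall x, X <= x -> continuous g x /\ Rabs (q x - s0 x) + (Rabs (dk1 x) + Rabs (dk2 x)) <= g x) ->
  (forall Y, X <= Y -> RInt g X Y <= G) ->
  sqM (k1 X) (k2 X) (Y1 s X) (Y2 s X) (Z1 s X) (Z2 s X) <=
    9 / kmin * G * sqP (k1 X) (k2 X) (Y1 s X) (Y2 s X) (Z1 s X) (Z2 s X).
Proof.
intros HX Hs HE HJ Hkap Hkmin Hk Hk2 Hkb Hg HG.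
set (a := fun x => sqP (k1 x) (k2 x) (Y1 s x) (Y2 s x) (Z1 s x) (Z2 s x)).
set (b := fun x => sqM (k1 x) (k2 x) (Y1 s x) (Y2 s x) (Z1 s x) (Z2 s x)).
change (b X <= 9 / kmin * G * a X).
(* [aa - bb = 4 k1 Im (conj y y') - 4 k2 Re (conj y y')]. The first term is nonnegative, and
   [3 * k2 <= k1] bounds the second product [4 k2 Re (conj y y')] by [(aa + bb) / 3], hence
   [bb <= 2 * aa]. *)
assert (Hab : forall x, X <= x -> 0 < a x /\ b x <= 2 * a x).
{ intros x Hx. destruct (Hkb x Hx) as (B1 & B2 & B3). specialize (HJ x ltac:(lra)).
  assert (HEx : 0 < energy s x) by (apply (energy_pos q A qC mu eps); auto; lra).
  unfold energy, sqY, sqZ in HEx. unfold imYZ in HJ. unfold a, b, sqP, sqM.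
  set (y1 := Y1 s x) in *. set (y2 := Y2 s x) in *. set (z1 := Z1 s x) in *. set (z2 := Z2 s x) in *.
  set (u := k1 x) in *. set (w := k2 x) in *.
  set (aa := (z1 - (u * y2 + w * y1)) ^ 2 + (z2 + (u * y1 - w * y2)) ^ 2).
  set (bb := (z1 + (u * y2 + w * y1)) ^ 2 + (z2 - (u * y1 - w * y2)) ^ 2).
  set (N := y1 ^ 2 + y2 ^ 2) in *. set (Z := z1 ^ 2 + z2 ^ 2) in *.
  assert (E1 : aa - bb = 4 * u * (y1 * z2 - y2 * z1) - 4 * w * (y1 * z1 + y2 * z2)) by (unfold aa, bb; ring).
  assert (E2 : aa + bb = 2 * (Z + (u ^ 2 + w ^ 2) * N)) by (unfold aa, bb, Z, N; ring).
  assert (H0 : 0 <= 4 * u * (y1 * z2 - y2 * z1)) by (apply Rmult_le_pos; lra).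
  assert (H1 : 4 * w * (y1 * z1 + y2 * z2) <= (aa + bb) / 3).
  { rewrite E2.
    assert (6 * w * (y1 * z1 + y2 * z2) <= Z + 9 * w ^ 2 * N).
    { sq_ge0 (z1 - 3 * w * y1); sq_ge0 (z2 - 3 * w * y2). unfold Z, N; lra. }
    assert (9 * w ^ 2 * N <= u ^ 2 * N).
    { apply Rmult_le_compat_r; [unfold N; nra|]. nra. }
    assert (0 <= w ^ 2 * N) by (apply Rmult_le_pos; [apply pow2_ge_0|unfold N; nra]). lra. }
  assert (Hsum : 0 < aa + bb).
  { rewrite E2. assert (0 <= N) by (unfold N; nra). assert (0 <= Z) by (unfold Z; nra).
    assert (Hu2 : 0 < u ^ 2 + w ^ 2) by (sq_ge0 w; assert (0 < u ^ 2) by (apply pow_lt; lra); lra).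
    destruct (Rle_lt_or_eq_dec 0 N H) as [HN|HN]; [|rewrite <- HN; lra].
    assert (0 < (u ^ 2 + w ^ 2) * N) by (apply Rmult_lt_0_compat; auto). lra. }
  split; lra. }
destruct (primitive_exists g X) as (Pg & Pg0 & HPg); [intros; now apply Hg|].
assert (HPG : forall Y, X <= Y -> Pg Y <= G).
{ intros Y HY. specialize (HG Y HY). rewrite (RInt_of_derive Pg g) in HG; auto; [lra|intros; now apply Hg]. }
assert (HG0 : 0 <= G) by (rewrite <- Pg0; apply HPG; lra).
assert (Hg0 : forall x, X <= x -> 0 <= g x).
{ intros x Hx. destruct (Hg x Hx) as (_ & H).
  abs_ge0 (q x - s0 x); abs_ge0 (dk1 x); abs_ge0 (dk2 x). lra. }
(* With [b <= 2 a] the perturbation lowers the derivative of the quotient by at most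
   [(7 / 2 + 5) * g / k1]; the added primitive, with 9 in place of [17 / 2], restores growth at rate
   [4 * kap]. *)
set (F := fun x => b x * / a x + 9 / kmin * Pg x).
assert (HF : forall x, X <= x -> exists l : R, is_derive F x l /\ 4 * kap * (b x * / a x) <= l).
{ intros x Hx. destruct (Hkb x Hx) as (B1 & B2 & B3). destruct (Hab x Hx) as (Ha0 & Hba).
  destruct (Hk x Hx) as (K1 & K2). destruct (Hk2 x Hx) as (E1 & E2). destruct (Hg x Hx) as (_ & Hgx).
  destruct (solves_der q A mu eps s x Hs ltac:(lra)) as (S1 & S2 & S3 & S4).
  specialize (Hg0 x Hx). pose proof (HPg x Hx) as HPx.
  set (e := q x - s0 x) in *.
  set (y1 := Y1 s x) in *. set (y2 := Y2 s x) in *. set (z1 := Z1 s x) in *. set (z2 := Z2 s x) in *.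
  set (u := k1 x) in *. set (w := k2 x) in *. set (du := dk1 x) in *. set (dw := dk2 x) in *.
  set (a1 := z1 - (u * y2 + w * y1)). set (a2 := z2 + (u * y1 - w * y2)).
  set (b1 := z1 + (u * y2 + w * y1)). set (b2 := z2 - (u * y1 - w * y2)).
  set (f1 := e * y1 - (du * y2 + dw * y1)). set (f2 := e * y2 + (du * y1 - dw * y2)).
  set (g1 := e * y1 + (du * y2 + dw * y1)). set (g2 := e * y2 - (du * y1 - dw * y2)).
  assert (Hq : q x - mu = e - (u ^ 2 - w ^ 2)) by (rewrite E1; unfold e; ring).
  assert (Da : is_derive a x (- 2 * w * (a1 ^ 2 + a2 ^ 2) + 2 * (a1 * f1 + a2 * f2))).
  { unfold a, sqP. eapply is_derive_eq; [der idtac|]. cbv beta.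
    fold y1 y2 z1 z2 u w du dw. rewrite Hq, <- E2. unfold a1, a2, f1, f2. ring. }
  assert (Db : is_derive b x (2 * w * (b1 ^ 2 + b2 ^ 2) + 2 * (b1 * g1 + b2 * g2))).
  { unfold b, sqM. eapply is_derive_eq; [der idtac|]. cbv beta.
    fold y1 y2 z1 z2 u w du dw. rewrite Hq, <- E2. unfold b1, b2, g1, g2. ring. }
  assert (Ea : a x = a1 ^ 2 + a2 ^ 2) by reflexivity. assert (Eb : b x = b1 ^ 2 + b2 ^ 2) by reflexivity.
  rewrite <- Ea in Da. rewrite <- Eb in Db.
  set (N := y1 ^ 2 + y2 ^ 2).
  assert (HN : 0 <= N) by (unfold N; nra).
  assert (Hgsq : forall t, Rabs t <= Rabs e + Rabs dw -> (t ^ 2 + du ^ 2) * N <= g x ^ 2 * N).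
  { intros t Ht. apply Rmult_le_compat_r; auto. rewrite <- (pow2_abs t), <- (pow2_abs du).
    abs_ge0 t; abs_ge0 du.
    apply Rle_trans with ((Rabs t + Rabs du) ^ 2); [nra|]. apply pow_incr; lra. }
  assert (Bf : Rabs (2 * (a1 * f1 + a2 * f2)) <= g x * (a x / u + u * N)).
  { rewrite Ea. apply two_dot_le; try lra.
    replace (f1 ^ 2 + f2 ^ 2) with (((e - dw) ^ 2 + du ^ 2) * N) by (unfold f1, f2, N; ring).
    apply Hgsq. unfold Rminus. eapply Rle_trans; [apply Rabs_triang|]. rewrite Rabs_Ropp; lra. }
  assert (Bg : Rabs (2 * (b1 * g1 + b2 * g2)) <= g x * (b x / u + u * N)).
  { rewrite Eb. apply two_dot_le; try lra.
    replace (g1 ^ 2 + g2 ^ 2) with (((e + dw) ^ 2 + du ^ 2) * N) by (unfold g1, g2, N; ring).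
    apply Hgsq. apply Rabs_triang. }
  assert (HuN : u * N <= (a x + b x) / (2 * u)).
  { assert (4 * (u ^ 2 + w ^ 2) * N <= 2 * (a x + b x)).
    { rewrite Ea, Eb.
      assert (2 * ((a1 ^ 2 + a2 ^ 2) + (b1 ^ 2 + b2 ^ 2)) - 4 * (u ^ 2 + w ^ 2) * N = 4 * (z1 ^ 2 + z2 ^ 2)) by
        (unfold a1, a2, b1, b2, N; ring). sq_ge0 z1; sq_ge0 z2. lra. }
    assert (0 <= w ^ 2 * N) by (apply Rmult_le_pos; auto; apply pow2_ge_0).
    apply Rmult_le_reg_r with (2 * u); [lra|].
    replace ((a x + b x) / (2 * u) * (2 * u)) with (a x + b x) by (field; lra). lra. }
  assert (Hu : 0 < u) by lra.
  assert (Iu : 0 < / u) by now apply Rinv_0_lt_compat.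
  assert (Eu : (a x + b x) / (2 * u) = / u * ((a x + b x) / 2)) by (field; lra). rewrite Eu in HuN.
  assert (H3 : / u * b x <= / u * (2 * a x)) by (apply Rmult_le_compat_l; lra).
  assert (Bf' : Rabs (2 * (a1 * f1 + a2 * f2)) <= g x * (/ u * (5 / 2 * a x))).
  { eapply Rle_trans; [exact Bf|]. apply Rmult_le_compat_l; auto. unfold Rdiv in *; lra. }
  assert (Bg' : Rabs (2 * (b1 * g1 + b2 * g2)) <= g x * (/ u * (7 / 2 * a x))).
  { eapply Rle_trans; [exact Bg|]. apply Rmult_le_compat_l; auto. unfold Rdiv in *; lra. }
  assert (Hb0 : 0 <= b x) by (rewrite Eb; nra).
  eexists; split.
  - unfold F. apply derP; [apply derM; [exact Db|apply derV; [lra|exact Da]]|].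
    eapply derM; [apply derC|exact HPx].
  - set (al := 2 * (a1 * f1 + a2 * f2)) in *. set (be := 2 * (b1 * g1 + b2 * g2)) in *.
    apply Rabs_le_between in Bf', Bg'.
    set (sg := b x * / a x).
    assert (Esg : b x = sg * a x) by (unfold sg; field; lra).
    assert (Hsg : 0 <= sg <= 2).
    { split; [apply Rmult_le_pos; auto; left; now apply Rinv_0_lt_compat|].
      apply Rmult_le_reg_r with (a x); auto. lra. }
    apply Rle_trans with (4 * w * sg + be * / a x - sg * (al * / a x) + 9 / kmin * g x);
      [|right; unfold sg; cbv beta; field; lra].
    assert (Hal : al * / a x <= g x * / u * (5 / 2)).
    { apply Rmult_le_reg_r with (a x); auto. rewrite Rmult_assoc, Rinv_l by lra. lra. }
    assert (Hbe : - (g x * / u * (7 / 2)) <= be * / a x).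
    { apply Rmult_le_reg_r with (a x); auto. rewrite (Rmult_assoc be), Rinv_l by lra. lra. }
    assert (Hgu : 0 <= g x * / u) by (apply Rmult_le_pos; lra).
    assert (Hsal : sg * (al * / a x) <= g x * / u * 5).
    { apply Rle_trans with (sg * (g x * / u * (5 / 2))); [apply Rmult_le_compat_l; lra|nra]. }
    assert (Hguk : g x * / u <= g x * / kmin).
    { apply Rmult_le_compat_l; auto. apply Rinv_le_contravar; lra. }
    assert (kap * sg <= w * sg) by (apply Rmult_le_compat_r; lra).
    unfold Rdiv. lra. }
apply Rnot_lt_le; intros Hlt.
set (c := 9 / kmin) in *. assert (Hc : 0 < c) by (apply Rdiv_lt_0_compat; lra).
destruct (Hab X (Rle_refl _)) as (HaX & _).
set (dl := b X * / a X - c * G).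
assert (Hdl : 0 < dl).
{ unfold dl. assert (c * G < b X * / a X); [|lra]. apply Rmult_lt_reg_r with (a X); auto.
  rewrite (Rmult_assoc (b X)), Rinv_l; lra. }
assert (Hsig : forall x, X <= x -> 0 <= b x * / a x <= 2).
{ intros x Hx; destruct (Hab x Hx) as (H1 & H2). split.
  - apply Rmult_le_pos; [apply Rplus_le_le_0_compat; apply pow2_ge_0|left; now apply Rinv_0_lt_compat].
  - apply Rmult_le_reg_r with (a x); auto. rewrite Rmult_assoc, Rinv_l; lra. }
assert (HFX : F X = dl + c * G) by (unfold F, dl; rewrite Pg0; ring).
assert (Hinc : forall x, X <= x -> dl <= b x * / a x).
{ intros x Hx. assert (F X <= F x).
  { apply der_incr; auto. intros t Ht. destruct (HF t ltac:(lra)) as (l & Hl & Hle). exists l; split; auto.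
    specialize (Hsig t ltac:(lra)). nra. }
  unfold F at 2 in H. specialize (HPG x Hx). nra. }
(* If the claim fails by [dl], the quotient stays above [dl] and [F] grows at least at rate
   [4 * kap * dl]; over this distance it gains [3 + c * G], more than its upper bound
   [2 + c * G]. *)
set (x := X + (3 + c * G) / (4 * kap * dl)).
assert (Hkd : 0 < 4 * kap * dl) by (apply Rmult_lt_0_compat; lra).
assert (Hx : X <= x).
{ unfold x. assert (0 <= (3 + c * G) / (4 * kap * dl)) by (apply Rdiv_le_0_compat; nra). lra. }
assert (HFx : F X - 4 * kap * dl * X <= F x - 4 * kap * dl * x).
{ apply (der_incr (fun t => F t - 4 * kap * dl * t)); auto. intros t Ht.
  destruct (HF t ltac:(lra)) as (l & Hl & Hle). eexists; split; [der idtac|].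
  specialize (Hinc t ltac:(lra)). cbv beta. nra. }
assert (4 * kap * dl * x = 4 * kap * dl * X + (3 + c * G)) by (unfold x; field; lra).
specialize (HPG x Hx). specialize (Hsig x Hx). rewrite HFX in HFx. unfold F in HFx. nra.
Qed.

End Cone.

(** Membership in a thin cone says [y'] is close to [i k0 y]. At the limiting coefficients the form
    is [/ k0 * |y' - i k0 y|^2], a small multiple of [|y|^2], while [Im (conj y y')] is about
    [k0 |y|^2]. The bound is relative to the latter because this quantity decreases in [x] and
    starts at [Im m_A]. *)
Lemma cone_close k0 eta : 0 < k0 -> 0 < eta -> exists nu, 0 < nu /\
  forall y1 y2 z1 z2 k1 k2 P Q R,
  Rabs (k1 - k0) <= nu -> Rabs k2 <= nu -> Rabs (P - k0) <= nu -> Rabs Q <= nu -> Rabs (R - / k0) <= nu ->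
  sqM k1 k2 y1 y2 z1 z2 <= nu * sqP k1 k2 y1 y2 z1 z2 ->
  P * (y1 ^ 2 + y2 ^ 2) + Q * (y1 * z1 + y2 * z2) + R * (z1 ^ 2 + z2 ^ 2) - 2 * (y1 * z2 - y2 * z1)
    <= eta * (y1 * z2 - y2 * z1).
Proof.
intros Hk He.
(* [nu * C1] will bound [|y' - i k0 y|^2] and [nu * C2] the whole form, both relative to [|y|^2]. *)
set (C1 := 64 * (k0 + 1) ^ 2 + 4). set (C2 := C1 * / k0 + 3 / 2 * (1 + 2 * C1 + 2 * k0 ^ 2)).
assert (Hik : 0 < / k0) by now apply Rinv_0_lt_compat.
assert (HC1 : 4 <= C1) by (unfold C1; sq_ge0 (k0 + 1); lra).
assert (HC2 : 0 < C2).
{ unfold C2. assert (0 < C1 * / k0) by (apply Rmult_lt_0_compat; lra). sq_ge0 k0. lra. }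
set (nu := Rmin (/ 4) (Rmin (k0 ^ 2 / (2 * C1)) (eta * k0 / (4 * C2)))).
assert (Hk2 : 0 < k0 ^ 2) by (apply pow_lt; lra).
assert (Hnu : 0 < nu).
{ repeat apply Rmin_pos; [lra| |]; apply Rdiv_lt_0_compat; nra. }
assert (N1 : nu <= / 4) by apply Rmin_l.
assert (N2 : nu * C1 <= k0 ^ 2 / 2).
{ apply Rle_trans with (k0 ^ 2 / (2 * C1) * C1); [|right; field; lra].
  apply Rmult_le_compat_r; [lra|]. unfold nu; eapply Rle_trans; [apply Rmin_r|apply Rmin_l]. }
assert (N3 : nu * C2 * 4 <= eta * k0).
{ apply Rle_trans with (eta * k0 / (4 * C2) * (C2 * 4)); [|right; field; lra]. rewrite Rmult_assoc.
  apply Rmult_le_compat_r; [lra|]. unfold nu; eapply Rle_trans; [apply Rmin_r|apply Rmin_r]. }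
exists nu; split; auto. intros y1 y2 z1 z2 k1 k2 P Q R H1 H2 H3 H4 H5 Hb.
set (N := y1 ^ 2 + y2 ^ 2). set (Z := z1 ^ 2 + z2 ^ 2). set (J := y1 * z2 - y2 * z1). set (C := y1 * z1 + y2 * z2).
set (S := (z1 + k0 * y2) ^ 2 + (z2 - k0 * y1) ^ 2).
assert (HN : 0 <= N) by (apply Rplus_le_le_0_compat; apply pow2_ge_0). assert (HZ : 0 <= Z) by (apply Rplus_le_le_0_compat; apply pow2_ge_0).
set (SB := sqM k1 k2 y1 y2 z1 z2) in *. set (SA := sqP k1 k2 y1 y2 z1 z2) in *.
assert (HSB : 0 <= SB) by (apply Rplus_le_le_0_compat; apply pow2_ge_0).
apply Rabs_le_between in H1, H2, H3, H4, H5.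
set (m := k1 ^ 2 + k2 ^ 2).
assert (Hm : m <= 2 * (k0 + 1) ^ 2).
{ unfold m. assert (k1 ^ 2 <= (k0 + 1) ^ 2) by nra. assert (k2 ^ 2 <= 1) by nra.
  assert (1 <= (k0 + 1) ^ 2) by nra. lra. }
assert (HA : SA <= 2 * SB + 8 * (m * N)).
{ assert (E : 2 * SB + 8 * (m * N) - SA = (z1 + 3 * (k1 * y2 + k2 * y1)) ^ 2 + (z2 - 3 * (k1 * y1 - k2 * y2)) ^ 2)
    by (unfold SA, SB, sqM, sqP, m, N; ring).
  sq_ge0 (z1 + 3 * (k1 * y2 + k2 * y1)); sq_ge0 (z2 - 3 * (k1 * y1 - k2 * y2)). lra. }
assert (HmN : m * N <= 2 * (k0 + 1) ^ 2 * N) by (apply Rmult_le_compat_r; auto).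
assert (HB : SB <= 32 * nu * (k0 + 1) ^ 2 * N).
{ assert (nu * SA <= nu * (2 * SB + 8 * (m * N))) by (apply Rmult_le_compat_l; lra).
  assert (nu * SB <= / 4 * SB) by (apply Rmult_le_compat_r; lra).
  assert (nu * (m * N) <= nu * (2 * (k0 + 1) ^ 2 * N)) by (apply Rmult_le_compat_l; lra). lra. }
assert (HS : S <= nu * C1 * N).
{ assert (HS1 : S <= 2 * SB + 2 * (((k1 - k0) ^ 2 + k2 ^ 2) * N)).
  { assert (E : 2 * SB + 2 * (((k1 - k0) ^ 2 + k2 ^ 2) * N) - S =
      (z1 + k0 * y2 + 2 * ((k1 - k0) * y2 + k2 * y1)) ^ 2 + (z2 - k0 * y1 - 2 * ((k1 - k0) * y1 - k2 * y2)) ^ 2)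
      by (unfold SB, S, sqM, N; ring).
    sq_ge0 (z1 + k0 * y2 + 2 * ((k1 - k0) * y2 + k2 * y1)).
    sq_ge0 (z2 - k0 * y1 - 2 * ((k1 - k0) * y1 - k2 * y2)). lra. }
  assert (Hd : (k1 - k0) ^ 2 + k2 ^ 2 <= 2 * nu).
  { assert ((k1 - k0) ^ 2 <= nu ^ 2) by nra. assert (k2 ^ 2 <= nu ^ 2) by nra. nra. }
  assert (((k1 - k0) ^ 2 + k2 ^ 2) * N <= 2 * nu * N) by (apply Rmult_le_compat_r; auto).
  unfold C1. lra. }
assert (HS0 : 0 <= S) by (apply Rplus_le_le_0_compat; apply pow2_ge_0).
assert (HJ : k0 * N / 4 <= J).
{ assert (E : 2 * k0 * (J - k0 * N / 2) + S = (k0 * y1 + (z2 - k0 * y1)) ^ 2 + (k0 * y2 - (z1 + k0 * y2)) ^ 2)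
    by (unfold J, N, S; field).
  sq_ge0 (k0 * y1 + (z2 - k0 * y1)); sq_ge0 (k0 * y2 - (z1 + k0 * y2)).
  assert (nu * C1 * N <= k0 ^ 2 / 2 * N) by (apply Rmult_le_compat_r; auto).
  apply Rmult_le_reg_l with (2 * k0); [lra|]. lra. }
assert (HZ2 : Z <= (2 * C1 + 2 * k0 ^ 2) * N).
{ assert (E : 2 * S + 2 * k0 ^ 2 * N - Z = (z1 + 2 * k0 * y2) ^ 2 + (z2 - 2 * k0 * y1) ^ 2) by (unfold S, N, Z; ring).
  sq_ge0 (z1 + 2 * k0 * y2); sq_ge0 (z2 - 2 * k0 * y1).
  assert (nu * (C1 * N) <= 1 * (C1 * N)) by (apply Rmult_le_compat_r; [apply Rmult_le_pos|]; lra). lra. }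
assert (HC : Rabs C <= (N + Z) / 2).
{ apply Rabs_le; unfold C, N, Z.
  sq_ge0 (y1 + z1); sq_ge0 (y2 + z2).
  sq_ge0 (y1 - z1); sq_ge0 (y2 - z2). split; lra. }
assert (HQC : Q * C <= nu * ((N + Z) / 2)).
{ eapply Rle_trans; [apply Rle_abs|]. rewrite Rabs_mult. apply Rmult_le_compat; auto; try apply Rabs_pos. apply Rabs_le; lra. }
assert (HP : (P - k0) * N <= nu * N) by (apply Rmult_le_compat_r; lra).
assert (HR : (R - / k0) * Z <= nu * Z) by (apply Rmult_le_compat_r; lra).
assert (E0 : k0 * N + / k0 * Z - 2 * J = / k0 * S) by (unfold S, N, Z, J; field; lra).
assert (HkS : / k0 * S <= / k0 * (nu * C1 * N)) by (apply Rmult_le_compat_l; lra).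
assert (HnZ : nu * Z <= nu * ((2 * C1 + 2 * k0 ^ 2) * N)) by (apply Rmult_le_compat_l; lra).
assert (HD : P * N + Q * C + R * Z - 2 * J <= nu * C2 * N) by (unfold C2; lra).
assert (HnJ : nu * C2 * 4 * (k0 * N / 4) <= eta * k0 * J).
{ apply Rle_trans with (nu * C2 * 4 * J); [apply Rmult_le_compat_l; [nra|auto]|].
  apply Rmult_le_compat_r; [nra|auto]. }
apply Rle_trans with (nu * C2 * N); auto.
apply Rmult_le_reg_l with k0; auto. lra.
Qed.

(* real part of the principal square root of [r + i eps] *)
Definition csq (eps r : R) : R := sqrt ((r + sqrt (r ^ 2 + eps ^ 2)) / 2).

Lemma csq_props eps r : 0 < eps -> 0 < csq eps r /\
  csq eps r ^ 2 - (eps / (2 * csq eps r)) ^ 2 = r /\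
  r <= csq eps r ^ 2 <= Rabs r + eps / 2.
Proof.
intros He. set (m := sqrt (r ^ 2 + eps ^ 2)).
assert (Hm2 : m ^ 2 = r ^ 2 + eps ^ 2) by (unfold m; apply pow2_sqrt; nra).
assert (Hm0 : 0 <= m) by apply sqrt_pos.
assert (Hm : Rabs r < m).
{ apply Rsqr_incrst_0; auto; [|apply Rabs_pos]. rewrite <- Rsqr_abs. unfold Rsqr. nra. }
assert (Hrm : - m < r < m) by (apply Rabs_def2 in Hm; lra).
assert (Hk2 : csq eps r ^ 2 = (r + m) / 2) by (unfold csq; apply pow2_sqrt; fold m; lra).
assert (Hk : 0 < csq eps r) by (unfold csq; apply sqrt_lt_R0; fold m; lra).
split; auto; split.
- replace ((eps / (2 * csq eps r)) ^ 2) with (eps ^ 2 / (4 * csq eps r ^ 2)) by (field; lra).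
  rewrite Hk2. replace (eps ^ 2) with ((m - r) * (m + r)) by (replace (eps ^ 2) with (m ^ 2 - r ^ 2) by lra; ring).
  field; lra.
- rewrite Hk2; split; [lra|].
  assert (m <= Rabs r + eps).
  { abs_ge0 r. apply Rsqr_incr_0; [|lra|lra]. unfold Rsqr.
    assert (Rabs r * Rabs r = r ^ 2) by (rewrite <- Rabs_mult, Rabs_right; [ring|apply Rle_ge, Rle_0_sqr]). nra. }
  pose proof (Rle_abs r); lra.
Qed.

(** The bound does not involve [eps] beyond [csq eps r] itself, so it stays uniform as the energy
    approaches the real axis. *)
Lemma csq_derive eps r : 0 < eps -> exists l : R, is_derive (csq eps) r l /\ Rabs l <= / (2 * csq eps r).
Proof.
intros He. destruct (csq_props eps r He) as (Hk & _).
set (m := sqrt (r ^ 2 + eps ^ 2)).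
assert (Hm2 : m ^ 2 = r ^ 2 + eps ^ 2) by (unfold m; apply pow2_sqrt; nra).
assert (Hm : Rabs r < m).
{ apply Rsqr_incrst_0; [|apply Rabs_pos|apply sqrt_pos]. rewrite <- Rsqr_abs. unfold Rsqr. nra. }
assert (Hrm : - m < r < m) by (apply Rabs_def2 in Hm; lra).
assert (Hm0 : 0 < m) by lra.
exists ((1 + r / m) / 2 * / (2 * csq eps r)); split.
- unfold csq. auto_derive.
  + split; [nra|]. split; auto. fold (csq eps r).
    replace (r * (r * 1) + eps * (eps * 1)) with (r ^ 2 + eps ^ 2) by ring. fold m. lra.
  + replace (r * (r * 1) + eps * (eps * 1)) with (r ^ 2 + eps ^ 2) by ring. fold m.
    fold (csq eps r). replace ((r + m) * / 2) with ((r + m) / 2) by (unfold Rdiv; ring).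
    change (sqrt ((r + m) / 2)) with (csq eps r). field. lra.
- rewrite Rabs_mult, (Rabs_right (/ (2 * csq eps r))) by (left; apply Rinv_0_lt_compat; lra).
  rewrite <- (Rmult_1_l (/ (2 * csq eps r))) at 2.
  apply Rmult_le_compat_r; [left; apply Rinv_0_lt_compat; lra|].
  assert (-1 <= r / m <= 1).
  { split; apply Rmult_le_reg_r with m; auto; unfold Rdiv; rewrite (Rmult_assoc r), Rinv_l; lra. }
  apply Rabs_le; lra.
Qed.

Section BoundaryValues.
Variables (q : R -> R) (A : R).
Hypothesis qC : forall x, A <= x -> continuous q x.
(* [q] splits as [s0 + (q - s0)] with [s0 -> 0], [s0'] integrable, [q - s0] integrable at infinity:
   [s0 = 0] in case (a), [s0 = q] in case (b). *)
Hypothesis q_asym : exists x1 (s0 ds : R -> R),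
  (forall x, x1 <= x -> is_derive s0 x (ds x) /\ continuous ds x) /\
  (forall e, 0 < e -> exists X, forall x, X <= x -> Rabs (s0 x) <= e) /\
  (forall e, 0 < e -> exists X, forall a b, X <= a -> a <= b ->
     RInt (fun x => Rabs (q x - s0 x) + Rabs (ds x)) a b <= e).

(** [X] is fixed before [mu] and [eps], so the estimate is uniform down to the real axis. This works
    because the conclusion of [cone] contains only the integral of [g] beyond [X], and not the lower
    bound [kap] of [k2], which degenerates with [eps]. *)
Lemma weyl_far lam0 (P Q Rf : R -> R) eta : 0 < lam0 -> 0 < eta ->
  (forall e, 0 < e -> exists X, forall x, X <= x ->
     Rabs (P x - sqrt lam0) <= e /\ Rabs (Q x) <= e /\ Rabs (Rf x - / sqrt lam0) <= e) ->
  exists X rho, A <= X /\ 0 < rho /\ forall mu eps p h s,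
    Rabs (mu - lam0) < rho -> 0 < eps < rho -> weyl q A mu eps p h s ->
    P X * sqY s X + Q X * reYZ s X + Rf X * sqZ s X - 2 * imYZ s X <= eta * imYZ s X.
Proof.
intros Hl0 Heta HU. set (k0 := sqrt lam0) in *.
assert (Hk0 : 0 < k0) by now apply sqrt_lt_R0.
assert (Hk02 : k0 ^ 2 = lam0) by (unfold k0; apply pow2_sqrt; lra).
destruct (cone_close k0 eta Hk0 Heta) as (nu & Hnu & Hclose).
destruct q_asym as (x1 & s0 & ds & Hs0 & Hs0l & Htail).
set (kmin := sqrt (lam0 / 2)). assert (Hkm : 0 < kmin) by (apply sqrt_lt_R0; lra).
assert (Hkm2 : kmin ^ 2 = lam0 / 2) by (unfold kmin; apply pow2_sqrt; lra).
(* [csq_derive] and [k2 <= k1] bound [|k1'| + |k2'|] by [/ kmin * |ds|], so [c] times the integrand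
   of [q_asym] dominates the perturbation in [cone]. *)
set (c := 1 + / kmin). assert (Hikm : 0 < / kmin) by now apply Rinv_0_lt_compat.
assert (Hc : 1 < c) by (unfold c; lra).
destruct (HU nu Hnu) as (Xu & HXu).
set (tau := Rmin (lam0 / 4) (nu * k0 / 4)).
assert (Htau : 0 < tau) by (apply Rmin_pos; [lra|]; apply Rdiv_lt_0_compat; [nra|lra]).
assert (Ht1 : tau <= lam0 / 4) by apply Rmin_l. assert (Ht2 : tau <= nu * k0 / 4) by apply Rmin_r.
destruct (Hs0l tau Htau) as (Xs & HXs).
(* The tail size for which the factor [9 / kmin * G] of [cone] becomes exactly [nu]. *)
assert (He9 : 0 < nu * kmin / (9 * c)) by (apply Rdiv_lt_0_compat; nra).
destruct (Htail _ He9) as (Xt & HXt).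
set (X := Rmax (Rmax A x1) (Rmax Xu (Rmax Xs Xt))).
assert (HX : A <= X /\ x1 <= X /\ Xu <= X /\ Xs <= X /\ Xt <= X).
{ unfold X. max_ge (Rmax A x1) (Rmax Xu (Rmax Xs Xt)).
  max_ge A x1; max_ge Xu (Rmax Xs Xt).
  max_ge Xs Xt. lra. }
destruct HX as (XA & X1 & XU & XS & XT).
set (rho := Rmin (Rmin 1 (lam0 / 4)) (Rmin (nu * k0 / 4) (2 * kmin * nu))).
assert (Hrho : 0 < rho).
{ repeat apply Rmin_pos; try lra; nra. }
assert (HR : rho <= 1 /\ rho <= lam0 / 4 /\ rho <= nu * k0 / 4 /\ rho <= 2 * kmin * nu).
{ unfold rho. min_le (Rmin 1 (lam0 / 4)) (Rmin (nu * k0 / 4) (2 * kmin * nu)).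
  min_le 1 (lam0 / 4).
  min_le (nu * k0 / 4) (2 * kmin * nu). lra. }
destruct HR as (R1 & R2 & R3 & R4).
exists X, rho; split; [auto|split; [auto|]].
intros mu eps p h s Hmu Heps W. apply Rabs_def2 in Hmu.
set (r := fun x => mu - s0 x). set (k1 := fun x => csq eps (r x)). set (k2 := fun x => eps / (2 * k1 x)).
assert (He : 0 < eps) by lra.
assert (Hr : forall x, X <= x -> lam0 / 2 <= r x <= 3 / 2 * lam0 /\ Rabs (r x - lam0) <= nu * k0 / 2).
{ intros x Hx. specialize (HXs x ltac:(lra)). apply Rabs_le_between in HXs. unfold r. split; [lra|].
  apply Rabs_le; lra. }
assert (Hkp : forall x, X <= x -> kmin <= k1 x /\ k1 x <= lam0 + 1 /\ 3 * k2 x <= k1 x /\ k2 x <= nu /\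
   k1 x ^ 2 - k2 x ^ 2 = r x /\ 2 * k1 x * k2 x = eps /\ 0 < k2 x /\ k2 x <= eps / (2 * kmin)).
{ intros x Hx. destruct (Hr x Hx) as (Hrx & _). destruct (csq_props eps (r x) He) as (Hk & Hd & Hb).
  fold (k1 x) in Hk, Hd, Hb. fold (k2 x) in Hd. rewrite (Rabs_right (r x)) in Hb by lra.
  assert (Hkk : kmin <= k1 x) by (apply Rsqr_incr_0; unfold Rsqr; nra).
  assert (Hik : / (2 * k1 x) <= / (2 * kmin)) by (apply Rinv_le_contravar; lra).
  assert (Hk2le : k2 x <= eps / (2 * kmin)) by (unfold k2, Rdiv; apply Rmult_le_compat_l; lra).
  split; [auto|split; [|split; [|split; [|split; [auto|split; [|split]]]]]]; auto.
  - apply Rsqr_incr_0; unfold Rsqr; nra.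
  - unfold k2. apply Rmult_le_reg_r with (2 * k1 x); [lra|].
    replace (3 * (eps / (2 * k1 x)) * (2 * k1 x)) with (3 * eps) by (field; lra). nra.
  - eapply Rle_trans; [exact Hk2le|]. apply Rmult_le_reg_r with (2 * kmin); [lra|].
    replace (eps / (2 * kmin) * (2 * kmin)) with eps by (field; lra). lra.
  - unfold k2; field; lra.
  - unfold k2; apply Rdiv_lt_0_compat; lra. }
assert (Hder : forall x, exists l : R * R, X <= x -> is_derive k1 x (fst l) /\ is_derive k2 x (snd l) /\
   Rabs (fst l) + Rabs (snd l) <= / kmin * Rabs (ds x)).
{ intros x. destruct (Rle_dec X x) as [Hx|Hn]; [|exists (0, 0); intros; contradiction].
  destruct (csq_derive eps (r x) He) as (l & Hl & Hlb). fold (k1 x) in Hlb.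
  destruct (Hs0 x ltac:(lra)) as (Hds & _).
  destruct (Hkp x Hx) as (K1 & _ & K3 & _ & _ & _ & K7 & _).
  assert (Dk1 : is_derive k1 x (- ds x * l)).
  { eapply is_derive_eq.
    - apply (is_derive_comp (csq eps) r); [exact Hl|]. unfold r. der idtac.
    - unfold scal; simpl; unfold mult; simpl. ring. }
  exists (- ds x * l, - k2 x / k1 x * (- ds x * l)); intros _; simpl. split; [auto|split].
  - unfold k2 at 1. unfold Rdiv. eapply is_derive_eq.
    + eapply derM; [apply derC|]. apply derV; [|eapply derM; [apply derC|exact Dk1]]. cbv beta; lra.
    + cbv beta. unfold k2. field. lra.
  - rewrite (Rabs_mult (- k2 x / k1 x)).
    assert (Hq1 : Rabs (- k2 x / k1 x) <= 1).
    { apply Rabs_le; split; apply Rmult_le_reg_r with (k1 x); try lra;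
      replace (- k2 x / k1 x * k1 x) with (- k2 x) by (field; lra); lra. }
    assert (Hdl : Rabs (- ds x * l) <= / (2 * kmin) * Rabs (ds x)).
    { rewrite Rabs_mult, Rabs_Ropp, Rmult_comm. apply Rmult_le_compat_r; [apply Rabs_pos|].
      eapply Rle_trans; [exact Hlb|]. apply Rinv_le_contravar; lra. }
    assert (E : / (2 * kmin) * Rabs (ds x) + / (2 * kmin) * Rabs (ds x) = / kmin * Rabs (ds x)) by (field; lra).
    abs_ge0 (- ds x * l). abs_ge0 (- k2 x / k1 x). nra. }
set (dk := fun x => proj1_sig (constructive_indefinite_description _ (Hder x))).
assert (Hdk : forall x, X <= x -> is_derive k1 x (fst (dk x)) /\ is_derive k2 x (snd (dk x)) /\
   Rabs (fst (dk x)) + Rabs (snd (dk x)) <= / kmin * Rabs (ds x)).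
{ intros x; unfold dk; destruct (constructive_indefinite_description _ (Hder x)); auto. }
set (g0 := fun x => Rabs (q x - s0 x) + Rabs (ds x)).
assert (Hg0C : forall x, X <= x -> continuous g0 x).
{ intros x Hx. destruct (Hs0 x ltac:(lra)) as (D1 & D2). pose proof (der_cont _ _ _ D1). pose proof (qC x ltac:(lra)).
  unfold g0. cont idtac. }
assert (HJ := fun x => weyl_imYZ_nonneg q A _ _ _ _ _ x He W).
assert (S := proj1 W). destruct (proj1 (proj2 W)) as (I1 & I2 & I3 & I4).
assert (HE0 : 0 < energy s A).
{ unfold energy, sqY, sqZ. rewrite I1, I2. sq_ge0 (Z1 s A); sq_ge0 (Z2 s A). lra. }
assert (Hcone := cone q A qC mu eps s X k1 k2 (fun x => fst (dk x)) (fun x => snd (dk x)) s0 (fun x => c * g0 x)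
  (eps / (2 * (lam0 + 1))) kmin (c * (nu * kmin / (9 * c))) XA S HE0 HJ).
destruct (Hkp X (Rle_refl _)) as (K1 & K2 & K3 & K4 & K5 & K6 & K7 & K8).
destruct (HXu X XU) as (U1 & U2 & U3).
unfold sqY, sqZ, reYZ, imYZ. apply (Hclose _ _ _ _ (k1 X) (k2 X)); auto.
- destruct (Hr X (Rle_refl _)) as (_ & Hrl). apply Rabs_le_between in Hrl.
  assert (Hk22 : k2 X ^ 2 <= nu * k0 / 8).
  { assert (k2 X ^ 2 <= eps ^ 2 / (2 * lam0)).
    { apply Rle_trans with ((eps / (2 * kmin)) ^ 2); [apply pow_incr; lra|].
      replace ((eps / (2 * kmin)) ^ 2) with (eps ^ 2 / (4 * kmin ^ 2)) by (field; lra). rewrite Hkm2. right; field; lra. }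
    assert (eps ^ 2 / (2 * lam0) <= eps / 8).
    { apply Rmult_le_reg_r with (2 * lam0); [lra|].
      replace (eps ^ 2 / (2 * lam0) * (2 * lam0)) with (eps ^ 2) by (field; lra). nra. }
    lra. }
  sq_ge0 (k2 X).
  assert (E : (k1 X - k0) * (k1 X + k0) = r X - lam0 + k2 X ^ 2) by (rewrite <- Hk02, <- K5; ring).
  apply Rabs_le; split; nra.
- rewrite Rabs_right by lra. exact K4.
- eapply Rle_trans; [apply Hcone|].
  + apply Rdiv_lt_0_compat; lra.
  + auto.
  + intros x Hx; destruct (Hdk x Hx) as (D1 & D2 & _); auto.
  + intros x Hx; destruct (Hkp x Hx) as (_ & _ & _ & _ & E1 & E2 & _); auto.
  + intros x Hx. destruct (Hkp x Hx) as (G1 & G2 & G3 & _). split; [auto|split; auto].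
    unfold k2, Rdiv. apply Rmult_le_compat_l; [lra|]. apply Rinv_le_contravar; lra.
  + intros x Hx. split; [specialize (Hg0C x Hx); cont idtac|].
    destruct (Hdk x Hx) as (_ & _ & D3). unfold g0, c.
    abs_ge0 (q x - s0 x). abs_ge0 (ds x).
    assert (0 <= / kmin * Rabs (q x - s0 x)) by (apply Rmult_le_pos; lra). lra.
  + intros Y HY. rewrite (RInt_from_scal g0 X) by (auto; lra).
    apply Rmult_le_compat_l; [lra|]. apply HXt; lra.
  + apply Rmult_le_compat_r; [apply Rplus_le_le_0_compat; apply pow2_ge_0|]. right; field; lra.
Qed.

Section Appell.
Variables (lam0 : R) (P Q Rf : R -> R).
Hypothesis lam0_pos : 0 < lam0.
Hypothesis Appell_der : forall x, A <= x -> is_derive P x ((lam0 - q x) * Q x) /\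
  is_derive Q x (-2 * P x + 2 * (lam0 - q x) * Rf x) /\ is_derive Rf x (- Q x).
Hypothesis P_lim : filterlim P (Rbar_locally p_infty) (locally (sqrt lam0)).
Hypothesis Q_lim : filterlim Q (Rbar_locally p_infty) (locally 0).
Hypothesis R_lim : filterlim Rf (Rbar_locally p_infty) (locally (/ sqrt lam0)).

Lemma Appell_discriminant x : A <= x -> 4 * P x * Rf x - Q x ^ 2 = 4.
Proof.
intros Hx.
assert (Hk : 0 < sqrt lam0) by now apply sqrt_lt_R0.
set (D := fun x => 4 * P x * Rf x - Q x ^ 2). change (D x = 4).
assert (Hc : forall y, A <= y -> D y = D A).
{ intros y Hy. apply der_zero; auto. intros t Ht.
  destruct (Appell_der t ltac:(lra)) as (H1 & H2 & H3).
  unfold D. eapply is_derive_eq; [der idtac|cbv beta; ring]. }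
assert (HP : is_lim P p_infty (sqrt lam0)) by exact P_lim.
assert (HQ : is_lim Q p_infty 0) by exact Q_lim.
assert (HR : is_lim Rf p_infty (/ sqrt lam0)) by exact R_lim.
assert (HD : is_lim D p_infty (Finite 4)).
{ replace 4 with (4 * (sqrt lam0 * / sqrt lam0) - 0 * 0) by (field; lra).
  apply is_lim_ext with (fun x => 4 * (P x * Rf x) - Q x * Q x); [intros; unfold D; ring|].
  apply is_lim_minus'; [|apply (is_lim_mult Q Q p_infty 0 0); easy].
  apply (is_lim_scal_l (fun x => P x * Rf x) 4 p_infty (sqrt lam0 * / sqrt lam0)).
  apply (is_lim_mult P Rf p_infty (sqrt lam0) (/ sqrt lam0)); easy. }
assert (HD' : is_lim D p_infty (Finite (D A))).
{ apply is_lim_ext_loc with (fun _ => D A); [|apply is_lim_const].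
  exists A; intros y Hy; symmetry; apply Hc; lra. }
apply is_lim_unique in HD. apply is_lim_unique in HD'. rewrite HD in HD'. injection HD' as E.
rewrite Hc; auto.
Qed.

Lemma Appell_limits e : 0 < e -> exists X, forall x, X <= x ->
  Rabs (P x - sqrt lam0) <= e /\ Rabs (Q x) <= e /\ Rabs (Rf x - / sqrt lam0) <= e.
Proof.
intros He.
assert (Hgen : forall (f : R -> R) l, filterlim f (Rbar_locally p_infty) (locally l) ->
  exists X, forall x, X < x -> Rabs (f x - l) < e).
{ intros f l Hf. apply (Hf (fun y => Rabs (y - l) < e)). exists (mkposreal e He); intros y Hy; exact Hy. }
destruct (Hgen P _ P_lim) as (X1 & H1). destruct (Hgen Q _ Q_lim) as (X2 & H2). destruct (Hgen Rf _ R_lim) as (X3 & H3).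
exists (Rmax X1 (Rmax X2 X3) + 1); intros x Hx.
max_ge X1 (Rmax X2 X3).
max_ge X2 X3.
specialize (H1 x ltac:(lra)); specialize (H2 x ltac:(lra)); specialize (H3 x ltac:(lra)).
rewrite Rminus_0_r in H2. lra.
Qed.

(** A zero of [Rf] would give [- Q x ^ 2 = 4] in the discriminant, so the positive sign at infinity
    persists down to [A]. *)
Lemma Appell_R_pos x : A <= x -> 0 < Rf x.
Proof.
intros Hx. apply Rnot_le_lt; intros Hle.
assert (Hk : 0 < / sqrt lam0) by (apply Rinv_0_lt_compat; now apply sqrt_lt_R0).
destruct (Appell_limits (/ sqrt lam0 / 2)) as (X & HX); [lra|].
set (y := Rmax X x + 1). max_ge X x.
destruct (HX y ltac:(unfold y; lra)) as (_ & _ & HR). apply Rabs_le_between in HR.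
assert (Hnz : forall t, A <= t -> Rf t <> 0).
{ intros t Ht E. pose proof (Appell_discriminant t Ht) as D. rewrite E in D. sq_ge0 (Q t); lra. }
assert (HRx : Rf x < 0) by (specialize (Hnz x Hx); lra).
destruct (Ranalysis5.IVT_interv Rf x y) as (z & Hz & E).
- intros t Ht. apply continuity_pt_filterlim. eapply der_cont.
  destruct (Appell_der t ltac:(lra)) as (_ & _ & H3). exact H3.
- unfold y; lra.
- exact HRx.
- lra.
- apply (Hnz z); auto; lra.
Qed.

(* The Hermitian form [D = P |y|^2 + Q Re(conj y y') + Rf |y'|^2 - 2 Im(conj y y') = Rf |y' - w y|^2],
   with [w = (- Q/2 + i)/Rf], is conserved at [lambda = lam0] and small far out, by [weyl_far]. *)
Theorem weyl_boundary_value th : 0 < th -> exists rho, 0 < rho /\ forall mu eps p h s,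
  Rabs (mu - lam0) < rho -> 0 < eps < rho -> weyl q A mu eps p h s ->
  Rabs (p - - Q A / (2 * Rf A)) <= th /\ Rabs (h - / Rf A) <= th.
Proof.
intros Hth.
set (p0 := - Q A / (2 * Rf A)). set (h0 := / Rf A).
assert (HRA : 0 < Rf A) by (apply Appell_R_pos; lra).
set (w2 := p0 ^ 2 + h0 ^ 2). assert (Hw2 : 0 <= w2) by (unfold w2; nra).
(* The argument ends with [Rf A * T <= kap * (1 + 2 * w2 + 2 * T)], where [T = |m - w(A)|^2]. The
   first bound on [kap] absorbs the [T] on the right, the second leaves [T <= th ^ 2]. *)
set (kap := Rmin (Rf A / 4) (Rf A * th ^ 2 / (2 * (1 + 2 * w2)))).
assert (Hth2 : 0 < th ^ 2) by (apply pow_lt; lra).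
assert (Hkap : 0 < kap) by (apply Rmin_pos; [lra|]; apply Rdiv_lt_0_compat; nra).
assert (Hk1 : kap <= Rf A / 4) by apply Rmin_l.
assert (Hk2 : kap * (1 + 2 * w2) <= Rf A * th ^ 2 / 2).
{ apply Rle_trans with (Rf A * th ^ 2 / (2 * (1 + 2 * w2)) * (1 + 2 * w2)); [|right; field; lra].
  apply Rmult_le_compat_r; [lra|apply Rmin_r]. }
destruct (weyl_far lam0 P Q Rf (kap / 2) lam0_pos ltac:(lra) Appell_limits) as (X & r1 & HX & Hr1 & Hfar).
destruct (q_bounded q A qC X HX) as (M & HM0 & HM).
destruct (bounded_on Q A X HX) as (BQ & HBQ0 & HBQ).
{ intros x Hx; eapply der_cont. destruct (Appell_der x ltac:(lra)) as (_ & H2 & _). exact H2. }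
destruct (bounded_on Rf A X HX) as (BR & HBR0 & HBR).
{ intros x Hx; eapply der_cont. destruct (Appell_der x ltac:(lra)) as (_ & _ & H3). exact H3. }
set (L := 1 + M + (Rabs lam0 + 1) + 1).
set (K := (BQ + 2 * BR + 2) * exp (L * (X - A)) * (X - A)).
assert (HK : 0 <= K).
{ apply Rmult_le_pos; [|lra]. apply Rmult_le_pos; [lra|left; apply exp_pos]. }
set (rho := Rmin (Rmin r1 1) (kap / (4 * (K + 1)))).
assert (Hrho : 0 < rho) by (repeat apply Rmin_pos; try lra; apply Rdiv_lt_0_compat; lra).
pose proof (Rmin_l (Rmin r1 1) (kap / (4 * (K + 1)))) as Q1; pose proof (Rmin_r (Rmin r1 1) (kap / (4 * (K + 1)))) as Q2.
pose proof (Rmin_l r1 1) as Q3; pose proof (Rmin_r r1 1) as Q4. fold rho in Q1, Q2.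
exists rho; split; auto. intros mu eps p h s Hmu Heps W.
assert (Hfar' := Hfar mu eps p h s ltac:(lra) ltac:(lra) W).
assert (He : 0 < eps) by lra. assert (S := proj1 W).
assert (HJA := weyl_imYZ_A q A mu eps p h s W). assert (Hh := weyl_h_nonneg q A mu eps p h s He W).
assert (HJX : imYZ s X <= h) by (rewrite <- HJA; apply (imYZ_decr q A mu eps); auto; lra).
destruct (proj1 (proj2 W)) as (I1 & I2 & I3 & I4).
set (B := 1 + p ^ 2 + h ^ 2).
assert (HEA : energy s A = B) by (unfold energy, sqY, sqZ, B; rewrite I1, I2, I3, I4; ring).
assert (HB : 1 <= B) by (unfold B; nra).
assert (HE : forall x, A <= x <= X -> energy s x <= B * exp (L * (X - A))).
{ intros x Hx. destruct (energy_growth q A mu eps s M x S ltac:(lra)) as (Hg & _).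
  { intros t Ht; apply HM; lra. }
  rewrite HEA in Hg. eapply Rle_trans; [exact Hg|]. apply Rmult_le_compat_l; [lra|].
  apply exp_nondecr. apply Rmult_le_compat; try lra.
  - abs_ge0 mu; abs_ge0 eps; lra.
  - unfold L. rewrite (Rabs_right eps) by lra.
    assert (Rabs mu <= Rabs lam0 + Rabs (mu - lam0)).
    { replace mu with (lam0 + (mu - lam0)) at 1 by ring. apply Rabs_triang. } lra. }
set (D := fun x => P x * sqY s x + Q x * reYZ s x + Rf x * sqZ s x - 2 * imYZ s x).
set (d := Rabs (mu - lam0) + eps).
set (c := d * (BQ + 2 * BR + 2) * (B * exp (L * (X - A)))).
assert (Hd0 : 0 < d) by (unfold d; abs_ge0 (mu - lam0); lra).
(* Off [lam0] the derivative of [D] gains terms bounded by [c] and the favourable [2 * eps * sqY],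
   so [D A <= D X + c * (X - A)]. As [X] is fixed, the last term is a small multiple of [B] once [d]
   is small. *)
assert (HDA : D A - - c * A <= D X - - c * X).
{ apply (der_incr (fun x => D x - - c * x)); auto. intros x Hx.
  destruct (Appell_der x ltac:(lra)) as (A1 & A2 & A3).
  pose proof (sqY_der q A mu eps s x S ltac:(lra)) as D1. pose proof (sqZ_der q A mu eps s x S ltac:(lra)) as D2.
  pose proof (reYZ_der q A mu eps s x S ltac:(lra)) as D3. pose proof (imYZ_der q A mu eps s x S ltac:(lra)) as D4.
  exists (- Q x * ((mu - lam0) * sqY s x) - 2 * Rf x * ((mu - lam0) * reYZ s x + eps * imYZ s x) + 2 * eps * sqY s x + c); split.
  - unfold D. eapply is_derive_eq; [der idtac|cbv beta; ring].
  - specialize (HBQ x Hx); specialize (HBR x Hx); specialize (HE x Hx).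
    pose proof (energy_nonneg s x) as En. pose proof (reYZ_le s x) as Er. pose proof (imYZ_le s x) as Ei.
    pose proof (sqY_nonneg s x) as Ey. pose proof (sqZ_nonneg s x) as Ez.
    assert (Eye : sqY s x <= energy s x) by (unfold energy; lra).
    set (E := energy s x) in *.
    assert (T1 : Rabs (- Q x * ((mu - lam0) * sqY s x)) <= BQ * (d * E)).
    { rewrite Rabs_mult, Rabs_Ropp. apply Rmult_le_compat; auto; try apply Rabs_pos.
      rewrite Rabs_mult, (Rabs_right (sqY s x)) by lra.
      apply Rmult_le_compat; auto; [apply Rabs_pos|unfold d; lra]. }
    assert (T2 : Rabs (2 * Rf x * ((mu - lam0) * reYZ s x + eps * imYZ s x)) <= 2 * BR * (d * E)).
    { rewrite Rabs_mult, (Rabs_mult 2), (Rabs_right 2) by lra.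
      apply Rmult_le_compat; try apply Rabs_pos; [abs_ge0 (Rf x); lra|lra|].
      eapply Rle_trans; [apply Rabs_triang|]. rewrite !Rabs_mult, (Rabs_right eps) by lra.
      assert (Rabs (mu - lam0) * Rabs (reYZ s x) <= Rabs (mu - lam0) * E) by (apply Rmult_le_compat_l; [apply Rabs_pos|lra]).
      assert (eps * Rabs (imYZ s x) <= eps * E) by (apply Rmult_le_compat_l; lra).
      unfold d; lra. }
    assert (T3 : 0 <= 2 * eps * sqY s x) by (apply Rmult_le_pos; lra).
    apply Rabs_le_between in T1, T2.
    assert (T4 : (BQ + 2 * BR + 2) * (d * E) <= c).
    { unfold c. replace (d * (BQ + 2 * BR + 2) * (B * exp (L * (X - A)))) with
        ((BQ + 2 * BR + 2) * (d * (B * exp (L * (X - A))))) by ring.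
      apply Rmult_le_compat_l; [lra|]. apply Rmult_le_compat_l; lra. }
    assert (0 <= d * E) by (apply Rmult_le_pos; lra). lra. }
assert (Hc : c * (X - A) = d * K * B) by (unfold c, K; ring).
assert (HdK : d * K <= kap / 2).
{ assert (Hd2 : d <= kap / (2 * (K + 1))).
  { unfold d. replace (kap / (2 * (K + 1))) with (kap / (4 * (K + 1)) + kap / (4 * (K + 1))) by (field; lra). lra. }
  apply Rle_trans with (d * (K + 1)); [nra|].
  apply Rle_trans with (kap / (2 * (K + 1)) * (K + 1)); [apply Rmult_le_compat_r; lra|right; field; lra]. }
(* Eliminating [P A] by the discriminant turns the form at [A] into the squared distance from [m] to
   [w(A)]. *)
assert (EDA : D A = Rf A * ((p - p0) ^ 2 + (h - h0) ^ 2)).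
{ unfold D, sqY, sqZ, reYZ, imYZ. rewrite I1, I2, I3, I4.
  pose proof (Appell_discriminant A ltac:(lra)) as Dis.
  assert (EP : P A = (4 + Q A ^ 2) / (4 * Rf A)) by (replace (4 + Q A ^ 2) with (4 * P A * Rf A) by lra; field; lra).
  rewrite EP. unfold p0, h0. field. lra. }
fold (D X) in Hfar'.
set (T := (p - p0) ^ 2 + (h - h0) ^ 2) in *.
assert (HBT : B <= 1 + 2 * w2 + 2 * T).
{ unfold B, T, w2. sq_ge0 (p - 2 * p0); sq_ge0 (h - 2 * h0). lra. }
assert (HhB : h <= B) by (unfold B; nra).
assert (HT : Rf A * T <= kap * B).
{ rewrite <- EDA. assert (kap / 2 * imYZ s X <= kap / 2 * B) by (apply Rmult_le_compat_l; lra).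
  assert (d * K * B <= kap / 2 * B) by (apply Rmult_le_compat_r; lra). lra. }
assert (HT2 : T <= th ^ 2).
{ assert (HT0 : 0 <= T) by (apply Rplus_le_le_0_compat; apply pow2_ge_0).
  assert (kap * B <= kap * (1 + 2 * w2 + 2 * T)) by (apply Rmult_le_compat_l; lra).
  assert (kap * T <= Rf A / 4 * T) by (apply Rmult_le_compat_r; lra).
  apply Rmult_le_reg_l with (Rf A); auto. lra. }
sq_ge0 (p - p0); sq_ge0 (h - h0).
split; rewrite <- (Rabs_right th) by lra; apply Rsqr_le_abs_0; unfold Rsqr; unfold T in HT2; simpl in *; lra.
Qed.

End Appell.
End BoundaryValues.

(** * Stieltjes inversion *)

Lemma at_right_0_lim (f : R -> R) l :
  (forall e, 0 < e -> exists r, 0 < r /\ forall y, 0 < y < r -> Rabs (f y - l) <= e) ->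
  filterlim f (at_right 0) (locally l).
Proof.
intros H P (e & HP). destruct (H (e / 2)) as (r & Hr & Hb); [pose proof (cond_pos e); lra|].
exists (mkposreal r Hr). intros y Hy Hy0. apply HP.
unball Hy; unball_goal.
apply Rabs_def2 in Hy. specialize (Hb y ltac:(lra)). unfold Rminus in Hb. pose proof (cond_pos e); lra.
Qed.

Lemma at_right_0_lim_inv (f : R -> R) l : filterlim f (at_right 0) (locally l) ->
  forall e, 0 < e -> exists r, 0 < r /\ forall y, 0 < y < r -> Rabs (f y - l) < e.
Proof.
intros H e He. destruct (H (fun z => Rabs (z - l) < e)) as (r & Hr).
{ exists (mkposreal e He); intros z Hz; exact Hz. }
exists r; split; [apply cond_pos|]. intros y Hy. apply Hr; [|lra].
unball_goal.
rewrite Ropp_0, Rplus_0_r, Rabs_right; lra.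
Qed.

Lemma lipschitz_limit_0 (f df : R -> R) (r M : R) : 0 < r ->
  (forall y, 0 < y < r -> is_derive f y (df y) /\ Rabs (df y) <= M) ->
  exists l, filterlim f (at_right 0) (locally l).
Proof.
intros Hr H.
assert (HM : 0 <= M) by (destruct (H (r / 2) ltac:(lra)) as (_ & Hb); abs_ge0 (df (r / 2)); lra).
apply (filterlim_locally_cauchy (U:=R_CompleteNormedModule)). intros e.
assert (Hd : 0 < Rmin r (e / (M + 1))) by (apply Rmin_pos; auto; apply Rdiv_lt_0_compat; [apply cond_pos|lra]).
exists (fun y => 0 < y < Rmin r (e / (M + 1))). split.
- exists (mkposreal _ Hd). intros y Hy Hy0.
  unball Hy.
  apply Rabs_def2 in Hy; lra.
- intros u v Hu Hv. min_le r (e / (M + 1)).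
  unball_goal.
  assert (Hb : Rabs (f v - f u) <= M * Rabs (v - u)).
  { apply (mvt_bound f df). intros x Hx. apply H. unfold Rmin, Rmax in Hx; destruct (Rle_dec u v); lra. }
  assert (Hvu : Rabs (v - u) < e / (M + 1)) by (apply Rabs_def1; lra).
  eapply Rle_lt_trans; [exact Hb|].
  assert ((M + 1) * Rabs (v - u) < (M + 1) * (e / (M + 1))) by (apply Rmult_lt_compat_l; lra).
  replace ((M + 1) * (e / (M + 1))) with (pos e) in * by (field; lra). abs_ge0 (v - u). nra.
Qed.

Lemma little_o_derive (f : R -> R) (x l : R) :
  (forall e, 0 < e -> exists r, 0 < r /\ forall y, Rabs (y - x) < r -> Rabs (f y - f x - l * (y - x)) <= e * Rabs (y - x)) ->
  is_derive f x l.
Proof.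
intros H. apply is_derive_Reals. intros e He. destruct (H (e / 2) ltac:(lra)) as (r & Hr & Hb).
exists (mkposreal r Hr). intros t Ht Hlt; simpl in Hlt.
specialize (Hb (x + t)). replace (x + t - x) with t in Hb by ring. specialize (Hb Hlt).
replace ((f (x + t) - f x) / t - l) with ((f (x + t) - f x - l * t) / t) by (field; auto).
assert (Hp : 0 < Rabs t) by (now apply Rabs_pos_lt).
unfold Rdiv at 1; rewrite Rabs_mult, Rabs_inv.
apply Rmult_lt_reg_r with (Rabs t); auto. rewrite Rmult_assoc, Rinv_l by lra. nra.
Qed.

Lemma rsum_le (g k : nat -> R) n : (forall i, (i < n)%nat -> g i <= k i) -> rsum g n <= rsum k n.
Proof.
induction n as [|n IH]; intros H; simpl; [lra|].
pose proof (H n ltac:(lia)). assert (rsum g n <= rsum k n) by (apply IH; intros; apply H; lia). lra.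
Qed.

Lemma rsum_scal (g : nat -> R) k n : rsum (fun i => k * g i) n = k * rsum g n.
Proof. induction n as [|n IH]; simpl; [ring|rewrite IH; ring]. Qed.

Lemma lipschitz_abs_cont (f : R -> R) a b M : 0 <= M ->
  (forall s t, a <= s -> s <= t -> t <= b -> Rabs (f t - f s) <= M * (t - s)) -> abs_cont_on f a b.
Proof.
intros HM H eps He. exists (eps / (M + 1)); split; [apply Rdiv_lt_0_compat; lra|].
intros n s t Hst _ Hsum.
apply Rle_lt_trans with (M * rsum (fun i => t i - s i) n).
- rewrite <- rsum_scal. apply rsum_le. intros i Hi. destruct (Hst i Hi) as (H1 & H2 & H3). apply H; auto.
- assert (M * rsum (fun i => t i - s i) n <= M * (eps / (M + 1))) by (apply Rmult_le_compat_l; lra).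
  assert (M * (eps / (M + 1)) < (M + 1) * (eps / (M + 1))).
  { apply Rmult_lt_compat_r; [apply Rdiv_lt_0_compat|]; lra. }
  replace ((M + 1) * (eps / (M + 1))) with eps in * by (field; lra). lra.
Qed.

(* Stieltjes inversion for a Herglotz function [p + i h] with boundary values [w + i f] on [(0, oo)];
   [b 0] has a limit at the origin although [p + i h] may not. *)
Section Inversion.
Variables (p h b a V : R -> R -> R) (w f : R -> R) (d : R).
Hypothesis HV : potentials p h b a V.
Hypothesis h_cont : forall x y, 0 < y -> continuous (fun t => h t y) x.
Hypothesis boundary : forall lam, 0 < lam -> forall th, 0 < th -> exists rho, 0 < rho /\
  forall x y, Rabs (x - lam) < rho -> 0 < y < rho -> Rabs (p x y - w lam) <= th /\ Rabs (h x y - f lam) <= th.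
Hypothesis origin : filterlim (b 0) (at_right 0) (locally d).

(** The vertical derivative of [b lam] is [p], which [boundary] keeps bounded near [lam]. *)
Lemma b_limit lam : 0 < lam -> exists l, filterlim (b lam) (at_right 0) (locally l).
Proof.
intros Hl. destruct (boundary lam Hl 1 Rlt_0_1) as (rho & Hr & Hb).
apply (lipschitz_limit_0 (b lam) (p lam) rho (Rabs (w lam) + 1)); auto.
intros y Hy. destruct (HV lam y (proj1 Hy)) as (_ & H2 & _). split; [exact H2|].
destruct (Hb lam y) as (H & _); auto. { rewrite Rminus_diag, Rabs_R0; auto. }
pose proof (Rabs_triang_inv (p lam y) (w lam)). lra.
Qed.

Lemma h_integral lam eps : 0 < eps -> RInt (fun t => h t eps) 0 lam = b lam eps - b 0 eps.
Proof.
intros He. apply (is_RInt_unique (V:=R_CompleteNormedModule)).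
apply (is_RInt_derive (V:=R_CompleteNormedModule) (fun t => b t eps)); intros x _; [|now apply h_cont].
destruct (HV x eps He) as (H & _). exact H.
Qed.

(** Because [boundary] allows approach from every direction, [f lam] and [f x] are both close to the
    same value [h x y] at one small height. *)
Lemma density_continuous lam : 0 < lam -> continuous f lam.
Proof.
intros Hl. apply continuity_pt_filterlim. intros e He.
destruct (boundary lam Hl (e / 3) ltac:(lra)) as (r1 & Hr1 & H1).
assert (Hm : 0 < Rmin r1 lam) by (apply Rmin_pos; auto).
exists (Rmin r1 lam); split; auto. intros x (_ & Hx). simpl in Hx |- *; unfold Rdist in *.
min_le r1 lam.
assert (Hx0 : 0 < x) by (apply Rabs_def2 in Hx; lra).
destruct (boundary x Hx0 (e / 3) ltac:(lra)) as (r2 & Hr2 & H2).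
assert (Hy : 0 < Rmin r1 r2 / 2) by (assert (0 < Rmin r1 r2) by (apply Rmin_pos; auto); lra).
min_le r1 r2.
destruct (H1 x (Rmin r1 r2 / 2)) as (_ & E1); try lra.
destruct (H2 x (Rmin r1 r2 / 2)) as (_ & E2); try lra. { rewrite Rminus_diag, Rabs_R0; auto. }
apply Rabs_le_between in E1, E2. apply Rabs_def1; lra.
Qed.

Lemma inversion_limit lam l : filterlim (b lam) (at_right 0) (locally l) ->
  filterlim (fun eps => / PI * RInt (fun t => h t eps) 0 lam) (at_right 0) (locally (/ PI * (l - d))).
Proof.
intros Hb. apply at_right_0_lim. intros e He.
assert (Hpi : 0 < PI) by apply PI_RGT_0.
assert (Hip : 0 < / PI) by now apply Rinv_0_lt_compat.
assert (Hpe : 0 < PI * e / 2) by nra.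
destruct (at_right_0_lim_inv _ _ Hb _ Hpe) as (r1 & Hr1 & H1).
destruct (at_right_0_lim_inv _ _ origin _ Hpe) as (r2 & Hr2 & H2).
exists (Rmin r1 r2); split; [apply Rmin_pos; auto|]. intros y Hy.
min_le r1 r2.
specialize (H1 y ltac:(lra)); specialize (H2 y ltac:(lra)). rewrite h_integral by lra.
replace (/ PI * (b lam y - b 0 y) - / PI * (l - d)) with (/ PI * ((b lam y - l) - (b 0 y - d))) by ring.
rewrite Rabs_mult, (Rabs_right (/ PI)) by lra.
apply Rmult_le_reg_l with PI; auto. rewrite <- Rmult_assoc, Rinv_r, Rmult_1_l by lra.
unfold Rminus at 1. eapply Rle_trans; [apply Rabs_triang|]. rewrite Rabs_Ropp. lra.
Qed.

(** Stands for the spectral function, of which only the defining limit on the positive half-line is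
    available. *)
Variable N : R -> R.
Hypothesis HN : forall lam, 0 < lam ->
  filterlim (fun eps => / PI * RInt (fun t => h t eps) 0 lam) (at_right 0) (locally (N lam)).

Lemma distribution_value lam l : 0 < lam -> filterlim (b lam) (at_right 0) (locally l) -> N lam = / PI * (l - d).
Proof.
intros Hl Hb.
apply (filterlim_locally_unique (F := at_right 0) (fun eps => / PI * RInt (fun t => h t eps) 0 lam));
  [now apply HN|now apply inversion_limit].
Qed.

(** The mean value theorem is used at a fixed small height, where [h] is within [PI * e] of [f lam]
    on the whole segment; the increment bound is then uniform in the height and survives its
    limit. *)
Lemma distribution_derive lam : 0 < lam -> is_derive N lam (/ PI * f lam).
Proof.
intros Hl. assert (Hpi : 0 < PI) by apply PI_RGT_0.
assert (Hip : 0 < / PI) by now apply Rinv_0_lt_compat.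
apply little_o_derive. intros e He.
destruct (boundary lam Hl (PI * e) ltac:(nra)) as (r & Hr & Hb).
exists (Rmin r lam); split; [apply Rmin_pos; auto|]. intros x Hx.
min_le r lam.
assert (Hx0 : 0 < x) by (apply Rabs_def2 in Hx; lra).
destruct (b_limit lam Hl) as (l0 & L0). destruct (b_limit x Hx0) as (l1 & L1).
rewrite (distribution_value lam l0 Hl L0), (distribution_value x l1 Hx0 L1).
assert (Hlim : Rabs (l1 - l0 - f lam * (x - lam)) <= PI * e * Rabs (x - lam)).
{ apply le_epsilon; intros t Ht.
  destruct (at_right_0_lim_inv _ _ L0 (t / 2) ltac:(lra)) as (r1 & Hr1 & H1).
  destruct (at_right_0_lim_inv _ _ L1 (t / 2) ltac:(lra)) as (r2 & Hr2 & H2).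
  set (y := Rmin r (Rmin r1 r2) / 2).
  assert (Hy0 : 0 < Rmin r (Rmin r1 r2)) by (repeat apply Rmin_pos; auto).
  min_le r (Rmin r1 r2).
  min_le r1 r2.
  assert (Hy : 0 < y) by (unfold y; lra).
  specialize (H1 y ltac:(unfold y; lra)); specialize (H2 y ltac:(unfold y; lra)).
  assert (Hm : Rabs ((b x y - f lam * x) - (b lam y - f lam * lam)) <= PI * e * Rabs (x - lam)).
  { apply (mvt_bound (fun t => b t y - f lam * t) (fun t => h t y - f lam)). intros z Hz. split.
    - destruct (HV z y Hy) as (D & _). eapply is_derive_eq; [der idtac|cbv beta; ring].
    - apply Hb; [|unfold y; lra].
      apply Rabs_def2 in Hx. unfold Rmin, Rmax in Hz; destruct (Rle_dec lam x); apply Rabs_def1; lra. }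
  apply Rabs_def2 in H1, H2. apply Rabs_le_between in Hm. apply Rabs_le; split; lra. }
replace (/ PI * (l1 - d) - / PI * (l0 - d) - / PI * f lam * (x - lam)) with (/ PI * (l1 - l0 - f lam * (x - lam))) by ring.
rewrite Rabs_mult, (Rabs_right (/ PI)) by lra.
apply Rmult_le_reg_l with PI; auto. rewrite <- Rmult_assoc, Rinv_r, Rmult_1_l by lra. lra.
Qed.

Lemma distribution_abs_cont a' b' : 0 < a' -> a' < b' -> abs_cont_on N a' b'.
Proof.
intros Ha Hab. assert (Hip : 0 < / PI) by apply Rinv_0_lt_compat, PI_RGT_0.
destruct (bounded_on f a' b') as (M & HM & Hb); [lra|intros; apply density_continuous; lra|].
apply (lipschitz_abs_cont N a' b' (/ PI * M)); [apply Rmult_le_pos; lra|].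
intros s t Hs Hst Ht. rewrite <- (Rabs_right (t - s)) by lra.
apply (mvt_bound N (fun x => / PI * f x)). rewrite Rmin_left, Rmax_right by lra. intros x Hx. split.
- apply distribution_derive; lra.
- rewrite Rabs_mult, (Rabs_right (/ PI)) by lra. apply Rmult_le_compat_l; [lra|]. apply Hb; lra.
Qed.

End Inversion.

(** * The two classes of potentials and the spectral density *)

Lemma potential_conditions (c : nat -> R) (A : R) : 0 < A ->
  (forall x, 0 < x -> ex_series (fun n => c (S (S n)) * x ^ n)) ->
  (exists x0, 0 < x0 /\
     (L1_from (qfun c) x0 \/
      (L1_from (Derive (qfun c)) x0 /\ AC_loc_from (qfun c) x0 /\
       filterlim (qfun c) (Rbar_locally p_infty) (locally 0)))) ->
  (exists B G (g : R -> R), 0 <= B /\ 0 <= G /\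
    (forall x, A <= x -> continuous g x /\ 0 <= g x /\ Rabs (qfun c x) <= B + g x) /\
    (forall X, A <= X -> RInt g A X <= G)) /\
  (exists x1 (s0 ds : R -> R),
    (forall x, x1 <= x -> is_derive s0 x (ds x) /\ continuous ds x) /\
    (forall e, 0 < e -> exists X, forall x, X <= x -> Rabs (s0 x) <= e) /\
    (forall e, 0 < e -> exists X, forall a b, X <= a -> a <= b ->
       RInt (fun x => Rabs (qfun c x - s0 x) + Rabs (ds x)) a b <= e)).
Proof.
intros HA Hc (x0 & Hx0 & Hq). set (q := qfun c) in *.
assert (qC : forall x, 0 < x -> continuous q x) by (intros; now apply qfun_continuous).
destruct Hq as [HL1|(HL1 & _ & Hlim)].
- set (g := fun x => Rabs (q x)).
  assert (gC : forall x, 0 < x -> continuous g x) by (intros x Hx; apply cont_Abs; auto).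
  assert (g0 : forall x, 0 <= g x) by (intros; apply Rabs_pos).
  split.
  + destruct (gen_int_bounded g x0) as (B & HB); auto; [intros; apply gC; lra|].
    (* [A] may lie on either side of [x0], so all integrals are compared from the smaller of the
       two. *)
    set (m := Rmin A x0). assert (Hm : 0 < m) by (apply Rmin_pos; auto).
    pose proof (Rmin_l A x0) as M1; pose proof (Rmin_r A x0) as M2; fold m in M1, M2.
    assert (gm : forall x, m <= x -> continuous g x) by (intros; apply gC; lra).
    assert (G0 : 0 <= RInt g m x0) by (apply RInt_from_nonneg with m; auto; lra).
    assert (HB0 : 0 <= B) by (specialize (HB x0 (Rle_refl _)); rewrite RInt_point in HB; exact HB).
    exists 0, (RInt g m x0 + B), g. split; [lra|split; [lra|split]].
    * intros x Hx. split; [apply gC; lra|split; auto]. unfold g; lra.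
    * intros X HX. max_ge X x0. specialize (HB (Rmax X x0) ltac:(lra)).
      assert (E1 := RInt_from_Chasles g m m A (Rmax X x0) gm ltac:(lra) ltac:(lra) ltac:(lra)).
      assert (E2 := RInt_from_Chasles g m A X (Rmax X x0) gm ltac:(lra) ltac:(lra) ltac:(lra)).
      assert (E3 := RInt_from_Chasles g m m x0 (Rmax X x0) gm ltac:(lra) ltac:(lra) ltac:(lra)).
      assert (0 <= RInt g m A) by (apply RInt_from_nonneg with m; auto; lra).
      assert (0 <= RInt g X (Rmax X x0)) by (apply RInt_from_nonneg with m; auto; lra). lra.
  + exists x0, (fun _ => 0), (fun _ => 0). split; [|split].
    * intros x _; split; [apply derC|apply cont_C].
    * intros e He; exists 0; intros; rewrite Rabs_R0; lra.
    * intros e He. destruct (gen_int_tail g x0) with (e := e) as (X & HX & Ht); auto; [intros; apply gC; lra|].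
      exists X; intros a b Ha Hb. rewrite (RInt_ext _ g); auto.
      intros x _. unfold g. rewrite Rabs_R0, Rminus_0_r, Rplus_0_r; reflexivity.
- assert (Hl : forall e, 0 < e -> exists X, forall x, X <= x -> Rabs (q x) <= e).
  { intros e He. destruct (Hlim (fun z => Rabs (z - 0) < e)) as (X & HX).
    { exists (mkposreal e He); intros z Hz; exact Hz. }
    exists (X + 1); intros x Hx. specialize (HX x ltac:(lra)). rewrite Rminus_0_r in HX. lra. }
  assert (qD : forall x, 0 < x -> is_derive q x (Derive q x)).
  { intros x Hx. apply Derive_correct. eexists. now apply qfun_derive. }
  assert (dC : forall x, 0 < x -> continuous (Derive q) x).
  { intros x Hx. apply continuous_ext_loc with (qder c); [|now apply qder_continuous].
    exists (mkposreal x Hx); intros y Hy.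
    unball Hy.
    apply Rabs_def2 in Hy. symmetry; apply is_derive_unique, qfun_derive; auto; lra. }
  split.
  + destruct (Hl 1 Rlt_0_1) as (X & HX).
    max_ge A X.
    destruct (bounded_on q A (Rmax A X)) as (M & HM0 & HM); [lra|intros; apply qC; lra|].
    exists (M + 1), 0, (fun _ => 0). split; [lra|split; [lra|split]].
    * intros x Hx. split; [apply cont_C|split; [lra|]].
      destruct (Rle_dec x (Rmax A X)) as [Hle|Hgt].
      -- specialize (HM x ltac:(lra)); lra.
      -- specialize (HX x ltac:(lra)); lra.
    * intros Y _. rewrite RInt_const. unfold scal; simpl; unfold mult; simpl. lra.
  + exists x0, q, (Derive q). split; [|split; [exact Hl|]].
    * intros x Hx; split; [apply qD; lra|apply dC; lra].
    * intros e He. destruct (gen_int_tail (fun x => Rabs (Derive q x)) x0) with (e := e) as (X & HX & Ht); auto.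
      -- intros x Hx; apply cont_Abs, dC; lra.
      -- intros; apply Rabs_pos.
      -- exists X; intros a b Ha Hb. rewrite (RInt_ext _ (fun x => Rabs (Derive q x))); auto.
         intros x _. rewrite Rminus_diag, Rabs_R0, Rplus_0_l; reflexivity.
Qed.

Theorem theorem1
  (c : nat -> R) (A : R)
  (P1 Q1 R1 : R -> R -> R)              (* U_1(x,lam) = (P1 x lam, Q1 x lam, R1 x lam) *)
  (u du v dv : R -> R -> R)             (* u(x,lam), u'(x,lam), v(x,lam), v'(x,lam) *)
  (at_ bt ct : R -> R) :                (* a~(lam), b~(lam), c~(lam) *)
  0 < A ->
  (forall x, 0 < x -> ex_series (fun n => c (S (S n)) * x ^ n)) ->
  -/4 <= c O ->
  (c O <> 0 \/ c 1%nat <> 0) ->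
  (exists x0, 0 < x0 /\
     (L1_from (qfun c) x0 \/
      (L1_from (Derive (qfun c)) x0 /\ AC_loc_from (qfun c) x0 /\
       filterlim (qfun c) (Rbar_locally p_infty) (locally 0)))) ->
  (* U_1 solves the Appell system and has the prescribed limit at infinity *)
  (forall lam, 0 < lam ->
     (forall x, A <= x ->
        is_derive (fun y => P1 y lam) x ((lam - qfun c x) * Q1 x lam) /\
        is_derive (fun y => Q1 y lam) x (-2 * P1 x lam + 2 * (lam - qfun c x) * R1 x lam) /\
        is_derive (fun y => R1 y lam) x (- Q1 x lam)) /\
     filterlim (fun x => P1 x lam) (Rbar_locally p_infty) (locally (sqrt lam)) /\
     filterlim (fun x => Q1 x lam) (Rbar_locally p_infty) (locally 0) /\
     filterlim (fun x => R1 x lam) (Rbar_locally p_infty) (locally (/ sqrt lam))) ->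
  (* u, v solve -y'' + q y = lam y with the initial conditions at A *)
  (forall lam, 0 < lam ->
     (forall x, A <= x ->
        is_derive (fun y => u y lam) x (du x lam) /\
        is_derive (fun y => du y lam) x ((qfun c x - lam) * u x lam) /\
        is_derive (fun y => v y lam) x (dv x lam) /\
        is_derive (fun y => dv y lam) x ((qfun c x - lam) * v x lam)) /\
     u A lam = 1 /\ du A lam = 0 /\ v A lam = 0 /\ dv A lam = 1) ->
  (* the representation of U_1 with coefficients a~, b~, c~ *)
  (forall lam, 0 < lam -> forall x, A <= x ->
     P1 x lam = at_ lam * du x lam ^ 2 + bt lam * (du x lam * dv x lam)
                + ct lam * dv x lam ^ 2 /\
     Q1 x lam = at_ lam * (-2 * u x lam * du x lam)
                + bt lam * (- (u x lam * dv x lam + du x lam * v x lam))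
                + ct lam * (-2 * v x lam * dv x lam) /\
     R1 x lam = at_ lam * u x lam ^ 2 + bt lam * (u x lam * v x lam)
                + ct lam * v x lam ^ 2) ->
  (* conclusion *)
  (forall a b, 0 < a -> a < b -> abs_cont_on (rhoA c A) a b) /\
  (forall lam, 0 < lam ->
     filterlim (rho_approx c A lam) (at_right 0) (locally (rhoA c A lam)) /\
     is_derive (rhoA c A) lam (/ (PI * at_ lam)) /\
     filterlim (fun eps => / PI * Im (mA c A (lam, eps))) (at_right 0)
               (locally (/ (PI * at_ lam))) /\
     alpha2 at_ lam / PI = / (PI * at_ lam) /\
     (forall x, A <= x ->
        / (PI * at_ lam) =
        / (PI * (P1 x lam * v x lam ^ 2 + Q1 x lam * v x lam * dv x lam
                 + R1 x lam * dv x lam ^ 2)))).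
Proof.
intros HA Hc _ _ Hq HU Huv Hrep.
destruct (potential_conditions c A HA Hc Hq) as (Htame & Hasym).
assert (qC : forall x, A <= x -> continuous (qfun c) x) by (intros; apply qfun_continuous; auto; lra).
set (p := fun x y => Re (mA c A (x, y))). set (h := fun x y => Im (mA c A (x, y))).
assert (HW : forall x y, 0 < y -> exists s, weyl (qfun c) A x y (p x y) (h x y) s).
{ intros x y Hy. exact (TW_epsilon (qfun c) A qC Htame x y Hy). }
assert (Hh : forall x y, 0 < y -> 0 <= h x y).
{ intros x y Hy. destruct (HW x y Hy) as (s & W). exact (weyl_h_nonneg (qfun c) A _ _ _ _ _ Hy W). }
destruct (expansion_holo p h Hh (weyl_expansion (qfun c) A p h HW)) as (D1 & D2 & Hholo).
destruct (potentials_exist p h D1 D2 Hholo) as (b & a & V & HV).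
assert (Hhb : exists C, forall x y, Rabs x <= 1 -> 0 < y <= 1 -> h x y <= C / y).
(* Comparison with the point [i] and weight [y / 2] gives [h x y <= h 0 1 + h x y / 2 + 2 * (h 0 1 /
   y)], since [(|x| + |y - 1|) / 2 <= 1]; now absorb the middle term and use
   [h 0 1 <= h 0 1 / y]. *)
{ exists (6 * h 0 1). intros x y Hx Hy.
  destruct (HW x y (proj1 Hy)) as (s & W). destruct (HW 0 1 Rlt_0_1) as (s1 & W1).
  pose proof (weyl_im_compare (qfun c) A _ _ _ _ _ _ _ _ _ _ (y / 2) (proj1 Hy) Rlt_0_1 ltac:(lra) W W1) as H.
  rewrite Rminus_0_r in H. assert (H0 := Hh 0 1 Rlt_0_1). assert (H1 := Hh x y (proj1 Hy)).
  assert (Hy1 : Rabs (y - 1) <= 1) by (apply Rabs_le; lra).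
  replace (y / 2 * h x y / y) with (h x y / 2) in H by (field; lra).
  replace (h 0 1 / (y / 2 * 1)) with (2 * (h 0 1 / y)) in H by (field; lra).
  assert (Hi : h 0 1 <= h 0 1 / y).
  { apply Rmult_le_reg_r with y; [lra|]. replace (h 0 1 / y * y) with (h 0 1) by (field; lra). nra. }
  assert ((Rabs x + Rabs (y - 1)) / 2 * (h x y / 2 + 2 * (h 0 1 / y)) <= 1 * (h x y / 2 + 2 * (h 0 1 / y))).
  { apply Rmult_le_compat_r; lra. }
  replace (6 * h 0 1 / y) with (6 * (h 0 1 / y)) by (field; lra). lra. }
destruct (b_limit_0 p h b a V HV Hh Hhb) as (d & Hd). apply at_right_0_lim in Hd.
assert (Hat : forall lam, 0 < lam -> R1 A lam = at_ lam).
{ intros lam Hl. destruct (Hrep lam Hl A (Rle_refl _)) as (_ & _ & E).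
  destruct (Huv lam Hl) as (_ & U1 & _ & V1 & _). rewrite U1, V1 in E. rewrite E; ring. }
set (w := fun lam => - Q1 A lam / (2 * R1 A lam)). set (f := fun lam => / at_ lam).
assert (Hbv : forall lam, 0 < lam -> forall th, 0 < th -> exists rho, 0 < rho /\
  forall x y, Rabs (x - lam) < rho -> 0 < y < rho -> Rabs (p x y - w lam) <= th /\ Rabs (h x y - f lam) <= th).
{ intros lam Hl th Hth. destruct (HU lam Hl) as (HU1 & HP & HQ & HR).
  destruct (weyl_boundary_value (qfun c) A qC Hasym lam (fun x => P1 x lam) (fun x => Q1 x lam) (fun x => R1 x lam)
    Hl HU1 HP HQ HR th Hth) as (rho & Hrho & H).
  exists rho; split; auto. intros x y Hx Hy. destruct (HW x y (proj1 Hy)) as (s & W).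
  specialize (H x y (p x y) (h x y) s Hx Hy W). unfold f, w. rewrite <- Hat; auto. }
assert (HhC : forall x y, 0 < y -> continuous (fun t => h t y) x).
{ intros x y Hy. destruct (Hholo x y Hy) as ((_ & _ & D & _) & _). exact (der_cont _ _ _ D). }
(* The [epsilon] in [rhoA] is this limit because the limit exists: [b] converges above both
   endpoints [lam] and 0. *)
assert (HN : forall lam, 0 < lam ->
  filterlim (fun eps => / PI * RInt (fun t => h t eps) 0 lam) (at_right 0) (locally (rhoA c A lam))).
{ intros lam Hl. unfold rhoA. apply epsilon_spec.
  destruct (b_limit p h b a V w f HV Hbv lam Hl) as (l & Hbl).
  exists (/ PI * (l - d)).
  exact (inversion_limit p h b a V d HV HhC Hd lam l Hbl). }
split; [intros; now apply (distribution_abs_cont p h b a V w f d HV HhC Hbv Hd (rhoA c A) HN)|].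
intros lam Hl.
assert (Ef : / (PI * at_ lam) = / PI * f lam) by (unfold f; apply Rinv_mult).
split; [exact (HN lam Hl)|split; [|split; [|split]]].
- rewrite Ef. now apply (distribution_derive p h b a V w f d HV HhC Hbv Hd (rhoA c A) HN).
- rewrite Ef. apply at_right_0_lim. intros e He.
  assert (Hpi : 0 < PI) by apply PI_RGT_0. assert (Hip : 0 < / PI) by now apply Rinv_0_lt_compat.
  destruct (Hbv lam Hl (PI * e) ltac:(nra)) as (r & Hr & H). exists r; split; auto. intros y Hy.
  destruct (H lam y) as (_ & E); auto. { rewrite Rminus_diag, Rabs_R0; auto. }
  fold (h lam y). rewrite <- Rmult_minus_distr_l, Rabs_mult, (Rabs_right (/ PI)) by lra.
  apply Rmult_le_reg_l with PI; auto. rewrite <- Rmult_assoc, Rinv_r, Rmult_1_l by lra. exact E.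
- rewrite Ef. unfold alpha2, f, Rdiv. ring.
- intros x Hx. destruct (Hrep lam Hl x Hx) as (EP & EQ & ER).
  destruct (Huv lam Hl) as (Hder & U1 & U2 & V1 & V2).
  (* On substituting the representation, the terms in [bt] and [ct] cancel and those in [at_]
     combine to [at_ lam] times the squared Wronskian. *)
  assert (Wr : u x lam * dv x lam - du x lam * v x lam = 1).
  { rewrite (der_zero (fun x => u x lam * dv x lam - du x lam * v x lam) A x Hx).
    - rewrite U1, U2, V1, V2; ring.
    - intros t Ht. destruct (Hder t ltac:(lra)) as (E1 & E2 & E3 & E4).
      eapply is_derive_eq; [der idtac|cbv beta; ring]. }
  do 2 f_equal. rewrite EP, EQ, ER.
  match goal with |- _ = ?r => replace r with (at_ lam * (u x lam * dv x lam - du x lam * v x lam) ^ 2) by ring end.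
  rewrite Wr; ring.
Qed.
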